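(* Let $n\ge 1$ and $N\ge 2$. There is a constant $C>0$, depending only on $n$ and $N$, such that every minimizer $U$ of $J_N$ in the unit ball $B_1\subset\mathbb R^n$ is Lipschitz continuous in $B_{1/2}$ and satisfies $$\|U\|_{C^{0,1}(B_{1/2})}\le C\left(1+\|U\|_{L^2(B_1)}\right).$$
   Context: For a bounded Lipschitz domain $\Omega\subset\mathbb R^n$ and $N\ge2$, let $\mathcal A=\{U=(u_1,\dots,u_N)\in H^1(\Omega;\mathbb R^N): u_1\ge u_2\ge\dots\ge u_N \text{ a.e.}\}$ and $$J_N(U,\Omega)=\int_\Omega\big(|\nabla U|^2+W(U)\big)\,dx,\qquad |\nabla U|^2=\sum_{i=1}^N|\nabla u_i|^2,\qquad W(U)=\sum_{i=1}^{N-1}\chi_{\{u_i>u_{i+1}\}}.$$ $U\in\mathcal A$ is a minimizer of $J_N$ in $\Omega$ if $J_N(U,\Omega)\le J_N(V,\Omega)$ for all $V\in\mathcal A$ with $V-U\in H^1_0(\Omega)$. $B_r$ denotes the ball of radius $r$ centered at $0$. *)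

(* Defs.v *)
From HB Require Import structures.
From mathcomp Require Import all_boot all_order all_algebra.
From mathcomp Require Import all_classical all_reals all_analysis.

Set Implicit Arguments.
Unset Strict Implicit.
Unset Printing Implicit Defensive.

Import Order.TTheory GRing.Theory Num.Theory.
Import numFieldNormedType.Exports.

Local Open Scope classical_set_scope.
Local Open Scope ring_scope.

(* The sigma-algebra on 'rV[T]_n generated by the coordinates, following the
   library's construction for n.-tuple T; for T := R this is the Borel
   sigma-algebra of R^n. *)
Section measurable_rV.
Context {d : measure_display} {T : measurableType d} (n : nat).

Let coord : 'I_n -> 'rV[T]_n -> T := fun i x => x 0 i.

Let rV_set0 : g_sigma_preimage coord set0.
Proof. exact: sigma_algebra0. Qed.

Let rV_setC A : g_sigma_preimage coord A -> g_sigma_preimage coord (~` A).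
Proof. exact: sigma_algebraC. Qed.

Let rV_bigcup (F : (set 'rV[T]_n)^nat) :
  (forall i, g_sigma_preimage coord (F i)) ->
  g_sigma_preimage coord (\bigcup_i F i).
Proof. exact: sigma_algebra_bigcup. Qed.

HB.instance Definition _ := @isMeasurable.Build (measure_tuple_display d)
  'rV[T]_n (g_sigma_preimage coord) rV_set0 rV_setC rV_bigcup.

Lemma measurable_coord_rV (i : 'I_n) :
  measurable_fun [set: 'rV[T]_n] (fun x : 'rV[T]_n => x 0 i).
Proof.
move=> _ Y mY; rewrite setTI; apply: sub_sigma_algebra => /=.
rewrite -bigcup_seq/=; exists i => /=; first by rewrite mem_index_enum.
by exists Y => //; rewrite setTI.
Qed.

Lemma measurable_fun_rV d' (X : measurableType d') (f : X -> 'rV[T]_n) :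
  (forall i, measurable_fun [set: X] (fun x => f x 0 i)) ->
  measurable_fun [set: X] f.
Proof.
move=> mf _ Y mY; rewrite setTI.
suff: image_set_system [set: X] f measurable Y.
  by rewrite /image_set_system/= setTI.
apply: mY; split.
  by apply: sigma_algebra_image; exact: sigma_algebra_measurable.
move=> A; rewrite /= -bigcup_seq => -[i _ [B mB <-]].
rewrite /image_set_system/= !setTI.
by have := mf i measurableT B mB; rewrite setTI.
Qed.

End measurable_rV.

(* Lebesgue measure on R^n: the image of leb_n \x leb_1 under
   R^n x R -> R^n.+1, starting from the unit mass on the one point of R^0. *)
Section lebesgue_rV.
Context {R : realType}.

Definition rV_rcons n (p : 'rV[R]_n * measurableTypeR R) : 'rV[R]_n.+1 :=
  \row_i oapp (fun j => p.1 0 j) p.2 (unlift ord_max i).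

Lemma measurable_rV_rcons n : measurable_fun [set: _] (@rV_rcons n).
Proof.
apply: measurable_fun_rV => i.
case: (unliftP ord_max i) => [j ->|->].
  rewrite (_ : (fun _ => _) = (fun x : 'rV[R]_n => x 0 j) \o fst).
    exact: (measurableT_comp (measurable_coord_rV j)).
  by apply/funext => p /=; rewrite mxE liftK.
rewrite (_ : (fun _ => _) = snd); first exact: measurable_snd.
by apply/funext => p /=; rewrite mxE unlift_none.
Qed.

Definition lebesgue_rVS n (m : {measure set 'rV[R]_n -> \bar R}) :
    {measure set 'rV[R]_n.+1 -> \bar R} :=
  measure_function_pushforward__canonical__measure_function_Measure
    (m \x (@lebesgue_measure R))%E (@measurable_rV_rcons n).

Fixpoint lebesgue_rV n : {measure set 'rV[R]_n -> \bar R} :=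
  if n is n'.+1 then lebesgue_rVS (lebesgue_rV n') else \d_ (0 : 'rV[R]_0).

Lemma lebesgue_rV_box n (A : 'I_n -> set (measurableTypeR R)) :
  (forall i, measurable (A i)) ->
  lebesgue_rV n [set x | forall i, A i (x 0 i)] =
  (\prod_(i < n) lebesgue_measure (A i))%E.
Proof.
elim: n A => [|n IH] A mA.
  rewrite big_ord0 /= diracE mem_set//=; by case.
rewrite big_ord_recr/= -IH//.
have liftE (i : 'I_n) : lift ord_max i = widen_ord (leqnSn n) i.
  by apply/val_inj; rewrite /= /bump leqNgt ltn_ord.
have mbox : measurable [set x : 'rV[R]_n |
    forall i, A (widen_ord (leqnSn n) i) (x 0 i)].
  rewrite (_ : mkset _ = \bigcap_(i in [set: 'I_n])
    ((fun x : 'rV[R]_n => x 0 i) @^-1` A (widen_ord (leqnSn n) i))).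
    apply: fin_bigcap_measurable => // i _; rewrite -[X in measurable X]setTI.
    exact: (@measurable_coord_rV _ R n i measurableT _ (mA _)).
  by apply/seteqP; split => x xA i; [move=> _|]; exact: xA.
rewrite -product_measure1E// /pushforward; congr (_ _).
apply/seteqP; split=> -[x y] /=.
  move=> xyA; split=> [i|].
    have := xyA (lift ord_max i); rewrite mxE liftK/=.
    by rewrite liftE.
  by have := xyA ord_max; rewrite mxE unlift_none.
move=> [xA yA] i; rewrite mxE; case: (unliftP ord_max i) => [j ->|->//] /=.
by rewrite liftE; exact: xA.
Qed.

End lebesgue_rV.

(* The library's norm on 'rV[R]_n is the sup norm; balls, moduli of vectors and
   the Lipschitz seminorm below are Euclidean. *)
Section euclidean.
Context {R : realType}.

Definition enorm n (x : 'rV[R]_n) : R := Num.sqrt (\sum_i x 0 i ^+ 2).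

Definition eball n (r : R) : set 'rV[R]_n := [set x | enorm x < r].

End euclidean.
Arguments eball {R} n r.

Section sobolev.
Context {R : realType} {n : nat}.
Local Notation leb := (@lebesgue_rV R n).
Implicit Types (D : set 'rV[R]_n) (f g phi : 'rV[R]_n -> R).

Definition partial (i : 'I_n) f : 'rV[R]_n -> R := 'D_(delta_mx 0 i) f.

Definition iter_partial (s : seq 'I_n) f : 'rV[R]_n -> R := foldr partial f s.

Definition smooth f := forall s : seq 'I_n, continuous (iter_partial s f) /\
  forall x i, derivable (iter_partial s f) x (delta_mx 0 i).

Definition test_function D phi := [/\ smooth phi,
  compact (closure [set x | phi x != 0]) &
  closure [set x | phi x != 0] `<=` D].

Definition L2 D f : Prop := f \_ D \in Lfun leb 2%:E.

Definition weak_partial D (i : 'I_n) f g := forall phi, test_function D phi ->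
  \int[leb]_(x in D) (f x * partial i phi x) =
  - \int[leb]_(x in D) (g x * phi x).

Definition H1 D f :=
  L2 D f /\ forall i, exists g, L2 D g /\ weak_partial D i f g.

(* A representative of the i-th weak derivative of f, which is unique up to
   a null set; its value is irrelevant when f is not in H1. *)
Definition wpartial D (i : 'I_n) f : 'rV[R]_n -> R :=
  xget (cst 0) [set g | L2 D g /\ weak_partial D i f g].

Definition H1norm D f : \bar R := ((\int[leb]_(x in D)
  (f x ^+ 2 + \sum_i wpartial D i f x ^+ 2)%:E) `^ (2^-1)%R)%E.

(* The closure of the test functions in H1. *)
Definition H10 D f := H1 D f /\ forall e : R, 0 < e ->
  exists2 phi, test_function D phi & (H1norm D (f \- phi)%R < e%:E)%E.

End sobolev.

Section functional.
Context {R : realType} {n N : nat}.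
Local Notation leb := (@lebesgue_rV R n).
Implicit Types (D : set 'rV[R]_n) (U V : 'rV[R]_n -> 'rV[R]_N).

(* Elements of H^1(D; R^N) are represented by functions on all of R^n, whose
   values outside D play no role. *)
Definition component U (i : 'I_N) : 'rV[R]_n -> R := fun x => U x 0 i.

Definition admissible D U := (forall i, H1 D (component U i)) /\
  {ae leb, forall x, D x ->
    forall i j : 'I_N, j = i.+1 :> nat -> U x 0 j <= U x 0 i}.

Definition grad_sq D U (x : 'rV[R]_n) : R :=
  \sum_(i < N) \sum_(k < n) wpartial D k (component U i) x ^+ 2.

Definition potential (y : 'rV[R]_N) : R :=
  \sum_(i < N) \sum_(j < N | j == i.+1 :> nat) (y 0 j < y 0 i)%R%:R.

Definition JN D U : \bar R :=
  (\int[leb]_(x in D) (grad_sq D U x + potential (U x))%:E)%E.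

Definition minimizer D U := admissible D U /\ forall V, admissible D V ->
  (forall i, H10 D (component V i \- component U i)) -> (JN D U <= JN D V)%E.

Definition L2norm D U : \bar R :=
  'N[leb]_2%:E[EFin \o ((@enorm R N \o U) \_ D)].

Definition C01norm D U : \bar R :=
  (ereal_sup [set (enorm (U x))%:E | x in D] +
   ereal_sup [set r | exists x y, [/\ D x, D y, x != y &
     r = (enorm (U x - U y) / enorm (x - y))%:E]])%E.

End functional.

(* Main.v *)
Require Import Defs.
From HB Require Import structures.
From mathcomp Require Import all_boot all_order all_algebra.
From mathcomp Require Import all_classical all_reals all_analysis.
From mathcomp Require Import measurable_realfun ring lra.

(* For test functions phi_1, ..., phi_N, sorting U + phi pointwise in decreasing
   order gives an admissible competitor: sorting does not increase the Dirichlet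
   energy, because max and min of two H^1 functions are (u + v +- |u - v|) / 2.
   Comparing energies yields, for the averages M u y r of u against a radial
   kernel of radius r centred at y, two facts.  First, perturbing one component
   by r times a bump of radius r gives |int u_i Lap(bump)| <= C r^(n-1), hence
   M u_i y r is C-Lipschitz in r.  Second, W of a sorted vector is the number of
   its distinct values minus one, so if u_i > u_(i+1) a.e. on a ball, moving
   u_1, ..., u_i simultaneously does not increase W, and S_i = u_1 + ... + u_i
   is weakly harmonic there: M S_i y r does not depend on r.
   The Lipschitz bound compares a_i = |M S_i y s - M S_i z s| along dyadic scales
   s = s_k down to |y - z|.  If u_i and u_(i+1) are separated on the ball of
   radius 3 s_k / 2 at y, then a_i is the same at s_k and at s_(k+1).  If they
   touch there, u_i - u_(i+1) >= 0 has small averages near the contact point, and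
   2 S_i - S_(i-1) - S_(i+1) = u_i - u_(i+1) yields
   2 a_i <= a_(i-1) + a_(i+1) + C |y - z|.  A discrete maximum principle bounds
   the remaining a_i by the separated ones, and since the set of separated
   indices only grows with k, errors accumulate at most N + 1 times. *)


Set Implicit Arguments.
Unset Strict Implicit.
Unset Printing Implicit Defensive.

Import Order.TTheory GRing.Theory Num.Theory.
Import numFieldNormedType.Exports.

Local Open Scope classical_set_scope.
Local Open Scope ring_scope.

(** * Lebesgue measure on R^n *)

Section lebesgue_rV_theory.
Context {R : realType}.
Implicit Types n : nat.

(** The averages use a smooth radial kernel whose profile [bumpf 2] is chosen so that its derivative
    in the radius is a multiple of the Laplacian of the bump [bumpf 0]. A bound on the first
    variation against smooth bumps is thus a bound on the derivative of [M u y r] in [r]. The bump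
    is given amplitude r because the Dirichlet cost r^2 r^(n-2) and the change of W are then both of
    order r^n. The obstacle is that a component separated from the next one may still coincide with
    the previous one, so that it need not be harmonic by itself; only the partial sums are, and a
    contact point yields nothing but an inequality between three consecutive sums. Moreover elements
    of H^1 have no pointwise values and the sets {u_i > u_(i+1)} are not known to be open.
    Separation and contact are therefore tested, scale by scale, on the representative [avg_lim],
    the limit of the averages. The test concerns balls around y alone; the condition 4 |y - z| <=
    s_k makes it serve z as well. *)

Lemma ball_rVE n (y : 'rV[R]_n) (r : R) : 0 < r ->
  ball y r = [set x | forall i, y 0 i - r < x 0 i < y 0 i + r].
Proof.
move=> r0; apply/seteqP; split => x /=.
  by move=> -[_ H] i; have := H 0 i; rewrite /ball /= ltr_distlC.
by move=> H; split => // a i; rewrite ord1 /ball /= ltr_distlC.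
Qed.

Lemma measurable_rV_box n (A : 'I_n -> set R) :
  (forall i, measurable (A i)) ->
  measurable [set x : 'rV[R]_n | forall i, A i (x 0 i)].
Proof.
move=> mA.
rewrite (_ : mkset _ = \bigcap_(i in [set: 'I_n])
    ((fun x : 'rV[R]_n => x 0 i) @^-1` A i)).
  apply: fin_bigcap_measurable => // i _; rewrite -[X in measurable X]setTI.
  exact: (@measurable_coord_rV _ R n i measurableT _ (mA _)).
by apply/seteqP; split => x xA i; [move=> _|]; exact: xA.
Qed.

Lemma measurable_rV_ball n (y : 'rV[R]_n) r : measurable (ball y r).
Proof.
have [r0|r0] := ltP 0 r; last first.
  by rewrite (_ : ball y r = set0)// -subset0 => x -[]; rewrite ltNge r0.
rewrite ball_rVE//; apply: (@measurable_rV_box n (fun i => `]y 0 i - r, y 0 i + r[%classic)) => i.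
exact: measurable_itv.
Qed.

(** The sigma-algebra is generated by coordinates, so openness is reduced to countably many boxes:
    [A] is the union of the sup-norm balls with rational centre and radius 1/(k+1) that it
    contains. *)
Lemma open_measurable_rV n (A : set 'rV[R]_n) : open A -> measurable A.
Proof.
move=> oA.
pose F (p : 'rV[rat]_n * nat) : set 'rV[R]_n :=
  let B := ball (map_mx ratr p.1 : 'rV[R]_n) p.2.+1%:R^-1 in
  if `[< B `<=` A >] then B else set0.
have -> : A = \bigcup_p F p.
  apply/seteqP; split => x; last first.
    by case=> p _; rewrite /F; case: asboolP => // + ; exact.
  move=> Ax; have /nbhs_ballP[e /= e0 eA] : nbhs x A by exact: open_nbhs_nbhs.
  (* Half of [e], because a ball of this radius containing [x] can reach twice as far from [x]. *)
  have [k ke] : exists k : nat, k.+1%:R^-1 < e / 2 :> R.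
    have := @near_infty_natSinv_lt R (PosNum (divr_gt0 e0 (ltr0n _ 2))).
    by case=> k _ /(_ k (leqnn k)) kk; exists k.
  have k0 : 0 < k.+1%:R^-1 :> R by rewrite invr_gt0.
  have /choice[q Hq] : forall i : 'I_n, exists q : rat,
      x 0 i - k.+1%:R^-1 < ratr q < x 0 i + k.+1%:R^-1.
    move=> i; have /rat_in_itvoo[q] : x 0 i - k.+1%:R^-1 < x 0 i + k.+1%:R^-1.
      by rewrite ltrBlDr -addrA ltrDl addr_gt0.
    by rewrite in_itv/= => Hq; exists q.
  have xq : ball (map_mx ratr (\row_i q i) : 'rV[R]_n) k.+1%:R^-1 x.
    rewrite ball_rVE//= => i; rewrite !mxE; have /andP[h1 h2] := Hq i.
    by rewrite ltrBlDr h2 -ltrBlDr h1.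
  exists (\row_i q i, k) => //; rewrite /F /=; case: asboolP => // H.
  exfalso; apply: H => z zq; apply: eA.
  apply: (@le_ball _ _ _ (k.+1%:R^-1 + k.+1%:R^-1)).
      by move: ke; move: (k.+1%:R^-1) => d; lra.
  by apply: ball_triangle zq; apply: ball_sym.
apply: countable_bigcupT_measurable => [|p]; first exact: countableP.
by rewrite /F; case: asboolP => // _; exact: measurable_rV_ball.
Qed.

Lemma continuous_measurable_rV n (f : 'rV[R]_n -> R) :
  continuous f -> measurable_fun [set: 'rV[R]_n] f.
Proof.
move=> cf; apply: (measurability _ (measurable_realfun.RGenOpens.measurableE R)) => _ [_ [a [b ->] <-]].
rewrite setTI; apply: open_measurable_rV.
by apply: open_comp => // x _; exact: cf.
Qed.

(** A named head for the measure that [lebesgue_rV] returns already packed; the sigma-finite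
    instance required by Tonelli's theorem is attached to this name. *)
Definition leb n : set 'rV[R]_n -> \bar R := lebesgue_rV n.
Arguments leb n : clear implicits.
HB.instance Definition _ n := Measure.copy (leb n) (lebesgue_rV n).

Lemma leb_box n (A : 'I_n -> set R) : (forall i, measurable (A i)) ->
  leb n [set x | forall i, A i (x 0 i)] = (\prod_(i < n) lebesgue_measure (A i))%E.
Proof. exact: lebesgue_rV_box. Qed.

Lemma leb_ball n (y : 'rV[R]_n) r : 0 < r ->
  leb n (ball y r) = ((r *+ 2) ^+ n)%:E.
Proof.
move=> r0; rewrite ball_rVE//.
rewrite (@leb_box n (fun i => `]y 0 i - r, y 0 i + r[%classic)); last first.
  by move=> i; exact: measurable_itv.
rewrite (eq_bigr (fun=> (r *+ 2)%:E)).
  by rewrite prodEFin prodr_const card_ord.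
move=> i _; rewrite lebesgue_measure_itv/= lte_fin ifT; last by lra.
by rewrite -EFinD; congr (_%:E); lra.
Qed.

Lemma leb_sigma_finite n : sigma_finite [set: 'rV[R]_n] (leb n).
Proof.
exists (fun k => ball (0 : 'rV[R]_n) k.+1%:R).
  apply/esym; rewrite -subTset => x _.
  have [k xk] : exists k : nat, `|x| < k.+1%:R.
    by exists (Num.truncn `|x|); rewrite truncnS_gt.
  by exists k => //; rewrite -ball_normE /= sub0r normrN.
move=> k; split; first exact: measurable_rV_ball.
by rewrite leb_ball// ltry.
Qed.

HB.instance Definition _ n := Measure_isSigmaFinite.Build _ _ _ (leb n) (leb_sigma_finite n).

End lebesgue_rV_theory.

Arguments leb {R} n.

(** * Affine changes of variables in R^n *)

Section affine_change_of_variables.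
Context {R : realType}.
Implicit Types n : nat.

Lemma measurable_affine_rV n (r : R) (z : 'rV[R]_n) :
  measurable_fun [set: 'rV[R]_n] (fun x => r *: x + z).
Proof.
apply: measurable_fun_rV => i.
rewrite (_ : (fun _ => _) = (fun x : 'rV[R]_n => r * x 0 i + z 0 i)); last first.
  by apply/funext => x; rewrite !mxE.
apply: measurable_funD => //; apply: measurable_funM => //.
exact: measurable_coord_rV.
Qed.

(** By uniqueness of Lebesgue measure it is enough to compare it with [r] times the image measure on
    half-open intervals. *)
Lemma lebesgue_measure_affine (r z : R) (A : set R) : 0 < r -> measurable A ->
  lebesgue_measure ((fun t => r * t + z) @^-1` A) =
  (r^-1%:E * lebesgue_measure A)%E.
Proof.
move=> r0 mA.
have mf : measurable_fun [set: measurableTypeR R]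
    ((fun t => r * t + z) : measurableTypeR R -> measurableTypeR R).
  by apply: measurable_funD => //; apply: measurable_funM.
pose m := mscale (NngNum (ltW r0))
   (measure_function_pushforward__canonical__measure_function_Measure
      (@lebesgue_measure R) mf).
have H : forall X, ocitv X -> lebesgue_measure X = m X.
  move=> _ [[a b]] /= _ <-; rewrite /m/= /mscale /= /pushforward.
  have -> : (fun t => r * t + z) @^-1` `]a, b] = `](a - z) / r, (b - z) / r]%classic.
    apply/seteqP; split => x /=; rewrite !in_itv/= ltr_pdivrMr// ler_pdivlMr//;
    move=> /andP[h1 h2]; apply/andP; split; lra.
  rewrite !lebesgue_measure_itv/= !lte_fin.
  rewrite ltr_pM2r ?invr_gt0// ltrD2r; case: ifPn => _; last by rewrite mule0.
  by rewrite -!EFinD -EFinM; congr (_%:E); field; rewrite gt_eqF.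
rewrite (lebesgue_measure_unique H mA) /m /= /mscale /= muleA -EFinM.
by rewrite mulVf ?gt_eqF// mul1e.
Qed.

(** Both sides are measures agreeing on boxes, where the one-dimensional case applies to each
    coordinate. Boxes generate the sigma-algebra and are stable under intersection, and balls of
    integer radius exhaust the space with finite measure. *)
Lemma leb_affine n (r : R) (z : 'rV[R]_n) (A : set 'rV[R]_n) :
  0 < r -> measurable A ->
  leb n ((fun x => r *: x + z) @^-1` A) = ((r ^- n)%:E * leb n A)%E.
Proof.
move=> r0 mA.
pose G := [set X : set 'rV[R]_n | exists2 B : 'I_n -> set R,
  (forall i, measurable (B i)) & X = [set x | forall i, B i (x 0 i)]].
pose m1 := measure_function_pushforward__canonical__measure_function_Measure
      (leb n) (measurable_affine_rV r z).
have rn0 : 0 <= r ^- n by rewrite invr_ge0 exprn_ge0// ltW.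
pose m2 := mscale (NngNum rn0) (leb n).
suff : m1 A = m2 A by [].
apply: (measure_unique G (fun k => ball (0 : 'rV[R]_n) k.+1%:R)) => //.
- apply/seteqP; split.
    apply: smallest_sub; first exact: smallest_sigma_algebra.
    rewrite -bigcup_seq => X [i _ [B mB <-]]; apply: sub_sigma_algebra.
    exists (fun j => if j == i then B else setT).
      by move=> j; case: ifP.
    rewrite setTI; apply/seteqP; split => x /=.
      by move=> Bx j; case: eqP => // ->.
    by move=> /(_ i); rewrite eqxx.
  apply: smallest_sub; first exact: sigma_algebra_measurable.
  by move=> X [B mB ->]; exact: measurable_rV_box.
- move=> X Y [B mB ->] [C mC ->]; exists (fun i => B i `&` C i).
    by move=> i; exact: measurableI.
  apply/seteqP; split => x /=; first by move=> [h1 h2] i.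
  by move=> h; split => i; case: (h i).
- move=> k; exists (fun i => `]0 - k.+1%:R, 0 + k.+1%:R[%classic).
    by move=> i; exact: measurable_itv.
  rewrite ball_rVE//; apply/seteqP; split => x /=.
    by move=> h i; have := h i; rewrite mxE in_itv.
  by move=> h i; have := h i; rewrite mxE in_itv.
- rewrite -subTset => x _.
  exists (Num.truncn `|x|) => //; rewrite -ball_normE /= sub0r normrN.
  by rewrite truncnS_gt.
- move=> _ [B mB ->]; rewrite /m1 /m2 /= /mscale /pushforward /=.
  rewrite (leb_box mB).
  transitivity (leb n [set x : 'rV[R]_n |
      forall i, ((fun t => r * t + z 0 i) @^-1` (B i)) (x 0 i)]).
    congr (leb n _); apply/seteqP; split => x /= h i; have := h i.
      by rewrite !mxE.
    by rewrite !mxE.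
  rewrite (@leb_box _ _ (fun i => (fun t => r * t + z 0 i) @^-1` B i)); last first.
    move=> i; rewrite -[X in measurable X]setTI.
    by apply: (measurable_funD (measurable_funM _ _) _).
  under eq_bigr do rewrite lebesgue_measure_affine//.
  rewrite big_split/=; congr (_ * _)%E.
  by rewrite prodEFin prodr_const card_ord exprVn.
- move=> k; rewrite /m1 /= /pushforward.
  have -> : (fun x => r *: x + z) @^-1` ball 0 k.+1%:R =
      ball (- (r^-1 *: z)) (k.+1%:R / r).
    have rk : 0 < k.+1%:R / r by rewrite divr_gt0.
    have E (t y : R) : `|0 - (r * t + y)| = r * `|- (r^-1 * y) - t|.
      rewrite -{2}(gtr0_norm r0) -normrM; congr `|_|.
      by field; rewrite gt_eqF.
    rewrite !ball_rVE//; apply/seteqP; split => x /= h i; have := h i;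
      by rewrite !mxE -!ltr_distlC E -ltr_pdivlMl// [_ / r]mulrC.
  by rewrite [X in (X < _)%E]leb_ball ?divr_gt0// ltry.
Qed.

Lemma ge0_integral_affine n (r : R) (z : 'rV[R]_n) (f : 'rV[R]_n -> \bar R) :
  0 < r -> measurable_fun setT f -> (forall x, 0 <= f x)%E ->
  (\int[leb n]_x f (r *: x + z)%R = (r ^- n)%:E * \int[leb n]_x f x)%E.
Proof.
move=> r0 mf f0.
have rn0 : 0 <= r ^- n by rewrite invr_ge0 exprn_ge0// ltW.
rewrite -(ge0_integral_mscale (leb n) measurableT (NngNum rn0))//.
have := @ge0_integral_pushforward _ _ _ _ _ _ (measurable_affine_rV r z) (leb n) setT f measurableT mf (fun x _ => f0 x).
rewrite preimage_setT => <-.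
apply: eq_measure_integral; first exact: measurable_affine_rV.
by move=> mphi A mA _; exact: leb_affine.
Qed.

Lemma integrable_affine n (r : R) (z : 'rV[R]_n) (f : 'rV[R]_n -> R) :
  0 < r -> (leb n).-integrable setT (EFin \o f) ->
  (leb n).-integrable setT (EFin \o (fun x => f (r *: x + z))).
Proof.
move=> r0 /integrableP[mf foo]; apply/integrableP; split.
  exact: (measurableT_comp mf (measurable_affine_rV r z)).
have := @ge0_integral_affine n r z (fun x => `|(f x)%:E|)%E r0.
move=> -> //; last exact: measurableT_comp.
by rewrite lte_mul_pinfty// lee_fin invr_ge0 exprn_ge0// ltW.
Qed.

Lemma Rintegral_affine n (r : R) (z : 'rV[R]_n) (f : 'rV[R]_n -> R) :
  0 < r -> (leb n).-integrable setT (EFin \o f) ->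
  \int[leb n]_x f (r *: x + z) = r ^- n * \int[leb n]_x f x.
Proof.
move=> r0 intf.
have fE x : f x = Num.max (f x) 0 - Num.max (- f x) 0.
  have [h|h] := leP 0 (f x).
    by rewrite (max_idPr _) ?subr0// oppr_le0.
  by rewrite (max_idPl _) ?opprK ?add0r// oppr_ge0 ltW.
have mf : measurable_fun setT f by case/integrableP: intf => /measurable_EFinP.
have P g : (leb n).-integrable setT (EFin \o g) -> (forall x, 0 <= g x) ->
    \int[leb n]_x g (r *: x + z) = r ^- n * \int[leb n]_x g x.
  move=> ig g0; rewrite /Rintegral.
  rewrite (@ge0_integral_affine n r z (EFin \o g))//.
    by rewrite fineM//; exact: integrable_fin_num.
  by case/integrableP: ig.
have i1 : (leb n).-integrable setT (EFin \o (fun x => Num.max (f x) 0)).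
  apply: (le_integrable measurableT _ _ intf).
    by apply/measurable_EFinP; exact: measurable_maxr.
  move=> x _ /=; rewrite lee_fin ger0_norm ?le_max ?lexx ?orbT//.
  by rewrite ge_max ler_norm normr_ge0.
have i2 : (leb n).-integrable setT (EFin \o (fun x => Num.max (- f x) 0)).
  apply: (le_integrable measurableT _ _ intf).
    by apply/measurable_EFinP; apply: measurable_maxr => //; exact: measurableT_comp.
  move=> x _ /=; rewrite lee_fin ger0_norm ?le_max ?lexx ?orbT//.
  by rewrite ge_max normr_ge0 -normrN ler_norm.
have -> : \int[leb n]_x f x = \int[leb n]_x Num.max (f x) 0 - \int[leb n]_x Num.max (- f x) 0.
  by rewrite -RintegralB//; apply: eq_Rintegral => x _; exact: fE.
rewrite mulrBr -!P//; last 2 first.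
  by move=> x; rewrite le_max lexx orbT.
  by move=> x; rewrite le_max lexx orbT.
rewrite -RintegralB//; [|exact: integrable_affine i1|exact: integrable_affine i2].
by apply: eq_Rintegral => x _; rewrite {1}fE.
Qed.

End affine_change_of_variables.

(** * Square-integrable functions *)

Lemma sqr_le_norm (R : realDomainType) (a b : R) :
  `|a| <= `|b| -> a ^+ 2 <= b ^+ 2.
Proof.
by move=> ab; rewrite -real_normK ?num_real// -(real_normK (num_real b)) lerXn2r ?nnegrE.
Qed.

(** Evaluates the quadratic at its minimum -B/C. This yields Cauchy-Schwarz in L^2 and the triangle
    inequality in R^n and, with A = 0, the vanishing of a first variation. *)
Lemma discriminant_le (R : realFieldType) (A B C : R) : 0 <= A -> 0 <= C ->
  (forall t, 0 <= A + t * (2 * B) + t ^+ 2 * C) -> B ^+ 2 <= A * C.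
Proof.
move=> f0 g0 H; have [C0|C0] := eqVneq C 0.
  have [->|B0] := eqVneq B 0; first by rewrite expr0n mulr_ge0.
  (* For C = 0 the polynomial is affine and takes the value -1 at this point. *)
  have := H (- (A + 1) / (2 * B)).
  rewrite C0 mulr0 addr0 mulfVK ?mulf_neq0//; lra.
have {}C0 : 0 < C by rewrite lt_neqAle eq_sym C0.
have := H (- B / C); rewrite -(pmulr_lge0 _ C0).
have -> : (A + - B / C * (2 * B) + (- B / C) ^+ 2 * C) * C =
  A * C - B ^+ 2 by field; rewrite gt_eqF.
by rewrite subr_ge0.
Qed.

Section square_integrable.
Context d (T : measurableType d) (R : realType) (mu : {measure set T -> \bar R}).
Implicit Types f g : T -> R.

Definition rintegrable f := mu.-integrable setT (EFin \o f).

(** Integrals run over the whole space: functions on the unit ball will be extended by zero, so that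
    no domain has to be carried along. *)
Definition sqi f := measurable_fun setT f /\ rintegrable (fun x => f x ^+ 2).

Definition sqn f := \int[mu]_x (f x ^+ 2).

Lemma rintegrableP f : rintegrable f <->
  measurable_fun setT f /\ (\int[mu]_x `|f x|%:E < +oo)%E.
Proof.
split => [/integrableP[mf h]|[mf h]].
  by split => //; exact/measurable_EFinP.
by apply/integrableP; split => //; exact/measurable_EFinP.
Qed.

Lemma le_rintegrable f g : measurable_fun setT f -> rintegrable g ->
  (forall x, `|f x| <= g x) -> rintegrable f.
Proof.
move=> mf ig fg; apply: (le_integrable measurableT _ _ ig).
  exact/measurable_EFinP.
by move=> x _ /=; rewrite lee_fin (le_trans (fg x))// ler_norm.
Qed.

Lemma rintegrable_measurable f : rintegrable f -> measurable_fun setT f.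
Proof. by case/rintegrableP. Qed.

Lemma rintegrableD f g : rintegrable f -> rintegrable g ->
  rintegrable (fun x => f x + g x).
Proof. by move=> h1 h2; have := integrableD measurableT h1 h2. Qed.

Lemma rintegrableB f g : rintegrable f -> rintegrable g ->
  rintegrable (fun x => f x - g x).
Proof. by move=> h1 h2; have := integrableB measurableT h1 h2. Qed.

Lemma rintegrableZ c f : rintegrable f -> rintegrable (fun x => c * f x).
Proof. by move=> h; have := integrableZl measurableT c h. Qed.

Lemma rintegrable_norm f : rintegrable f -> rintegrable (fun x => `|f x|).
Proof.
move=> rf; apply: (le_integrable measurableT _ _ rf).
  by apply/measurable_EFinP; apply: measurableT_comp => //; exact: rintegrable_measurable.
by move=> x _ /=; rewrite normr_id.
Qed.

Lemma rintegrable_sum (I : Type) (s : seq I) (F : I -> T -> R) :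
  (forall i, rintegrable (F i)) -> rintegrable (fun x => \sum_(i <- s) F i x).
Proof.
move=> h; elim: s => [|i s IH].
  by under eq_fun do rewrite big_nil; exact: integrable0.
by under eq_fun do rewrite big_cons; exact: rintegrableD.
Qed.

Lemma Rintegral_sum (I : Type) (s : seq I) (F : I -> T -> R) :
  (forall i, rintegrable (F i)) ->
  \int[mu]_x (\sum_(i <- s) F i x) = \sum_(i <- s) \int[mu]_x F i x.
Proof.
move=> h; elim: s => [|i s IH].
  by under eq_Rintegral do rewrite big_nil; rewrite Rintegral_cst// mul0r big_nil.
under eq_Rintegral do rewrite big_cons.
rewrite RintegralD//; [|exact: h|exact: (rintegrable_sum s h)].
by rewrite IH big_cons.
Qed.

Lemma le_RintegralT f g : rintegrable f -> rintegrable g ->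
  (forall x, f x <= g x) -> \int[mu]_x f x <= \int[mu]_x g x.
Proof. by move=> h1 h2 h; apply: le_Rintegral. Qed.

Lemma sqi_mul f g : sqi f -> sqi g -> rintegrable (fun x => f x * g x).
Proof.
move=> [mf sf] [mg sg].
apply: (le_rintegrable _ (rintegrableD sf sg)); first exact: measurable_funM.
move=> x; rewrite normrM -(real_normK (num_real (f x))) -(real_normK (num_real (g x))).
have := normr_ge0 (f x); have := normr_ge0 (g x).
by move: `|f x| `|g x| => a b; nra.
Qed.

Lemma sqiD f g : sqi f -> sqi g -> sqi (fun x => f x + g x).
Proof.
move=> sf sg; split; first by apply: measurable_funD; [case: sf|case: sg].
have -> : (fun x => (f x + g x) ^+ 2) =
    (fun x => f x ^+ 2 + (2 * (f x * g x) + g x ^+ 2)).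
  by apply/funext => x; ring.
apply: rintegrableD; first by case: sf.
apply: rintegrableD; last by case: sg.
by apply: rintegrableZ; exact: sqi_mul.
Qed.

Lemma sqiZ c f : sqi f -> sqi (fun x => c * f x).
Proof.
move=> [mf sf]; split; first exact: measurable_funM.
by under eq_fun do rewrite exprMn; exact: rintegrableZ.
Qed.

Lemma sqiN f : sqi f -> sqi (fun x => - f x).
Proof. by move=> /(@sqiZ (-1)); under eq_fun do rewrite mulN1r. Qed.

Lemma sqiB f g : sqi f -> sqi g -> sqi (fun x => f x - g x).
Proof. by move=> sf sg; apply: sqiD => //; exact: sqiN. Qed.

Lemma sqi0 : sqi (cst 0).
Proof.
split => //; rewrite [X in rintegrable X](_ : _ = cst 0); first exact: integrable0.
by apply/funext => x; rewrite expr0n.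
Qed.

Lemma sqi_sum (I : Type) (s : seq I) (F : I -> T -> R) :
  (forall i, sqi (F i)) -> sqi (fun x => \sum_(i <- s) F i x).
Proof.
move=> h; elim: s => [|i s IH].
  by under eq_fun do rewrite big_nil; exact: sqi0.
by under eq_fun do rewrite big_cons; exact: sqiD.
Qed.

Lemma le_sqi f g : measurable_fun setT f -> sqi g ->
  (forall x, `|f x| <= `|g x|) -> sqi f.
Proof.
move=> mf [mg sg] fg; split => //.
apply: (le_rintegrable _ sg); first exact: measurable_funX.
by move=> x; rewrite ger0_norm ?sqr_ge0//; exact: sqr_le_norm.
Qed.

Lemma sqi_norm f : sqi f -> sqi (fun x => `|f x|).
Proof.
move=> sf; apply: (le_sqi _ sf); last by move=> x; rewrite normr_id.
by apply: measurableT_comp => //; case: sf.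
Qed.

Lemma sqn_ge0 f : 0 <= sqn f.
Proof. by apply: Rintegral_ge0 => x _; rewrite sqr_ge0. Qed.

Lemma sqnZ c f : sqi f -> sqn (fun x => c * f x) = c ^+ 2 * sqn f.
Proof.
move=> [_ sf]; rewrite /sqn -RintegralZl//.
by apply: eq_Rintegral => x _; rewrite exprMn.
Qed.

Lemma le_sqn f g : sqi f -> sqi g -> (forall x, `|f x| <= `|g x|) ->
  sqn f <= sqn g.
Proof.
move=> [_ sf] [_ sg] fg; apply: le_RintegralT => // x.
exact: sqr_le_norm.
Qed.

Lemma sqnD_le f g : sqi f -> sqi g ->
  sqn (fun x => f x + g x) <= 2 * (sqn f + sqn g).
Proof.
move=> sf sg; have [_ sfg] := sqiD sf sg; case: sf sg => [_ sf] [_ sg].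
rewrite /sqn -RintegralD// -RintegralZl//; last exact: rintegrableD.
apply: le_RintegralT => //; first by apply: rintegrableZ; exact: rintegrableD.
move=> x; rewrite -subr_ge0.
by rewrite (_ : _ - _ = (f x - g x) ^+ 2) ?sqr_ge0//; ring.
Qed.

Lemma Rintegral_CauchySchwarz f g : sqi f -> sqi g ->
  (\int[mu]_x (f x * g x)) ^+ 2 <= sqn f * sqn g.
Proof.
move=> sf sg; set B := \int[mu]_x _.
have H t : 0 <= sqn f + t * (2 * B) + t ^+ 2 * sqn g.
  have [_ i1] := sf; have [_ i2] := sg; have i3 := sqi_mul sf sg.
  have -> : sqn f + t * (2 * B) + t ^+ 2 * sqn g =
      \int[mu]_x (f x + t * g x) ^+ 2.
    have i4 : rintegrable (fun x => t * (2 * (f x * g x))).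
      by do 2 apply: rintegrableZ.
    have i5 : rintegrable (fun x => t ^+ 2 * g x ^+ 2) by apply: rintegrableZ.
    rewrite /sqn /B -RintegralZl// -RintegralZl//; last exact: rintegrableZ.
    rewrite -RintegralZl// -RintegralD// -RintegralD//; last exact: rintegrableD.
    by apply: eq_Rintegral => x _; ring.
  by apply: Rintegral_ge0 => x _; rewrite sqr_ge0.
by apply: discriminant_le => //; exact: sqn_ge0.
Qed.

Lemma cvg_Rintegral_mul (f_ : nat -> T -> R) f g :
  (forall k, sqi (f_ k)) -> sqi f -> sqi g ->
  sqn (fun x => f_ k x - f x) @[k --> \oo] --> 0 ->
  \int[mu]_x (f_ k x * g x) @[k --> \oo] --> \int[mu]_x (f x * g x).
Proof.
move=> sf_ sf sg h.
apply/cvgrPdist_le => e e0.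
(* The summand 1 keeps the denominator positive when [g] vanishes almost everywhere. *)
have gp : 0 < sqn g + 1 by rewrite ltr_wpDl// sqn_ge0.
have e2 : 0 < e ^+ 2 / (sqn g + 1) by rewrite divr_gt0// exprn_gt0.
move/cvgrPdist_le : h => /(_ _ e2); apply: filterS => k.
rewrite sub0r normrN ger0_norm ?sqn_ge0// ler_pdivlMr// => hk.
rewrite distrC -RintegralB//; [|exact: sqi_mul|exact: sqi_mul].
under eq_Rintegral do rewrite -mulrBl.
rewrite -(@ler_pXn2r _ 2)// ?nnegrE ?(ltW e0)//.
rewrite real_normK ?num_real// (le_trans (Rintegral_CauchySchwarz _ _))//.
  exact: sqiB.
rewrite (le_trans _ hk)// ler_wpM2l ?sqn_ge0//; lra.
Qed.

(** Dominated convergence for the squared differences, with dominating function (2 g)^2. *)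
Lemma sqn_dominated (f_ : nat -> T -> R) f g :
  (forall k, measurable_fun setT (f_ k)) -> sqi g ->
  (forall x, f_ k x @[k --> \oo] --> f x) ->
  (forall k x, `|f_ k x| <= g x) ->
  sqi f /\ sqn (fun x => f_ k x - f x) @[k --> \oo] --> 0.
Proof.
move=> mf_ sg fcv fg.
have mf : measurable_fun setT f by apply: (measurable_fun_cvg mf_) => x _; exact: fcv.
have fg' x : `|f x| <= g x.
  have h : `|f_ k x| @[k --> \oo] --> `|f x| by apply: cvg_norm.
  by apply: (cvgr_to_le h); apply: nearW => k; exact: fg.
have gn x : `|g x| = g x by rewrite ger0_norm// (le_trans (normr_ge0 _) (fg' x)).
have sf : sqi f by apply: (le_sqi mf sg) => x; rewrite gn.
split => //.
have mD k : measurable_fun setT (fun x => (f_ k x - f x) ^+ 2).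
  by apply: measurable_funX; exact: measurable_funB.
have [|||||_ _] := @dominated_convergence _ _ _ mu _ measurableT
  (fun k x => ((f_ k x - f x) ^+ 2)%:E) (cst 0%E) (fun x => (4 * g x ^+ 2)%:E).
- by move=> k; exact/measurable_EFinP.
- exact: measurable_cst.
- apply: aeW => x _; rewrite /=; apply/fine_cvgP; split; first exact: nearW.
  have h : f_ k x - f x @[k --> \oo] --> 0 by apply/subr_cvg0.
  by have /(_ _) := cvgM h h; rewrite mulr0; apply.
- by apply: rintegrableZ; case: sg.
- apply: aeW => x k _ /=; rewrite lee_fin ger0_norm ?sqr_ge0//.
  have := ler_normB (f_ k x) (f x); have := fg k x; have := fg' x.
  rewrite -(real_normK (num_real (f_ k x - f x))).
  have := normr_ge0 (f_ k x - f x).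
  move: `|f_ k x - f x| `|f_ k x| `|f x| (g x) => a b c e; nra.
by rewrite integral_cst// mul0e => /fine_cvg.
Qed.

End square_integrable.

(** * The Euclidean norm and functions vanishing outside a ball *)

Section euclidean_norm.
Context {R : realType} {n : nat}.
Implicit Types x y z : 'rV[R]_n.

Lemma sqr_enorm x : enorm x ^+ 2 = \sum_i x 0 i ^+ 2.
Proof. by rewrite sqr_sqrtr// sumr_ge0// => i _; rewrite sqr_ge0. Qed.

Lemma enorm_ge0 x : 0 <= enorm x. Proof. exact: sqrtr_ge0. Qed.

Lemma enorm0 : enorm (0 : 'rV[R]_n) = 0.
Proof.
by apply/eqP; rewrite -sqrf_eq0 sqr_enorm big1// => i _; rewrite mxE expr0n.
Qed.

Lemma le_enorm x (r : R) : 0 <= r -> (enorm x <= r) = (\sum_i x 0 i ^+ 2 <= r ^+ 2).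
Proof. by move=> r0; rewrite -sqr_enorm ler_pXn2r ?nnegrE ?enorm_ge0. Qed.

Lemma enormZ c x : enorm (c *: x) = `|c| * enorm x.
Proof.
rewrite /enorm -sqrtr_sqr -sqrtrM ?sqr_ge0//; congr Num.sqrt.
by rewrite mulr_sumr; apply: eq_bigr => i _; rewrite mxE exprMn.
Qed.

Lemma enormN x : enorm (- x) = enorm x.
Proof. by rewrite -scaleN1r enormZ normrN1 mul1r. Qed.

Lemma enormBC x y : enorm (x - y) = enorm (y - x).
Proof. by rewrite -enormN opprB. Qed.

Lemma enormD x y : enorm (x + y) <= enorm x + enorm y.
Proof.
have xy0 : 0 <= enorm x + enorm y by rewrite addr_ge0 ?enorm_ge0.
rewrite le_enorm//; set B := \sum_i (x 0 i * y 0 i).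
have -> : \sum_i (x + y) 0 i ^+ 2 = enorm x ^+ 2 + 2 * B + enorm y ^+ 2.
  rewrite !sqr_enorm mulr_sumr -!big_split/=; apply: eq_bigr => i _.
  by rewrite mxE; ring.
have H t : 0 <= enorm x ^+ 2 + t * (2 * B) + t ^+ 2 * enorm y ^+ 2.
  have -> : enorm x ^+ 2 + t * (2 * B) + t ^+ 2 * enorm y ^+ 2 =
      \sum_i (x 0 i + t * y 0 i) ^+ 2.
    rewrite !sqr_enorm !mulr_sumr -!big_split/=; apply: eq_bigr => i _; ring.
  by rewrite sumr_ge0// => i _; rewrite sqr_ge0.
suff : B ^+ 2 <= (enorm x * enorm y) ^+ 2.
  have c0 : 0 <= enorm x * enorm y by rewrite mulr_ge0 ?enorm_ge0.
  rewrite -real_normK ?num_real// ler_pXn2r ?nnegrE// => h.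
  rewrite sqrrD -mulr_natl; have := le_trans (ler_norm B) h.
  by move: (enorm x) (enorm y) B {H h c0 xy0} => a b B; lra.
by rewrite exprMn; apply: discriminant_le => //; rewrite exprn_ge0 ?enorm_ge0.
Qed.

Lemma enormB_ge x y : enorm x - enorm y <= enorm (x - y).
Proof. by rewrite lerBlDr -{1}(subrK y x) enormD. Qed.

Lemma enorm_triangle y x z : enorm (x - z) <= enorm (x - y) + enorm (y - z).
Proof. by have := enormD (x - y) (y - z); rewrite addrA subrK. Qed.

Lemma le_coord_enorm x i : `|x 0 i| <= enorm x.
Proof.
rewrite -(@ler_pXn2r _ 2)// ?nnegrE ?enorm_ge0// real_normK ?num_real//.
by rewrite sqr_enorm (bigD1 i)//= lerDl sumr_ge0// => j _; rewrite sqr_ge0.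
Qed.

Lemma le_coord_norm x i : `|x 0 i| <= `|x|.
Proof.
by rewrite [leRHS]/Num.norm /= mx_normrE; apply/bigmax_geP; right; exists (0, i).
Qed.

Lemma norm_le_enorm x : `|x| <= enorm x.
Proof.
rewrite [leLHS]/Num.norm /= mx_normrE; apply/bigmax_leP; split; first exact: enorm_ge0.
by move=> [i j] _ /=; rewrite ord1 le_coord_enorm.
Qed.

Lemma enorm_le_norm x : enorm x <= n%:R * `|x|.
Proof.
rewrite le_enorm ?mulr_ge0//.
apply: (@le_trans _ _ (n%:R * `|x| ^+ 2)).
  rewrite -[X in X%:R * _]card_ord -sum1_card natr_sum mulr_suml ler_sum// => i _.
  by rewrite mul1r; apply: sqr_le_norm; rewrite normr_id le_coord_norm.
rewrite exprMn ler_wpM2r ?sqr_ge0// expr2.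
case: n => [|m]; first by rewrite mul0r.
by rewrite ler_peMl// ler1n.
Qed.

Lemma rV_coord_continuous (i : 'I_n) : continuous (fun x : 'rV[R]_n => x 0 i).
Proof. exact: coord_continuous. Qed.

Lemma enorm_continuous : continuous (@enorm R n).
Proof.
move=> x; apply/(@cvgrPdist_le _ _ _ (nbhs x) (nbhs_filter x)) => e e0.
have d0 : 0 < e / n.+1%:R by rewrite divr_gt0.
have : \forall y \near x, ball x (e / n.+1%:R) y by exact: nbhsx_ballx.
apply: filterS => y; rewrite -ball_normE /= => h.
have {}h : enorm (x - y) <= e.
  apply: (le_trans (enorm_le_norm _)).
  move: h; rewrite ltr_pdivlMr// mulrC => h.
  by apply: (le_trans _ (ltW h)); rewrite ler_wpM2r// ler_nat.
rewrite ler_norml; apply/andP; split; last exact: (le_trans (enormB_ge _ _)).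
by rewrite lerNl opprB; apply: (le_trans (enormB_ge _ _)); rewrite enormBC.
Qed.

Lemma open_eball (r : R) : open (@eball R n r).
Proof.
rewrite (_ : eball n r = @enorm R n @^-1` `]-oo, r[%classic).
  by apply: open_comp => // x _; exact: enorm_continuous.
by apply/seteqP; split => x; rewrite /= in_itv.
Qed.

Lemma measurable_eball (r : R) : measurable (@eball R n r).
Proof. by apply: open_measurable_rV; exact: open_eball. Qed.

Lemma measurable_enorm : measurable_fun setT (@enorm R n).
Proof. by apply: continuous_measurable_rV; exact: enorm_continuous. Qed.

Lemma leb_eball_lty (r : R) : (leb n (eball n r) < +oo)%E.
Proof.
have [r0|r0] := ltP 0 r; last first.
  rewrite (_ : eball n r = set0) ?measure0 ?ltry// -subset0 => x /=.
  by rewrite /eball/= ltNge (le_trans r0)// enorm_ge0.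
apply: (@le_lt_trans _ _ (leb n (ball (0 : 'rV[R]_n) r))).
  apply: le_measure; rewrite ?inE; [exact: measurable_eball|exact: measurable_rV_ball|].
  by move=> x; rewrite -ball_normE /= sub0r normrN; exact: le_lt_trans (norm_le_enorm _).
by rewrite leb_ball// ltry.
Qed.

End euclidean_norm.

Section vanishing_outside_a_ball.
Context {R : realType} {n : nat}.
Local Notation V := 'rV[R]_n.
Local Notation mu := (leb n).
Implicit Types f g k : V -> R.

Definition vanish (r : R) f := forall x, r <= enorm x -> f x = 0.

Lemma vanish_norm_le f r C : vanish r f -> (forall x, `|f x| <= C) ->
  forall x, `|f x| <= C * \1_(eball n r) x.
Proof.
move=> vf fC x; have [h|h] := leP r (enorm x).
  by rewrite vf// normr0 mulr_ge0// (le_trans _ (fC x)).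
by rewrite indicE mem_set// mulr1.
Qed.

Lemma sqi_indic_eball r : sqi mu (\1_(eball n r) : V -> R).
Proof.
split; first by apply: measurable_indic; exact: measurable_eball.
have -> : (fun x : V => \1_(eball n r) x ^+ 2) = (\1_(eball n r) : V -> R).
  by apply/funext => x; rewrite indicE; case: (_ \in _); rewrite ?expr1n ?expr0n.
apply/rintegrableP; split.
  by apply: measurable_indic; exact: measurable_eball.
rewrite (eq_integral (fun x => (\1_(eball n r) x)%:E)).
  by rewrite integral_indic ?setIT//; [exact: leb_eball_lty|exact: measurable_eball].
by move=> x _; rewrite ger0_norm.
Qed.

Lemma sqi_bounded f r C : measurable_fun setT f -> vanish r f ->
  (forall x, `|f x| <= C) -> sqi mu f.
Proof.
move=> mf vf fC.
apply: (le_sqi mf (sqiZ C (sqi_indic_eball r))) => x.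
by apply: (le_trans (vanish_norm_le vf fC x)); exact: ler_norm.
Qed.

(** Pairing with the indicator of the ball turns square integrability into integrability. *)
Lemma sqi_rintegrable f r : sqi mu f -> vanish r f -> rintegrable mu f.
Proof.
move=> sf vf.
have := sqi_mul sf (sqi_indic_eball r).
congr rintegrable; apply/funext => x; have [h|h] := leP r (enorm x).
  by rewrite vf// mul0r.
by rewrite indicE mem_set// mulr1.
Qed.

End vanishing_outside_a_ball.

(** * Mollification *)

Section mollification.
Context {R : realType} {n : nat}.
Local Notation V := 'rV[R]_n.
Local Notation mu := (leb n).
Implicit Types f g k : V -> R.
Implicit Types x y z : V.

(** Correlation with [k] around [y]; it is the usual convolution when [k] is even, as the radial
    kernels are. *)
Definition mol k f (y : V) : R := \int[mu]_x (f x * k (x - y)).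

Record mollifier (r : R) k : Prop := Mollifier {
  moll_lip : exists2 L, 0 <= L & forall x y, `|k x - k y| <= L * `|x - y| ;
  moll_ge0 : forall x, 0 <= k x ;
  moll_vanish : vanish r k ;
  moll_int : \int[mu]_x k x = 1 }.

Lemma lip_continuous k L : (forall x y : V, `|k x - k y| <= L * `|x - y|) ->
  continuous k.
Proof.
move=> kL x; apply/(@cvgrPdist_le _ _ _ (nbhs x) (nbhs_filter x)) => e e0.
have L0 : 0 < `|L| + 1 by rewrite ltr_wpDl.
have : \forall y \near x, ball x (e / (`|L| + 1)) y.
  by apply: nbhsx_ballx; rewrite divr_gt0.
apply: filterS => y; rewrite -ball_normE /= ltr_pdivlMr// => h.
apply: (le_trans (kL _ _)); apply: le_trans (ltW h).
by rewrite mulrC ler_wpM2l// (le_trans (ler_norm L))// lerDl.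
Qed.

Lemma measurable_shift k (y : V) : measurable_fun setT k ->
  measurable_fun [set: V] (fun x : V => k (x - y)).
Proof.
move=> mk; have := measurableT_comp mk (measurable_affine_rV 1 (- y)).
by congr measurable_fun; apply/funext => x /=; rewrite scale1r.
Qed.

Section bounded_kernel.
Context (k : V -> R) (K : R).
Context (mk : measurable_fun setT k) (kK : forall x, `|k x| <= K).

Let K0 : 0 <= K. Proof. exact: le_trans (kK 0). Qed.

Lemma rintegrable_mol f y : rintegrable mu f ->
  rintegrable mu (fun x => f x * k (x - y)).
Proof.
move=> rf; have mf := rintegrable_measurable rf.
have rf' : rintegrable mu (fun x => K * `|f x|).
  by apply: rintegrableZ; exact: rintegrable_norm.
apply: (le_rintegrable _ rf'); first by apply: measurable_funM => //; exact: measurable_shift.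
by move=> x; rewrite normrM mulrC ler_wpM2r.
Qed.

Lemma mol_shift f y : rintegrable mu f ->
  mol k f y = \int[mu]_z (f (z + y) * k z).
Proof.
move=> rf; have := Rintegral_affine y ltr01 (rintegrable_mol y rf).
rewrite expr1n invr1 mul1r /mol => <-.
by apply: eq_Rintegral => x _; rewrite scale1r addrK.
Qed.

Lemma norm_mol_le f y : rintegrable mu f ->
  `|mol k f y| <= K * \int[mu]_x `|f x|.
Proof.
move=> rf; have rfn := rintegrable_norm rf.
apply: (le_trans (le_normr_Rintegral measurableT (rintegrable_mol y rf))).
rewrite -RintegralZl//; apply: le_RintegralT.
- exact: (rintegrable_norm (rintegrable_mol y rf)).
- exact: rintegrableZ.
- by move=> x; rewrite normrM mulrC ler_wpM2r.
Qed.

End bounded_kernel.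

Lemma lip_mol k L K f : (forall x y, `|k x - k y| <= L * `|x - y|) ->
  (forall x, `|k x| <= K) -> rintegrable mu f ->
  forall y z, `|mol k f y - mol k f z| <= (L * \int[mu]_x `|f x|) * `|y - z|.
Proof.
move=> kL kK rf y z.
have mk : measurable_fun setT k.
  by apply: continuous_measurable_rV; exact: lip_continuous kL.
rewrite /mol -RintegralB//; [|exact: (rintegrable_mol mk kK)|exact: (rintegrable_mol mk kK)].
under eq_Rintegral do rewrite -mulrBr.
have ri : rintegrable mu (fun x => f x * (k (x - y) - k (x - z))).
  under eq_fun do rewrite mulrBr.
  by apply: rintegrableB; exact: (rintegrable_mol mk kK).
apply: (le_trans (le_normr_Rintegral measurableT ri)).
rewrite mulrAC -RintegralZl//; last exact: rintegrable_norm.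
apply: le_RintegralT; [exact: rintegrable_norm|by apply: rintegrableZ; exact: rintegrable_norm|].
move=> x; rewrite normrM mulrC ler_wpM2r// (le_trans (kL _ _))//.
by rewrite opprB addrC addrA subrK distrC.
Qed.

Lemma vanish_mol k f r s : vanish r k -> vanish s f -> vanish (s + r) (mol k f).
Proof.
move=> vk vf y hy; rewrite /mol (@eq_Rintegral _ _ _ _ _ (cst 0)).
  by rewrite Rintegral_cst// mul0r.
move=> x _; have [h|h] := leP s (enorm x); first by rewrite vf// mul0r.
rewrite vk ?mulr0// enormBC; apply: le_trans (enormB_ge _ _); lra.
Qed.

Section one_mollifier.
Context (r : R) (k : V -> R) (kr : mollifier r k).

Lemma moll_bounded : exists2 K, 0 <= K & forall x, `|k x| <= K.
Proof.
have [L L0 kL] := moll_lip kr.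
exists (L * `|r| *+ 2 + `|k 0|); first by rewrite addr_ge0// mulrn_wge0// mulr_ge0.
move=> x; have [h|h] := leP r (enorm x).
  by rewrite (moll_vanish kr)// normr0 addr_ge0// mulrn_wge0// mulr_ge0.
rewrite -{1}(subrK (k 0) (k x)) (le_trans (ler_normD _ _))// lerD2r.
rewrite (le_trans (kL _ _))// subr0 mulr2n.
have : L * `|x| <= L * `|r|.
  rewrite ler_wpM2l// (le_trans (norm_le_enorm _))// (le_trans (ltW h))//.
  exact: ler_norm.
by move=> /le_trans; apply; rewrite lerDl mulr_ge0.
Qed.

Lemma measurable_moll : measurable_fun setT k.
Proof.
have [L L0 kL] := moll_lip kr.
by apply: continuous_measurable_rV; exact: lip_continuous kL.
Qed.

Lemma sqi_moll : sqi mu k.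
Proof.
have [K K0 kK] := moll_bounded.
exact: (sqi_bounded measurable_moll (moll_vanish kr) kK).
Qed.

Lemma rintegrable_moll : rintegrable mu k.
Proof. exact: (sqi_rintegrable sqi_moll (moll_vanish kr)). Qed.

Lemma measurable_mol f : rintegrable mu f -> measurable_fun setT (mol k f).
Proof.
move=> rf; have [L L0 kL] := moll_lip kr; have [K K0 kK] := moll_bounded.
apply: continuous_measurable_rV.
exact: (lip_continuous (lip_mol kL kK rf)).
Qed.

Lemma sqi_mol s f : sqi mu f -> vanish s f -> sqi mu (mol k f).
Proof.
move=> sf vf; have rf := sqi_rintegrable sf vf.
have [K K0 kK] := moll_bounded.
apply: (sqi_bounded (measurable_mol rf) (vanish_mol (moll_vanish kr) vf)).
by move=> x; exact: (norm_mol_le measurable_moll kK).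
Qed.

Lemma rintegrable_shift f y : rintegrable mu f -> rintegrable mu (fun z => f (z + y)).
Proof.
move=> rf; have := integrable_affine y ltr01 rf.
by congr rintegrable; apply/funext => x; rewrite scale1r.
Qed.

Lemma rintegrable_mull f g C : rintegrable mu f -> measurable_fun setT g ->
  (forall x, `|g x| <= C) -> rintegrable mu (fun x => f x * g x).
Proof.
move=> rf mg gC; apply: (le_rintegrable _ (rintegrableZ C (rintegrable_norm rf))).
  by apply: measurable_funM => //; exact: rintegrable_measurable rf.
by move=> x; rewrite normrM mulrC ler_wpM2r.
Qed.

(** Jensen's inequality for the probability density [k], read off from the nonnegative variance of
    the translated [f] around its mean [mol k f y]. *)
Lemma sqr_mol_le s f y : sqi mu f -> vanish s f ->
  mol k f y ^+ 2 <= \int[mu]_z (f (z + y) ^+ 2 * k z).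
Proof.
move=> sf vf; have rf := sqi_rintegrable sf vf.
have [K K0 kK] := moll_bounded.
have mk := measurable_moll.
have i1 : rintegrable mu (fun z => f (z + y) * k z).
  by apply: (rintegrable_mull _ mk kK); exact: rintegrable_shift.
have i2 : rintegrable mu (fun z => f (z + y) ^+ 2 * k z).
  apply: (rintegrable_mull _ mk kK).
  by case: sf => _ /(rintegrable_shift y).
have i3 := rintegrable_moll.
rewrite (mol_shift mk kK)//; set m := \int[mu]_z _.
have : 0 <= \int[mu]_z ((f (z + y) - m) ^+ 2 * k z).
  by apply: Rintegral_ge0 => z _; rewrite mulr_ge0 ?sqr_ge0 ?(moll_ge0 kr).
rewrite (@eq_Rintegral _ _ _ _ _ (fun z => f (z + y) ^+ 2 * k z +
   (- (2 * m) * (f (z + y) * k z) + m ^+ 2 * k z))); last by move=> z _; ring.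
have i4 : rintegrable mu (fun z => - (2 * m) * (f (z + y) * k z)) by exact: rintegrableZ.
have i5 : rintegrable mu (fun z => m ^+ 2 * k z) by exact: rintegrableZ.
rewrite RintegralD//; last exact: rintegrableD.
rewrite RintegralD// !RintegralZl// (moll_int kr) -/m.
by rewrite mulr1 mulNr -mulrA -expr2; lra.
Qed.

(** Jensen pointwise, then Tonelli and translation invariance. Mollification is thus a contraction
    of L^2, which is what lets its convergence pass to L^2 limits. *)
Lemma sqn_mol_le s f : sqi mu f -> vanish s f -> sqn mu (mol k f) <= sqn mu f.
Proof.
move=> sf vf; have [mf if2] := sf; have [K K0 kK] := moll_bounded.
have mk := measurable_moll.
have [_ im2] := sqi_mol sf vf.
have fin1 : (\int[mu]_x (f x ^+ 2)%:E)%E \is a fin_num by exact: integrable_fin_num.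
rewrite /sqn /Rintegral fine_le//; first exact: integrable_fin_num.
(* In this shifted variable the inner integral over the first argument is, up to the factor [k], the
   integral of a translate of the square of [f]. *)
pose F (p : V * V) : \bar R := (f (p.2 + p.1) ^+ 2 * k p.2)%:E.
have mF : measurable_fun setT F.
  apply/measurable_EFinP; apply: measurable_funM; last first.
    by apply: (measurableT_comp mk); exact: measurable_snd.
  apply: measurable_funX; apply: (measurableT_comp mf).
  apply: measurable_fun_rV => i.
  rewrite (_ : (fun _ => _) = (fun p : V * V => p.2 0 i + p.1 0 i)); last first.
    by apply/funext => p; rewrite mxE.
  apply: measurable_funD.
    exact: (measurableT_comp (measurable_coord_rV i) measurable_snd).
  exact: (measurableT_comp (measurable_coord_rV i) measurable_fst).
have F0 p : (0 <= F p)%E by rewrite lee_fin mulr_ge0 ?sqr_ge0 ?(moll_ge0 kr).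
apply: (@le_trans _ _ (\int[mu]_y \int[mu]_z F (y, z))%E).
  apply: ge0_le_integral => //.
  - by move=> y _; rewrite lee_fin sqr_ge0.
  - by case/rintegrableP: im2 => /measurable_EFinP.
  - exact: measurable_fun_fubini_tonelli_F.
  - move=> y _; have := sqr_mol_le y sf vf; rewrite -lee_fin => /le_trans; apply.
    rewrite /Rintegral fineK//.
    apply: integrable_fin_num => //; apply: (rintegrable_mull _ mk kK).
    by move/(rintegrable_shift y) : if2.
rewrite fubini_tonelli//.
have -> : (\int[mu]_z \int[mu]_y F (y, z) = \int[mu]_z ((k z)%:E * \int[mu]_x (f x ^+ 2)%:E))%E.
  apply: eq_integral => z _; rewrite /F /=.
  transitivity (\int[mu]_y ((k z)%:E * (f (1 *: y + z) ^+ 2)%:E))%E.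
    by apply: eq_integral => y _; rewrite -EFinM mulrC scale1r addrC.
  rewrite ge0_integralZl//.
  - rewrite (@ge0_integral_affine _ _ _ _ (fun x => (f x ^+ 2)%:E))//.
    + by rewrite expr1n invr1 mul1e.
    + by apply/measurable_EFinP; exact: measurable_funX.
    + by move=> x; rewrite lee_fin sqr_ge0.
  - apply/measurable_EFinP; apply: measurable_funX.
    exact: (measurableT_comp mf (measurable_affine_rV 1 z)).
  - by move=> x _; rewrite lee_fin sqr_ge0.
  - by rewrite lee_fin (moll_ge0 kr).
rewrite ge0_integralZr//.
- have := moll_int kr; rewrite /Rintegral => h.
  rewrite -[X in (X * _)%E]fineK ?h ?mul1e//.
  by apply: integrable_fin_num => //; exact: rintegrable_moll.
- exact/measurable_EFinP.
- by move=> x _; rewrite lee_fin (moll_ge0 kr).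
- by apply: integral_ge0 => x _; rewrite lee_fin sqr_ge0.
Qed.

End one_mollifier.

End mollification.

(** * Convergence of mollifications in L^2 *)

Section mollification_converges.
Context {R : realType} {n : nat}.
Local Notation V := 'rV[R]_n.
Local Notation mu := (leb n).
Implicit Types f g k : V -> R.
Implicit Types x y z : V.
Context (k_ : nat -> V -> R) (r_ : nat -> R).
Context (moll_k : forall j, mollifier (r_ j) (k_ j)).
Context (r1 : forall j, r_ j <= 1).
Context (r0 : r_ j @[j --> \oo] --> 0).

(** The property is carried from continuous functions to indicators, to simple functions, to
    nonnegative functions and finally to differences of these. *)
Let P f := sqn mu (fun x => mol (k_ j) f x - f x) @[j --> \oo] --> 0.

Lemma norm_mol_sub_le k r f y C e : mollifier r k -> rintegrable mu f ->
  (forall z, enorm z < r -> `|f (z + y) - C| <= e) -> `|mol k f y - C| <= e.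
Proof.
move=> kr rf h; have [K K0 kK] := moll_bounded kr.
have mk := measurable_moll kr; have rk := rintegrable_moll kr.
(* For [r <= 0] the kernel would vanish identically, against its unit mass; for positive [r] the
   hypothesis at the origin bounds [e] from below. *)
have e0 : 0 <= e.
  have [r00|r00] := ltP 0 r.
    by apply: (le_trans _ (h 0 _)); rewrite ?enorm0.
  exfalso; have := moll_int kr; rewrite (@eq_Rintegral _ _ _ _ _ (cst 0)).
    by rewrite Rintegral_cst// mul0r => /eqP; rewrite eq_sym oner_eq0.
  by move=> x _; rewrite (moll_vanish kr)// (le_trans r00)// enorm_ge0.
rewrite (mol_shift mk kK)// -[C]mulr1 -[in X in C * X](moll_int kr) -RintegralZl//.
have i1 : rintegrable mu (fun z => f (z + y) * k z).
  by apply: (rintegrable_mull _ mk kK); exact: rintegrable_shift.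
have i2 : rintegrable mu (fun z => C * k z) by exact: rintegrableZ.
rewrite -RintegralB//.
apply: (le_trans (le_normr_Rintegral measurableT (rintegrableB i1 i2))).
rewrite -[e]mulr1 -[in X in e * X](moll_int kr) -RintegralZl//.
apply: le_RintegralT; [exact/rintegrable_norm/rintegrableB|exact: rintegrableZ|].
move=> z; rewrite -mulrBl normrM (ger0_norm (moll_ge0 kr z)).
have [hz|hz] := leP r (enorm z).
  by rewrite (moll_vanish kr)// !mulr0.
by rewrite ler_wpM2r ?(moll_ge0 kr)// h.
Qed.

Lemma mol_cvg_continuous rho g C : continuous g -> vanish rho g ->
  (forall x, `|g x| <= C) -> P g.
Proof.
move=> cg vg gC.
have mg := continuous_measurable_rV cg.
have sg := sqi_bounded mg vg gC; have rg := sqi_rintegrable sg vg.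
have C0 : 0 <= C := le_trans (normr_ge0 _) (gC 0).
have [] // := @sqn_dominated _ _ _ mu (fun j => mol (k_ j) g) g
    (fun x => C * \1_(eball n (rho + 1)) x).
- by move=> j; exact: (measurable_mol (moll_k j)).
- by apply: sqiZ; exact: sqi_indic_eball.
- move=> x; apply/cvgrPdistC_le => e e0.
  have : nbhs x [set z | `|g z - g x| <= e].
    have /(@cvgrPdistC_le _ _ _ (nbhs x) (nbhs_filter x)) := cg x.
    exact.
  move=> /nbhs_ballP[d /= d0 hd].
  have : \forall j \near \oo, `|r_ j| < d.
    by move/cvgr0Pnorm_lt : r0; apply.
  apply: filterS => j rj; apply: (norm_mol_sub_le (moll_k j) rg) => z zr.
  apply: hd; rewrite -ball_normE /= opprD addrCA subrr addr0 normrN.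
  rewrite (le_lt_trans (norm_le_enorm _))// (lt_trans zr)//.
  exact: le_lt_trans (ler_norm _) rj.
- move=> j x; apply: vanish_norm_le.
    move=> y hy; apply: (vanish_mol (moll_vanish (moll_k j)) vg).
    by apply: le_trans hy; rewrite lerD2l.
  move=> y; rewrite -[mol _ _ _]subr0.
  by apply: (norm_mol_sub_le (moll_k j) rg) => z _; rewrite subr0.
Qed.

Lemma mol_lin k f g a b y r rho : mollifier r k -> sqi mu f -> sqi mu g ->
  vanish rho f -> vanish rho g ->
  mol k (fun x => a * f x + b * g x) y = a * mol k f y + b * mol k g y.
Proof.
move=> kr sf sg vf vg; have [K K0 kK] := moll_bounded kr.
have mk := measurable_moll kr.
have rf := sqi_rintegrable sf vf; have rg := sqi_rintegrable sg vg.
have i1 := rintegrable_mol mk kK y rf; have i2 := rintegrable_mol mk kK y rg.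
rewrite /mol -!RintegralZl// -RintegralD//; [|exact: rintegrableZ|exact: rintegrableZ].
by apply: eq_Rintegral => x _; rewrite mulrDl !mulrA.
Qed.

Lemma mol_cvg_lin f g a b rho : sqi mu f -> sqi mu g ->
  vanish rho f -> vanish rho g -> P f -> P g -> P (fun x => a * f x + b * g x).
Proof.
move=> sf sg vf vg Pf Pg.
have sF j : sqi mu (fun x => mol (k_ j) f x - f x).
  by apply: sqiB => //; exact: (sqi_mol (moll_k j) sf vf).
have sG j : sqi mu (fun x => mol (k_ j) g x - g x).
  by apply: sqiB => //; exact: (sqi_mol (moll_k j) sg vg).
apply: (@squeeze_cvgr _ _ _ _ (cst 0) (fun j =>
  2 * (a ^+ 2 * sqn mu (fun x => mol (k_ j) f x - f x) +
       b ^+ 2 * sqn mu (fun x => mol (k_ j) g x - g x)))); last 2 first.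
- exact: cvg_cst.
- rewrite [X in _ --> X](_ : 0 = 2 * (a ^+ 2 * 0 + b ^+ 2 * 0)); last by rewrite !mulr0 addr0 mulr0.
  by apply: cvgMl_tmp; apply: cvgD; apply: cvgMl_tmp.
apply: nearW => j; rewrite sqn_ge0 /=.
rewrite -!sqnZ//; apply: le_trans (sqnD_le (sqiZ a (sF j)) (sqiZ b (sG j))).
rewrite le_eqVlt; apply/orP; left; apply/eqP; congr (sqn _ _); apply/funext => x.
by rewrite (mol_lin _ _ _ (moll_k j) sf sg vf vg); ring.
Qed.

(** An epsilon/3 argument: the mollification of [f - f_ i] is controlled by the contraction
    [sqn_mol_le], uniformly in the radius. *)
Lemma mol_cvg_closed (f_ : nat -> V -> R) f rho :
  (forall i, sqi mu (f_ i)) -> (forall i, vanish rho (f_ i)) ->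
  sqi mu f -> vanish rho f ->
  sqn mu (fun x => f_ i x - f x) @[i --> \oo] --> 0 ->
  (forall i, P (f_ i)) -> P f.
Proof.
move=> sf_ vf_ sf vf ff Pf_; apply/cvgr0Pnorm_le => e e0.
(* Squared norms lose a factor 2 in each of two splittings, and 2 (1 + 2 (1 + 1)) / 12 < 1. *)
have e12 : 0 < e / 12 by rewrite divr_gt0.
have [i fi] : exists i, sqn mu (fun x => f_ i x - f x) <= e / 12.
  move/cvgr0Pnorm_le : ff => /(_ _ e12)[i _ /(_ i (leqnn i))] h.
  by exists i; apply: le_trans h; exact: ler_norm.
move/cvgr0Pnorm_le : (Pf_ i) => /(_ _ e12); apply: filterS => j.
rewrite !ger0_norm ?sqn_ge0// => fj.
have sD : sqi mu (fun x => f x - f_ i x) by exact: sqiB.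
have vD : vanish rho (fun x => f x - f_ i x).
  by move=> x hx; rewrite vf// vf_// subrr.
have sM := sqi_mol (moll_k j) sD vD.
have sMi := sqi_mol (moll_k j) (sf_ i) (vf_ i).
have s1 : sqi mu (fun x => f_ i x - f x) by exact: sqiB.
have s2 : sqi mu (fun x => mol (k_ j) (f_ i) x - f_ i x) by exact: sqiB.
have -> : (fun x => mol (k_ j) f x - f x) =
    (fun x => mol (k_ j) (fun x => f x - f_ i x) x +
     ((mol (k_ j) (f_ i) x - f_ i x) + (f_ i x - f x))).
  apply/funext => x.
  have -> : mol (k_ j) (fun x => f x - f_ i x) x =
      mol (k_ j) f x - mol (k_ j) (f_ i) x.
    have := mol_lin 1 (-1) x (moll_k j) sf (sf_ i) vf (vf_ i).
    rewrite mul1r mulN1r => <-; congr (mol _ _ _); apply/funext => z.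
    by rewrite mul1r mulN1r.
  ring.
have h1 := sqn_mol_le (moll_k j) sD vD.
have h0 : sqn mu (fun x => f x - f_ i x) = sqn mu (fun x => f_ i x - f x).
  by apply: eq_Rintegral => x _; rewrite -sqrrN opprB.
have h2 := sqnD_le s2 s1.
have h3 := sqnD_le sM (sqiD s2 s1).
by move: h1 h2 h3 fi fj; rewrite h0; lra.
Qed.

(** Dynkin's theorem: the sets where a continuous function is positive generate the sigma-algebra
    and are stable under intersection, by taking minima; the good sets form a lambda-system because
    the convergence is linear and closed under L^2 limits. *)
Lemma mol_cvg_indic rho (A : set V) : measurable A ->
  P (\1_(A `&` eball n rho) : V -> R).
Proof.
pose E : set V := eball n rho.
have mE : measurable E by exact: measurable_eball.
have vI (B : set V) : vanish rho (\1_(B `&` E) : V -> R).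
  move=> x hx; rewrite indicE memNset// => -[_]; rewrite /E /eball/=.
  by rewrite ltNge hx.
have sI (B : set V) : measurable B -> sqi mu (\1_(B `&` E) : V -> R).
  move=> mB; apply: (sqi_bounded (C := 1)) (vI B) _.
    by apply: measurable_indic; exact: measurableI.
  by move=> x; rewrite indicE; case: (_ \in _); rewrite ?normr1 ?normr0.
pose H : set (set V) := [set B | measurable B /\ P (\1_(B `&` E) : V -> R)].
pose G : set (set V) := [set B | exists2 phi : V -> R, continuous phi &
   B = [set x | 0 < phi x]].
suff GH : G `<=` H.
  suff mGH : measurable `<=` H by move=> /mGH[].
  have -> : (measurable : set (set V)) = <<s G >>.
    apply/seteqP; split.
      apply: smallest_sub; first exact: smallest_sigma_algebra.
      rewrite -bigcup_seq => X [i _].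
      pose GT := g_sigma_algebraType G.
      have : measurable_fun [set: GT] (fun x : GT => (x : V) 0 i).
        apply: (measurability _ (measurable_realfun.RGenOInfty.measurableE R)).
        move=> _ [_ [a ->] <-]; apply: sub_sigma_algebra.
        exists (fun x : V => x 0 i - a).
          by move=> x; apply: (@cvgB _ _ _ (nbhs x)); [exact: rV_coord_continuous|exact: cvg_cst].
        by rewrite setTI; apply/seteqP; split => x /=; rewrite in_itv/= andbT subr_gt0.
      by move=> h [B mB <-]; exact: h measurableT B mB.
    apply: smallest_sub; first exact: sigma_algebra_measurable.
    by move=> B [phi cphi ->]; apply: open_measurable_rV;
       rewrite (_ : mkset _ = phi @^-1` `]0, +oo[%classic);
       [apply: open_comp => // x _; exact: cphi|
        apply/seteqP; split => x /=; rewrite in_itv/= andbT].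
  apply: lambda_system_subset => //.
  - move=> _ _ [p cp ->] [q cq ->]; exists (fun x => Num.min (p x) (q x)).
      by move=> x; exact: (continuous_min (cp x) (cq x)).
    by apply/seteqP; split => x /=; rewrite lt_min => /andP.
  - split => //.
    + by apply: GH; exists (cst 1); [exact: cst_continuous|
         apply/seteqP; split => x //= _; rewrite ltr01].
    + move=> A' B BA [mA' PA] [mB PB]; split; first exact: measurableD.
      have := mol_cvg_lin 1 (-1) (sI _ mA') (sI _ mB) (vI A') (vI B) PA PB.
      congr P; apply/funext => x; rewrite mul1r mulN1r !indicE.
      rewrite !(in_setD, in_setI).
      have : x \in B -> x \in A' by rewrite !inE; exact: BA.
      by case: (x \in B) => [/(_ isT) ->|_]; case: (x \in E);
        rewrite ?andbF ?andbT ?subrr ?subr0.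
    + move=> F ndF HF; have mF i : measurable (F i) by case: (HF i).
      split; first exact: bigcupT_measurable.
      have [||||sU cU] := @sqn_dominated _ _ _ mu (fun i => \1_(F i `&` E) : V -> R)
         (\1_(\bigcup_i F i `&` E)) (\1_E).
      * by move=> i; apply: measurable_indic; exact: measurableI.
      * exact: sqi_indic_eball.
      * move=> x; have [[i _ Fix]|nF] := pselect ((\bigcup_i F i) x).
          apply: (@cvg_near_cst _ _ _ _ _ _).
          exists i => // j /= ij; rewrite !indicE !in_setI; congr ((_ && _)%:R).
          rewrite !mem_set//; first by exists i.
          by have /subsetPset := ndF _ _ ij; exact.
        apply: (@cvg_near_cst _ _ _ _ _ _); apply: nearW => j.
        rewrite !indicE !in_setI; congr ((_ && _)%:R).
        by rewrite !memNset// => Fjx; apply: nF; exists j.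
      * move=> i x; rewrite !indicE in_setI.
        by case: (x \in F i); case: (x \in E); rewrite ?normr0 ?normr1.
      apply: (mol_cvg_closed (fun i => sI _ (mF i)) (fun i => vI (F i)) sU (vI _) cU).
      by move=> i; case: (HF i).
move=> B [phi cphi ->].
have mB : measurable [set x | 0 < phi x].
  apply: open_measurable_rV.
  rewrite (_ : mkset _ = phi @^-1` `]0, +oo[%classic).
    by apply: open_comp => // x _; exact: cphi.
  by apply/seteqP; split => x /=; rewrite in_itv/= andbT.
split => //.
(* [psi] is continuous and positive exactly on the set in question, so that the functions min(1, m
   psi) tend to its indicator. *)
pose psi x := Num.max 0 (Num.min (phi x) (rho - enorm x)).
have cpsi : continuous psi.
  move=> x.
  have h : {for x, continuous (fun y : V => rho - enorm y)}.
    by apply: (@cvgB _ _ _ (nbhs x)); [exact: cvg_cst|exact: enorm_continuous].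
  exact: (continuous_max (@cst_continuous _ _ 0 x) (continuous_min (cphi x) h)).
pose g (m : nat) x := Num.min 1 (m%:R * psi x).
have psi0 x : 0 <= psi x by rewrite le_max lexx.
have g0 m x : 0 <= g m x by rewrite le_min ler01 mulr_ge0.
have g1 m x : `|g m x| <= 1 by rewrite ger0_norm// ge_min lexx.
have vpsi x : ~ ([set x | 0 < phi x] `&` E) x -> psi x = 0.
  rewrite /psi /E /eball /= => h; apply/max_idPl; rewrite ge_min.
  apply/negP => /negP; rewrite negb_or -!ltNge subr_gt0 => /andP[h1 h2].
  by apply: h.
have vg m : vanish rho (g m).
  move=> x hx; rewrite /g vpsi ?mulr0 ?(min_idPr _)// => -[_]; rewrite /E/eball/=.
  by rewrite ltNge hx.
have cg m : continuous (g m).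
  move=> x.
  have h : {for x, continuous (fun y : V => m%:R * psi y)}.
    by apply: (@cvgMl_tmp _ _ (nbhs x)); exact: cpsi.
  have h1 : {for x, continuous (cst 1 : V -> R)} by exact: cst_continuous.
  exact: (continuous_min h1 h).
have [||||sU cU] := @sqn_dominated _ _ _ mu g
         (\1_([set x | 0 < phi x] `&` E)) (\1_E).
- by move=> m; exact: continuous_measurable_rV.
- exact: sqi_indic_eball.
- move=> x; apply: (@cvg_near_cst _ _ _ _ _ _).
  have [h|h] := pselect (([set x | 0 < phi x] `&` E) x); last first.
    by apply: nearW => m; rewrite indicE memNset// /g vpsi// mulr0 (min_idPr _).
  have p0 : 0 < psi x.
    by case: h; rewrite /E /eball /= => h1 h2; rewrite lt_max lt_min h1 subr_gt0 h2 orbT.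
  exists (Num.truncn (psi x)^-1).+1 => // m /= hm.
  rewrite indicE mem_set// /g (min_idPl _)// -ler_pdivrMr// mul1r.
  rewrite (le_trans (ltW (truncnS_gt _)))// ler_nat//.
- move=> m x; have [h|h] := leP rho (enorm x).
    by rewrite vg// normr0 indicE.
  by rewrite [X in _ <= X]indicE mem_set.
apply: (mol_cvg_closed _ vg sU (vI _) cU).
  by move=> m; exact: (sqi_bounded (continuous_measurable_rV (cg m)) (vg m) (g1 m)).
by move=> m; exact: (mol_cvg_continuous (cg m) (vg m) (g1 m)).
Qed.

Import HBNNSimple.

Lemma vanish_sum rho (I : Type) (s : seq I) (F : I -> V -> R) :
  (forall i, vanish rho (F i)) -> vanish rho (fun x => \sum_(i <- s) F i x).
Proof. by move=> vF x hx; rewrite big1// => i _; rewrite vF. Qed.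

Lemma mol_cvg_sum rho (I : Type) (s : seq I) (F : I -> V -> R) :
  (forall i, sqi mu (F i)) -> (forall i, vanish rho (F i)) ->
  (forall i, P (F i)) -> P (fun x => \sum_(i <- s) F i x).
Proof.
move=> sF vF PF; elim: s => [|i s IH].
  under eq_fun do rewrite big_nil.
  by apply: (@mol_cvg_continuous rho (cst 0) 0) => //; [exact: cst_continuous|move=> x; rewrite normr0].
have := mol_cvg_lin 1 1 (sF i) (sqi_sum s sF) (vF i) (vanish_sum s vF) (PF i) IH.
by congr P; apply/funext => x; rewrite big_cons !mul1r.
Qed.

(** Simple functions increasing to [f] are dominated by [f], hence converge to it in L^2. *)
Lemma mol_cvg_ge0 rho f : sqi mu f -> vanish rho f -> (forall x, 0 <= f x) -> P f.
Proof.
move=> sf vf f0; have [mf if2] := sf.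
have mEf : measurable_fun setT (EFin \o f) by exact/measurable_EFinP.
pose g := nnsfun_approx measurableT mEf.
have gcv x : g m x @[m --> \oo] --> f x.
  have h : (EFin \o f) x \is a fin_num by [].
  have := @cvg_nnsfun_approx _ _ _ _ measurableT _ mEf (fun x _ => f0 x) x I.
  by move/fine_cvg.
have ndg x : nondecreasing_seq (g ^~ x).
  by move=> i j ij; have /lefP := nd_nnsfun_approx measurableT mEf ij; exact.
have gf m x : g m x <= f x.
  rewrite -(cvg_lim (@Rhausdorff R) (gcv x)).
  by apply: nondecreasing_cvgn_le => //; apply/cvg_ex; exists (f x); exact: gcv.
have g0 m x : 0 <= g m x by exact: fun_ge0.
have vg m : vanish rho (g m).
  by move=> x hx; apply/eqP; rewrite eq_le g0 andbT (le_trans (gf m x))// vf.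
have mg m : measurable_fun setT (g m) by exact: measurable_funP.
have [||||_ cU] := @sqn_dominated _ _ _ mu g f f => //.
  by move=> m x; rewrite ger0_norm.
have sg m : sqi mu (g m).
  by apply: (le_sqi (mg m) sf) => x; rewrite !ger0_norm.
apply: (mol_cvg_closed sg vg sf vf cU) => m.
pose F (c : R) x := c * \1_(g m @^-1` [set c] `&` eball n rho) x.
have mA c : measurable (g m @^-1` [set c]).
  by rewrite -[X in measurable X]setTI; exact: mg.
have [s gE] : exists s : seq R, forall x,
    g m x = \sum_(c <- s) (c * \1_(g m @^-1` [set c]) x).
  by eexists => x; rewrite {1}(fimfunE (g m)) fsbig_finite//=.
have -> : (g m : V -> R) = (fun x => \sum_(c <- s) F c x).
  apply/funext => x; have [hx|hx] := leP rho (enorm x).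
    rewrite vg// big1// => i _; rewrite /F indicE memNset ?mulr0// => -[_].
    by rewrite /eball/= ltNge hx.
  rewrite gE; apply: eq_bigr => i _; rewrite /F !indicE in_setI.
  by rewrite [x \in eball _ _]mem_set// andbT.
have sI (B : set V) : measurable B -> sqi mu (\1_(B `&` eball n rho) : V -> R).
  move=> mB; apply: (le_sqi _ (sqi_indic_eball rho)).
    by apply: measurable_indic; apply: measurableI => //; exact: measurable_eball.
  move=> x; rewrite !indicE in_setI.
  by case: (x \in B); case: (x \in _); rewrite ?normr0 ?normr1.
have vI (B : set V) : vanish rho (\1_(B `&` eball n rho) : V -> R).
  by move=> x hx; rewrite indicE memNset// => -[_]; rewrite /eball/= ltNge hx.
apply: (mol_cvg_sum (rho := rho)).
- by move=> i; apply: sqiZ; exact: sI.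
- by move=> i x hx; rewrite /F vI// mulr0.
- move=> c; have := mol_cvg_lin c 0 (sI _ (mA c)) (sI _ (mA c)) (vI _) (vI _)
    (mol_cvg_indic rho (mA c)) (mol_cvg_indic rho (mA c)).
  by congr P; apply/funext => x; rewrite mul0r addr0.
Qed.

Lemma mol_cvg rho f : sqi mu f -> vanish rho f -> P f.
Proof.
move=> sf vf; have [mf _] := sf.
have sp : sqi mu (fun x => Num.max (f x) 0).
  apply: (le_sqi _ sf); first exact: measurable_maxr.
  move=> x; rewrite ger0_norm ?le_max ?lexx ?orbT//.
  by rewrite ge_max ler_norm normr_ge0.
have sn : sqi mu (fun x => Num.max (- f x) 0).
  apply: (le_sqi _ sf).
    by apply: measurable_maxr => //; exact: measurable_funN.
  move=> x; rewrite ger0_norm ?le_max ?lexx ?orbT//.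
  by rewrite ge_max normr_ge0 -normrN ler_norm.
have vp : vanish rho (fun x => Num.max (f x) 0).
  by move=> x hx; rewrite vf// maxxx.
have vn : vanish rho (fun x => Num.max (- f x) 0).
  by move=> x hx; rewrite vf// oppr0 maxxx.
have Pp : P (fun x => Num.max (f x) 0).
  by apply: (mol_cvg_ge0 sp vp) => x; rewrite le_max lexx orbT.
have Pn : P (fun x => Num.max (- f x) 0).
  by apply: (mol_cvg_ge0 sn vn) => x; rewrite le_max lexx orbT.
have := mol_cvg_lin 1 (-1) sp sn vp vn Pp Pn.
congr P; apply/funext => x; rewrite mul1r mulN1r.
have [h|h] := leP 0 (f x).
  by rewrite (max_idPr _) ?subr0// oppr_le0.
by rewrite (max_idPl _) ?opprK ?add0r// oppr_ge0 ltW.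
Qed.

End mollification_converges.

(** * Smooth functions and bump functions *)

Section smooth_flat_function.
Context {R : realType}.

(* The derivatives of exp(-1/s), extended by 0 to s <= 0, are combinations of
   these functions, so the family is closed under differentiation. *)
Definition flat (k : nat) (s : R) : R :=
  if 0 < s then s^-1 ^+ k * expR (- s^-1) else 0.

Lemma flat_le0 k s : s <= 0 -> flat k s = 0.
Proof. by move=> s0; rewrite /flat ltNge s0. Qed.

Lemma flat_ge0 k s : 0 <= flat k s.
Proof.
rewrite /flat; case: ifPn => // s0.
by rewrite mulr_ge0 ?expR_ge0// exprn_ge0// invr_ge0 ltW.
Qed.

(** With t = 1/s this is t^k / k! <= exp t, a single term of the exponential series. *)
Lemma flat_le k s : flat k s <= k`!%:R.
Proof.
rewrite /flat; case: ifPn => // s0.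
have t0 : 0 <= s^-1 by rewrite invr_ge0 ltW.
rewrite expRN ler_pdivrMr ?expR_gt0//.
case: k => [|k]; first by rewrite expr0 mul1r -expR0 ler_expR.
rewrite -ler_pdivrMl ?ltr0n ?fact_gt0// mulrC.
by apply: le_trans (expR_ge1Dxn k t0); rewrite lerDr.
Qed.

(** For positive [s], [flat k s] is [s] times the bounded [flat k.+1 s]; this decay gives the
    derivative at 0. *)
Lemma flat_small k s : flat k s <= k.+1`!%:R * `|s|.
Proof.
have [s0|s0] := leP s 0; first by rewrite flat_le0// mulr_ge0.
rewrite (gtr0_norm s0) -ler_pdivrMr//; apply: le_trans (flat_le k.+1 s).
by rewrite /flat s0 exprSr mulrAC.
Qed.

Lemma is_derive_flat (k : nat) (s : R) : is_derive s 1 (flat k) (flat k.+2 s - k%:R * flat k.+1 s).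
Proof.
have [s0|s0|->] := ltgtP s 0.
- apply: (@near_eq_is_derive _ _ _ (cst 0)).
    have : \forall t \near s, t < 0 by exact: lt_nbhsl.
    by apply: filterS => t t0; rewrite flat_le0// ltW.
  by rewrite !flat_le0 ?ltW// mulr0 subr0; exact: is_derive_cst.
- apply: (@near_eq_is_derive R R R (fun t : R => (t^-1 ^+ k * expR (- t^-1)))).
    have : \forall t \near s, 0 < t by exact: lt_nbhsr.
    by apply: filterS => t t0; rewrite /flat t0.
  have sn : s != 0 by rewrite gt_eqF.
  have d1 : is_derive s 1 (fun t : R => t^-1) (- s ^- 2).
    apply: DeriveDef; first exact: (derivableV sn (@derivable_id _ _ s 1)).
    by rewrite (deriveV sn (@derivable_id _ _ s 1)) derive_id [LHS]mulr1.
  have d2 := is_deriveX k d1.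
  have d3 : is_derive s 1 (fun t : R => - t^-1) (- - s ^- 2) := is_deriveN d1.
  have d4 := @is_derive1_comp R expR (fun t : R => - t^-1) s _ _ (is_derive_expR (- s^-1)) d3.
  have powE (t : R) : ((fun t : R => t^-1) ^+ k) t = t^-1 ^+ k.
    by elim: k {d2} => [|j IH]; rewrite ?expr0// !exprS -IH.
  rewrite (_ : (fun t : R => _) =
      ((fun t : R => t^-1) ^+ k) * (expR \o (fun t : R => - t^-1))); last first.
    by apply/funext => t; rewrite -powE.
  apply: (is_derive_eq (is_deriveM d2 d4)).
  rewrite /flat s0 /GRing.scale/= opprK powE.
  by case: k {d2 powE} => [|k]; rewrite /= -exprVn ?exprS; ring.
rewrite !flat_le0// mulr0 subr0.
(* The difference quotient of [flat k] at 0 is [flat k.+1], which tends to 0 there. *)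
have cv : h^-1 *: ((flat k \o shift 0) (h *: 1) - flat k 0) @[h --> 0^'] --> (0 : R).
  apply: (@cvg_trans _ (flat k.+1 h @[h --> 0^'])).
    apply: near_eq_cvg; near=> h.
    have h0 : h != 0 by near: h; exact: nbhs_dnbhs_neq.
    rewrite /= addr0 [_%:A]mulr1 (flat_le0 _ (lexx 0)) subr0 /GRing.scale/=.
    have [h1|h1|/eqP] := ltgtP h 0; last by rewrite (negbTE h0).
      by rewrite !flat_le0 ?ltW// mulr0.
    by rewrite /flat h1 exprS mulrA.
  apply/cvgr0Pnorm_le => e e0; near=> h.
  rewrite ger0_norm ?flat_ge0//; apply: (le_trans (flat_small _ _)).
  rewrite -ler_pdivlMl ?ltr0n ?fact_gt0//.
  near: h; apply: cvg_within; apply/nbhs_ballP.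
  exists ((k.+2`!%:R)^-1 * e); first by rewrite /= mulr_gt0// invr_gt0 ltr0n fact_gt0.
  by move=> h; rewrite -ball_normE /= sub0r normrN => /ltW.
apply: DeriveDef; first by apply/cvg_ex; exists 0.
by apply/cvg_lim; first exact: Rhausdorff.
Unshelve. all: by end_near. Qed.

Lemma continuous_flat k : continuous (flat k).
Proof.
move=> s; apply: differentiable_continuous; apply/derivable1_diffP.
by have [] := is_derive_flat k s.
Qed.

End smooth_flat_function.

Section smooth_functions.
Context {R : realType} {n : nat}.
Local Notation V := 'rV[R]_n.
Implicit Types f g : V -> R.
Local Notation e_ i := (delta_mx 0 i : V).

Lemma smooth_partial f i : smooth f -> smooth (partial i f).
Proof. by move=> sf s; have := sf (rcons s i); rewrite /iter_partial foldr_rcons. Qed.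

(** Smoothness concerns all words of partial derivatives; a class of continuous, partially
    differentiable functions closed under [partial] is an invariant for induction on the word. *)
Lemma smooth_coind (P : (V -> R) -> Prop) :
  (forall f, P f -> [/\ continuous f, (forall x i, derivable f x (e_ i)) &
     forall i, P (partial i f)]) ->
  forall f, P f -> smooth f.
Proof.
move=> HP f Pf s.
suff /HP[] : P (iter_partial s f) by [].
by elim: s => // i s IH /=; case: (HP _ IH).
Qed.

Lemma derive1P f (x v : V) : 'D_v f x = 'D_1 (fun t : R => f (t *: v + x)) 0.
Proof.
rewrite /derive (_ : (fun h : R => h^-1 *: ((f \o shift x) (h *: v) - f x)) =
  (fun h : R => h^-1 *: (((fun t : R => f (t *: v + x)) \o shift 0) (h *: 1) -
     f (0 *: v + x))))//.
by apply/funext => t; rewrite /= addr0 scale0r add0r [_%:A]mulr1.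
Qed.

(** The Leibniz rule turns a product into a sum of products, so sums, products and compositions with
    [flat] are treated as one class that differentiation maps into itself. *)
Inductive gen_smooth : (V -> R) -> Prop :=
| gen_base f : smooth f -> gen_smooth f
| gen_add f g : gen_smooth f -> gen_smooth g -> gen_smooth (fun x => f x + g x)
| gen_mul f g : gen_smooth f -> gen_smooth g -> gen_smooth (fun x => f x * g x)
| gen_flat k f : gen_smooth f -> gen_smooth (fun x => flat k (f x)).

Lemma is_derive_flat_comp k f x v df : is_derive x v f df ->
  is_derive x v (fun y => flat k (f y))
    ((flat k.+2 (f x) - k%:R * flat k.+1 (f x)) * df).
Proof.
move=> [fv fdf].
pose h (t : R) := f (t *: v + x).
have dh : is_derive (0:R) 1 h df.
  by apply: DeriveDef; [exact: (derivable1P f x v).1|rewrite -derive1P].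
have h0 : h 0 = f x by rewrite /h scale0r add0r.
have [d1 d2] := is_derive1_comp (is_derive_flat k (h 0)) dh.
rewrite h0 in d2.
by apply: DeriveDef; [exact: (derivable1P _ x v).2|rewrite derive1P -d2].
Qed.

Lemma smooth_cst c : smooth (cst c : V -> R).
Proof.
apply: (@smooth_coind (fun f => exists c, f = cst c)); last by exists c.
move=> _ [a ->]; split.
- exact: cst_continuous.
- by move=> x i; exact: derivable_cst.
- by move=> i; exists 0; apply/funext => x; rewrite /partial derive_cst.
Qed.

Lemma is_derive_coord j (x v : V) : is_derive x v (fun y : V => y 0 j) (v 0 j).
Proof.
have h : (fun t : R => (t *: v + x) 0 j) = (fun t => t * v 0 j + x 0 j).
  by apply/funext => t; rewrite !mxE.
have d : is_derive (0:R) 1 (fun t : R => t * v 0 j + x 0 j) (v 0 j).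
  have h1 := is_deriveM (is_derive_id (0:R) 1) (is_derive_cst (v 0 j) (0:R) 1).
  have h2 := is_deriveD h1 (is_derive_cst (x 0 j) (0:R) 1).
  by apply: (is_derive_eq h2); rewrite /= scaler0 add0r addr0 [LHS]mulr1.
apply: DeriveDef; first by apply/derivable1P; rewrite h; case: d.
by case: d => _ <-; rewrite derive1P h.
Qed.

Lemma smooth_coord j : smooth (fun x : V => x 0 j).
Proof.
apply: (@smooth_coind (fun f => f = (fun x : V => x 0 j) \/ exists c, f = cst c)); last by left.
move=> _ [->|[c ->]]; split.
- exact: rV_coord_continuous.
- by move=> x i; have [] := is_derive_coord j x (e_ i).
- move=> i; right; exists ((e_ i) 0 j); apply/funext => x.
  by have [] := is_derive_coord j x (e_ i).
- exact: cst_continuous.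
- by move=> x i; exact: derivable_cst.
- by move=> i; right; exists 0; apply/funext => x; rewrite /partial derive_cst.
Qed.

Lemma gen_smoothP f : gen_smooth f -> [/\ continuous f,
  (forall x i, derivable f x (e_ i)) & forall i, gen_smooth (partial i f)].
Proof.
elim => {f} [f sf|f g Gf [cf df pf] Gg [cg dg pg]|f g Gf [cf df pf] Gg [cg dg pg]|k f Gf [cf df pf]].
- split.
  + by case: (sf [::]).
  + by case: (sf [::]).
  + by move=> i; apply: gen_base; exact: smooth_partial.
- split.
  + by move=> x; apply: (@cvgD _ _ _ (nbhs x)); [exact: cf|exact: cg].
  + by move=> x i; exact: (derivableD (df x i) (dg x i)).
  + move=> i; have -> : partial i (fun x => f x + g x) = (fun x => partial i f x + partial i g x).
      by apply/funext => x; rewrite /partial (deriveD (df x i) (dg x i)).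
    exact: gen_add.
- split.
  + by move=> x; apply: (@cvgM _ _ (nbhs x)); [exact: cf|exact: cg].
  + by move=> x i; exact: (derivableM (df x i) (dg x i)).
  + move=> i; have -> : partial i (fun x => f x * g x) =
        (fun x => f x * partial i g x + g x * partial i f x).
      by apply/funext => x; rewrite /partial (deriveM (df x i) (dg x i)).
    by apply: gen_add; apply: gen_mul.
- have D x i : is_derive x (e_ i) (fun y => flat k (f y))
      ((flat k.+2 (f x) - k%:R * flat k.+1 (f x)) * partial i f x).
    by apply: is_derive_flat_comp; apply: derivableP.
  split.
  + move=> x; apply: (@continuous_comp _ _ _ f (flat k)); first exact: cf.
    exact: continuous_flat.
  + by move=> x i; have [] := D x i.
  + move=> i; have -> : partial i (fun x => flat k (f x)) =
        (fun x => (flat k.+2 (f x) + (- k%:R) * flat k.+1 (f x)) * partial i f x).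
      by apply/funext => x; have [_ ] := D x i; rewrite /partial mulNr.
    apply: gen_mul => //; apply: gen_add; first exact: gen_flat.
    by apply: gen_mul; [apply: gen_base; exact: smooth_cst|exact: gen_flat].
Qed.

Lemma gen_smooth_smooth f : gen_smooth f -> smooth f.
Proof. by apply: smooth_coind => g; exact: gen_smoothP. Qed.

Lemma smoothD f g : smooth f -> smooth g -> smooth (fun x => f x + g x).
Proof. by move=> sf sg; apply: gen_smooth_smooth; apply: gen_add; exact: gen_base. Qed.

Lemma smoothM f g : smooth f -> smooth g -> smooth (fun x => f x * g x).
Proof. by move=> sf sg; apply: gen_smooth_smooth; apply: gen_mul; exact: gen_base. Qed.

Lemma smooth_flat k f : smooth f -> smooth (fun x => flat k (f x)).
Proof. by move=> sf; apply: gen_smooth_smooth; apply: gen_flat; exact: gen_base. Qed.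

Lemma smooth_sum (I : Type) (s : seq I) (F : I -> V -> R) :
  (forall i, smooth (F i)) -> smooth (fun x => \sum_(i <- s) F i x).
Proof.
move=> sF; elim: s => [|i s IH].
  by under eq_fun do rewrite big_nil; exact: smooth_cst.
by under eq_fun do rewrite big_cons; exact: smoothD.
Qed.

End smooth_functions.

(** * Test functions and mean value bounds *)

Section test_functions.
Context {R : realType} {n : nat}.
Local Notation V := 'rV[R]_n.
Local Notation mu := (leb n).
Implicit Types f g k phi psi : V -> R.
Implicit Types x y z : V.
Local Notation e_ i := (delta_mx 0 i : V).

Lemma compact_closed_eball (r : R) : compact [set x : V | enorm x <= r].
Proof.
apply: bounded_closed_compact.
  exists r; split; first exact: num_real.
  move=> M rM x /= hx; rewrite (le_trans (norm_le_enorm _))// (le_trans hx)//.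
  exact: ltW.
rewrite (_ : mkset _ = @enorm R n @^-1` [set t | t <= r])//.
apply: closed_comp => [x _|]; first exact: enorm_continuous.
exact: closed_le.
Qed.

Lemma vanish_bounded f r : continuous f -> vanish r f ->
  exists2 C, 0 <= C & forall x, `|f x| <= C.
Proof.
move=> cf vf; have [r0|r0] := ltP r 0.
  by exists 0 => // x; rewrite vf ?normr0// (le_trans (ltW r0))// enorm_ge0.
have [] := @compact_EVT_max V R (fun x => `|f x|) [set x : V | enorm x <= r].
- by exists 0; rewrite /= enorm0.
- exact: compact_closed_eball.
- apply: continuous_subspaceT => x; apply: (@cvg_norm _ _ _ (nbhs x)).
  exact: cf.
move=> c _ hc; exists `|f c| => // x.
have [h|h] := leP (enorm x) r; first by apply: hc; rewrite inE.
by rewrite vf ?normr0// ltW.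
Qed.

(** The radius grows because only strictly beyond [r] is [f] known to vanish in a whole
    neighbourhood. *)
Lemma vanish_partial f r s i : r < s -> vanish r f -> vanish s (partial i f).
Proof.
move=> rs vf x hx; rewrite /partial.
have -> : 'D_(e_ i) f x = 'D_(e_ i) (cst 0 : V -> R) x; last by rewrite derive_cst.
apply: (@near_eq_derive _ _ _ f (cst 0 : V -> R) x).
have : nbhs x (@enorm R n @^-1` `]r, +oo[).
  apply: open_nbhs_nbhs; split; last by rewrite /= in_itv/= andbT (lt_le_trans rs).
  by apply: open_comp => // y _; exact: enorm_continuous.
by apply: filterS => y; rewrite /= in_itv/= andbT => /ltW/vf.
Qed.

Lemma test_function_vanish phi r : 0 < r -> test_function (eball n r) phi ->
  smooth phi /\ exists2 s, 0 < s < r & vanish s phi.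
Proof.
move=> r0 [sp cp sub]; split => //.
have [h|h] := pselect ([set x | phi x != 0] !=set0); last first.
  (* The function is identically zero, so any positive radius below [r] works. *)
  exists (r / 2); first by rewrite divr_gt0//= ltr_pdivrMr// mulr_natr mulr2n ltrDl.
  move=> x _; apply/eqP/negPn/negP => hx; apply: h; by exists x.
have [] := @compact_EVT_max V R (@enorm R n) (closure [set x | phi x != 0]).
- by case: h => x hx; exists x; exact: subset_closure.
- exact: cp.
- by apply: continuous_subspaceT; exact: enorm_continuous.
move=> c; rewrite inE => hc cmax; have {}hc : enorm c < r := sub _ hc.
have c0 := enorm_ge0 c.
exists ((enorm c + r) / 2); first by apply/andP; split; lra.
move=> x hx; apply/eqP/negPn/negP => px.
have : enorm x <= enorm c by apply: cmax; rewrite inE; exact: subset_closure.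
lra.
Qed.

Lemma vanish_test_function phi r s : s < r -> smooth phi -> vanish s phi ->
  test_function (eball n r) phi.
Proof.
move=> sr sp vp.
have h : closure [set x | phi x != 0] `<=` [set x : V | enorm x <= s].
  have cB : closed [set x : V | enorm x <= s].
    rewrite (_ : mkset _ = @enorm R n @^-1` [set t | t <= s])//.
    apply: closed_comp => [x _|]; first exact: enorm_continuous.
    exact: closed_le.
  rewrite [X in _ `<=` X]((closure_id _).1 cB); apply: closureS => x /=.
  by apply: contraR; rewrite -ltNge => /ltW/vp ->.
split => //; last by move=> x /h /= /le_lt_trans; apply.
apply: (subclosed_compact _ _ h); first exact: closed_closure.
exact: compact_closed_eball.
Qed.

Lemma derive_along f x v (t : R) : derivable f (x + t *: v) v ->
  is_derive t 1 (fun s : R => f (x + s *: v)) ('D_v f (x + t *: v)).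
Proof.
move=> df.
have h : is_derive (0:R) 1 (fun s : R => f (s *: v + (x + t *: v))) ('D_v f (x + t *: v)).
  by apply: DeriveDef; [exact: (derivable1P _ _ _).1|rewrite -derive1P].
have h' : is_derive ((shift (- t)) t) 1 (fun s : R => f (s *: v + (x + t *: v))) ('D_v f (x + t *: v)).
  by rewrite /= subrr.
have h2 := is_derive1_comp h' (is_derive_shift t 1 (- t)).
rewrite mulr1 in h2.
apply: (is_derive_eq (f := fun s : R => f (x + s *: v))) => //.
rewrite (_ : (fun s : R => f (x + s *: v)) = (fun s : R => f (s *: v + (x + t *: v))) \o shift (- t))//.
apply/funext => s /=; congr f.
by rewrite scalerDl scaleNr addrACA addNr addr0 addrC.
Qed.

Lemma lip_along f v C : (forall x, derivable f x v) ->
  (forall x, `|'D_v f x| <= C) -> forall x (t : R), `|f (x + t *: v) - f x| <= C * `|t|.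
Proof.
move=> df fC x.
have pos y (t : R) : 0 < t -> `|f (y + t *: v) - f y| <= C * `|t|.
  move=> t0.
  have D s := derive_along (df (y + s *: v)).
  have cD : {within `[0, t], continuous (fun s : R => f (y + s *: v))}.
    apply: derivable_within_continuous => s _.
    by have [] := D s.
  have [c _ hc] := @MVT R (fun s : R => f (y + s *: v)) (fun s => 'D_v f (y + s *: v)) 0 t t0 (fun s _ => D s) cD.
  have -> : f (y + t *: v) - f y = 'D_v f (y + c *: v) * t.
    by move: hc; rewrite scale0r addr0 subr0.
  by rewrite normrM ler_wpM2r.
move=> t; have [t0|t0|->] := ltgtP t 0.
- have := pos (x + t *: v) (- t); rewrite oppr_gt0 => /(_ t0).
  by rewrite scaleNr addrK distrC normrN.
- exact: pos.
- by rewrite scale0r addr0 subrr !normr0 mulr0.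
Qed.

(** Passes from [x] to [y] one coordinate at a time; [m] counts the leading coordinates still
    allowed to differ. *)
Lemma lip_of_partials f C : 0 <= C -> (forall x i, derivable f x (e_ i)) ->
  (forall x i, `|partial i f x| <= C) ->
  forall x y, `|f x - f y| <= (n%:R * C) * `|x - y|.
Proof.
move=> C0 df fC.
suff H m : (m <= n)%N -> forall x y, (forall i : 'I_n, (m <= i)%N -> x 0 i = y 0 i) ->
    `|f x - f y| <= (m%:R * C) * `|x - y|.
  by move=> x y; apply: H => // i; rewrite leqNgt ltn_ord.
elim: m => [_ x y xy|m IH mn x y xy].
  suff -> : x = y by rewrite !subrr !normr0 mulr0.
  by apply/rowP => i; exact: xy.
pose i0 := Ordinal mn.
pose t := y 0 i0 - x 0 i0.
pose z := x + t *: e_ i0.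
have zE j : z 0 j = if j == i0 then y 0 j else x 0 j.
  rewrite !mxE eqxx /=; case: eqP => [->|_]; last by rewrite mulr0 addr0.
  by rewrite mulr1 /t addrC subrK.
have h1 : `|f x - f z| <= C * `|x - y|.
  rewrite distrC; apply: (le_trans (lip_along (fun x => df x i0) (fun x => fC x i0) x t)).
  rewrite ler_wpM2l// /t distrC; apply: le_trans (le_coord_norm (x - y) i0).
  by rewrite !mxE.
have h2 : `|f z - f y| <= (m%:R * C) * `|x - y|.
  apply: (le_trans (IH (ltnW mn) z y _)).
    move=> i mi; rewrite zE; case: eqP => // /eqP ii0; apply: xy.
    by rewrite ltn_neqAle mi andbT; apply: contraNneq ii0 => mii; apply/eqP/val_inj.
  rewrite ler_wpM2l ?mulr_ge0//.
  rewrite [leLHS]/Num.norm /= mx_normrE; apply/bigmax_leP; split => // -[a j] _ /=.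
  rewrite ord1.
  have -> : (z - y) 0 j = if j == i0 then 0 else (x - y) 0 j.
    by rewrite mxE zE; case: eqP => // _; rewrite ?mxE ?subrr.
  by case: eqP => // _; [rewrite normr0|exact: le_coord_norm].
rewrite -(subrKA (f z)) (le_trans (ler_normD _ _))//.
by rewrite -natr1 !mulrDl mul1r addrC lerD.
Qed.

Lemma smooth_lip f r : smooth f -> vanish r f ->
  exists2 L, 0 <= L & forall x y, `|f x - f y| <= L * `|x - y|.
Proof.
move=> sf vf; have [_ df] := sf [::].
have /choice[C hC] : forall i, exists C, 0 <= C /\ forall x, `|partial i f x| <= C.
  move=> i; have r1 : r < r + 1 by rewrite ltrDl.
  have [C C0 hC] := vanish_bounded (sf [:: i]).1 (vanish_partial i r1 vf).
  by exists C.
exists (n%:R * \sum_i C i).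
  by rewrite mulr_ge0// sumr_ge0// => i _; case: (hC i).
apply: lip_of_partials => //.
  by rewrite sumr_ge0// => i _; case: (hC i).
move=> x i; apply: (le_trans ((hC i).2 x)).
by rewrite (bigD1 i)//= lerDl sumr_ge0// => j _; case: (hC j).
Qed.

End test_functions.

(** * Derivatives of mollifications and integrals of derivatives *)

Section smoothness_of_mollification.
Context {R : realType} {n : nat}.
Local Notation V := 'rV[R]_n.
Local Notation mu := (leb n).
Implicit Types f g k phi psi : V -> R.
Implicit Types x y z : V.
Local Notation e_ i := (delta_mx 0 i : V).

Lemma is_derive_shift_kernel k f i x y (t : R) : (forall x, derivable k x (e_ i)) ->
  is_derive t 1 (fun s : R => f x * k (x - (s *: e_ i + y)))
    (f x * - partial i k (x - (t *: e_ i + y))).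
Proof.
move=> dk.
have h1 := @derive_along R n k (x - y) (e_ i) (- t) (dk _).
have h2 : is_derive t 1 (fun s : R => - s) (- 1) := is_deriveN (is_derive_id t 1).
have h3 := @is_derive1_comp R (fun s : R => k (x - y + s *: e_ i)) (fun s : R => - s) t _ _ h1 h2.
have E (s : R) : x - y + - s *: e_ i = x - (s *: e_ i + y).
  by rewrite scaleNr opprD addrA addrAC.
have h4 := is_deriveZ (f x) h3.
rewrite (_ : (fun s : R => _) = f x *: ((fun s : R => k (x - y + s *: e_ i)) \o (fun s : R => - s))).
  by apply: (is_derive_eq h4); rewrite E mulrN1.
by apply/funext => s; rewrite /= -E.
Qed.

(** Differentiation under the integral: the derivative falls on the kernel, with a minus sign
    because [y] enters through [k (x - y)]. *)
Lemma is_derive_mol k f r i y : smooth k -> vanish r k -> rintegrable mu f ->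
  is_derive y (e_ i) (mol k f) (mol (fun x => - partial i k x) f y).
Proof.
move=> sk vk rf.
have [ck dk] := sk [::].
have [K K0 kK] := vanish_bounded ck vk.
have mk := continuous_measurable_rV ck.
have r1 : r < r + 1 by rewrite ltrDl.
have [C C0 hC] := vanish_bounded (sk [:: i]).1 (vanish_partial i r1 vk).
have {}hC x : `|partial i k x| <= C by exact: hC.
pose F (t : R) x := f x * k (x - (t *: e_ i + y)).
have FE : (fun t : R => mol k f (t *: e_ i + y)) = (fun t => \int[mu]_x F t x) by [].
have dF (t : R) x := @is_derive_shift_kernel k f i x y t (fun z => dk z i).
have I0 : (`]-1, 1[%classic : set R) 0 by rewrite /= in_itv/= ltrN10 ltr01.
have iF (t : R) : `]-1, 1[%classic t -> mu.-integrable setT (EFin \o F t).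
  by move=> _; exact: (rintegrable_mol mk kK).
have dF' (t : R) x : `]-1, 1[%classic t -> setT x -> derivable (F ^~ x) t 1.
  by move=> _ _; have [] := dF t x.
have pF (t : R) x : partial1of2 F t x = f x * - partial i k (x - (t *: e_ i + y)).
  by rewrite partial1of2E; have [_ ] := dF t x.
pose G x := C * `|f x|.
have G0 x : 0 <= G x by rewrite mulr_ge0.
have iG : mu.-integrable setT (EFin \o G) by apply: rintegrableZ; exact: rintegrable_norm.
have GF (t : R) x : `]-1, 1[%classic t -> setT x -> `|partial1of2 F t x| <= G x.
  by move=> _ _; rewrite pF normrM normrN mulrC ler_wpM2r.
apply: DeriveDef.
  apply/derivable1P; rewrite FE.
  exact: (derivable_under_integral measurableT I0 iF dF' G0 iG GF).
rewrite derive1P FE -derive1E.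
rewrite (differentiation_under_integral measurableT I0 iF dF' G0 iG GF).
by apply: eq_Rintegral => x _; rewrite pF scale0r add0r.
Qed.

Lemma smoothN f : smooth f -> smooth (fun x => - f x).
Proof.
move=> sf; have := smoothM (smooth_cst (-1)) sf.
by congr smooth; apply/funext => x; rewrite mulN1r.
Qed.

Lemma smooth_mol k f r : smooth k -> vanish r k -> rintegrable mu f ->
  smooth (mol k f).
Proof.
move=> sk vk rf.
(* Kernel and radius vary within the class, since each derivative replaces [k] by [- partial i k]
   and enlarges the radius. *)
apply: (@smooth_coind _ _ (fun g => exists r k, [/\ smooth k, vanish r k & g = mol k f])); last by exists r, k.
move=> _ [{}r [{}k [{}sk {}vk ->]]]; split.
- have [L L0 kL] := smooth_lip sk vk.
  have [K K0 kK] := vanish_bounded (sk [::]).1 vk.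
  exact: (lip_continuous (lip_mol kL kK rf)).
- by move=> x i; have [] := is_derive_mol i x sk vk rf.
- move=> i; exists (r + 1), (fun x => - partial i k x); split.
  + by apply: smoothN; exact: smooth_partial.
  + have r1 : r < r + 1 by rewrite ltrDl.
    by move=> x hx; rewrite (vanish_partial i r1 vk)// oppr0.
  + by apply/funext => x; have [_ <-] := is_derive_mol i x sk vk rf.
Qed.

Lemma vanish_shift f y r : vanish r f -> vanish (r + enorm y) (fun x => f (x + y)).
Proof.
move=> vf x hx; apply: vf.
by have := enormB_ge x (- y); rewrite enormN opprK; lra.
Qed.

Lemma rintegrable_vanish f r : continuous f -> vanish r f -> rintegrable mu f.
Proof.
move=> cf vf; have [C C0 hC] := vanish_bounded cf vf.
have mf := continuous_measurable_rV cf.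
exact: (sqi_rintegrable (sqi_bounded mf vf hC) vf).
Qed.

Lemma enorm_delta i : enorm (e_ i) = 1.
Proof.
rewrite /enorm (bigD1 i)//= big1 ?addr0; last first.
  by move=> j ji; rewrite mxE (negbTE ji) andbF expr0n.
by rewrite mxE !eqxx expr1n sqrtr1.
Qed.

(** The difference quotients have integral zero by translation invariance, and they converge to the
    derivative under a uniform bound. *)
Lemma Rintegral_partial psi r i : continuous psi ->
  (forall x, derivable psi x (e_ i)) -> continuous (partial i psi) ->
  vanish r psi -> \int[mu]_x partial i psi x = 0.
Proof.
move=> cp dp cdp vp.
have r1 : r < r + 1 by rewrite ltrDl.
have [C C0 hC] := vanish_bounded cdp (vanish_partial i r1 vp).
pose h (m : nat) : R := m.+1%:R^-1.
have h0 m : 0 < h m by rewrite invr_gt0.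
have h1 m : h m <= 1 by rewrite invf_le1// ler1n.
pose F m x := (h m)^-1 * (psi (x + h m *: e_ i) - psi x).
have rp : rintegrable mu psi by exact: rintegrable_vanish cp vp.
have IF m : \int[mu]_x F m x = 0.
  have rs := rintegrable_shift (h m *: e_ i) rp.
  rewrite RintegralZl//; last exact: rintegrableB.
  rewrite RintegralB//.
  have := Rintegral_affine (h m *: e_ i) ltr01 rp.
  under eq_Rintegral do rewrite scale1r.
  by rewrite expr1n invr1 mul1r => ->; rewrite subrr mulr0.
have vF m : vanish (r + 1) (F m).
  move=> x hx; rewrite /F.
  have hm : enorm (h m *: e_ i) <= 1.
    by rewrite enormZ enorm_delta mulr1 gtr0_norm.
  rewrite (vanish_shift vp (y := h m *: e_ i)); last by apply: le_trans hx; rewrite lerD2l.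
  by rewrite vp ?subrr ?mulr0// (le_trans _ hx)// lerDl.
have cF m : continuous (F m).
  move=> x; apply: (@cvgMl_tmp _ _ (nbhs x)).
  apply: (@cvgB _ _ _ (nbhs x)); last exact: cp.
  apply: (@continuous_comp _ _ _ (fun x : V => x + h m *: e_ i) psi); last exact: cp.
  by apply: (@cvgD _ _ _ (nbhs x)); [exact: cvg_id|exact: cvg_cst].
have FC m x : `|F m x| <= C.
  rewrite /F normrM gtr0_norm ?invr_gt0// ler_pdivrMl//.
  have := @lip_along R n psi (e_ i) C dp hC x (h m).
  by rewrite (gtr0_norm (h0 m)) mulrC.
have [||||_ cvF] := @sqn_dominated _ _ _ mu F (partial i psi)
   (fun x => C * \1_(eball n (r + 1)) x).
- by move=> m; exact: continuous_measurable_rV.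
- by apply: sqiZ; exact: sqi_indic_eball.
- move=> x.
  have : t^-1 *: ((psi \o shift x) (t *: e_ i) - psi x) @[t --> 0^'] --> partial i psi x.
    exact: dp.
  move/cvgr_dnbhsP => /(_ h) H.
  have -> : F ^~ x = (fun m => (h m)^-1 *: ((psi \o shift x) (h m *: e_ i) - psi x)).
    by apply/funext => m; rewrite /F /= [x + _]addrC.
  apply: H; split; first by move=> m; rewrite gt_eqF.
  exact: cvg_harmonic.
- by move=> m x; exact: (vanish_norm_le (vF m)).
have sF m : sqi mu (F m).
  exact: (sqi_bounded (continuous_measurable_rV (cF m)) (vF m) (FC m)).
have sp := sqi_bounded (continuous_measurable_rV cdp) (vanish_partial i r1 vp) hC.
(* Testing against the indicator of a ball outside which all these functions vanish turns L^2
   convergence into convergence of integrals. *)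
have := cvg_Rintegral_mul sF sp (sqi_indic_eball (r + 1)) cvF.
have E g : vanish (r + 1) g -> (fun x => g x * \1_(eball n (r + 1)) x) = g.
  move=> vg; apply/funext => x; have [hx|hx] := leP (r + 1) (enorm x).
    by rewrite vg// mul0r.
  by rewrite indicE mem_set// mulr1.
have -> : (fun m => \int[mu]_x (F m x * \1_(eball n (r + 1)) x)) = cst 0.
  by apply/funext => m; rewrite E// IF.
rewrite E; last exact: vanish_partial vp.
by move/(cvg_unique (@Rhausdorff R)) => /(_ _ (cvg_cst 0)).
Qed.

End smoothness_of_mollification.

Lemma lip_of_derive (R : realType) (f df : R -> R) (I : interval R) C :
  (forall t, t \in I -> is_derive t 1 f (df t)) ->
  (forall t, t \in I -> `|df t| <= C) ->
  {in I &, forall a b, `|f a - f b| <= C * `|a - b|}.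
Proof.
move=> fdf dfC.
suff H a b : a \in I -> b \in I -> a < b -> `|f b - f a| <= C * `|b - a|.
  move=> a b aI bI; have [ab|ab|->] := ltgtP a b.
  - by rewrite distrC [`|a - b|]distrC; exact: H.
  - exact: H.
  - by rewrite !subrr normr0 mulr0.
move=> aI bI ab.
have sub t : t \in `[a, b] -> t \in I.
  rewrite in_itv/= => /andP[at_ tb]; move: I aI bI {fdf dfC} => [l u].
  rewrite !itv_boundlr => /andP[h1 _] /andP[_ h2]; apply/andP; split.
    by apply: (le_trans h1); rewrite bnd_simp.
  by apply: le_trans h2; rewrite bnd_simp.
have [||c cI ->] := @MVT R f df a b ab.
- by move=> t /subset_itv_oo_cc/sub; exact: fdf.
- apply: derivable_within_continuous => t /sub tI.
  by have [] := fdf t tI.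
by rewrite normrM ler_wpM2r// dfC// sub// subset_itv_oo_cc.
Qed.

(** * Bump functions and their Laplacians *)

Section bumpf_functions.
Context {R : realType} {n : nat}.
Local Notation V := 'rV[R]_n.
Local Notation mu := (leb n).
Implicit Types u f g : V -> R.
Implicit Types x y z : V.
Local Notation e_ i := (delta_mx 0 i : V).

Definition quad y (r : R) x : R := 1 - r^-1 ^+ 2 * \sum_i (x 0 i - y 0 i) ^+ 2.

(** With q = 1 - |x - y|^2 / r^2 this is q^-k exp(-1/q) inside the ball. Index 0 is the bump used
    for perturbations and index 2 the profile of the averaging kernel; indices 3 and 4 arise in
    their derivatives. *)
Definition bumpf k y (r : R) x : R := flat k (quad y r x).

Lemma sum_sqr_enorm x y : \sum_i (x 0 i - y 0 i) ^+ 2 = enorm (x - y) ^+ 2.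
Proof. by rewrite sqr_enorm; apply: eq_bigr => i _; rewrite !mxE. Qed.

Lemma quad_gt0 y r x : 0 < r -> (0 < quad y r x) = (enorm (x - y) < r).
Proof.
move=> r0; rewrite /quad sum_sqr_enorm subr_gt0 exprVn mulrC ltr_pdivrMr ?exprn_gt0//.
by rewrite mul1r ltr_pXn2r ?nnegrE ?enorm_ge0// ltW.
Qed.

Lemma bumpf_eq0 k y r x : 0 < r -> r <= enorm (x - y) -> bumpf k y r x = 0.
Proof. by move=> r0 h; rewrite /bumpf flat_le0// leNgt quad_gt0// -leNgt. Qed.

Lemma bumpf_ge0 k y r x : 0 <= bumpf k y r x.
Proof. exact: flat_ge0. Qed.

Lemma bumpf_le k y r x : bumpf k y r x <= k`!%:R.
Proof. exact: flat_le. Qed.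

Lemma norm_bumpf_le k y r x : `|bumpf k y r x| <= k`!%:R.
Proof. by rewrite ger0_norm ?bumpf_ge0// bumpf_le. Qed.

(** On the half ball q lies between 1/2 and 1, so exp(-1/q) is at least exp(-2) and the power of 1/q
    at least 1. *)
Lemma bumpf_lower y r x : 0 < r -> enorm (x - y) <= r / 2 ->
  expR (-2) <= bumpf 2 y r x.
Proof.
move=> r0 h.
have q0 : 1 / 2 <= quad y r x.
  rewrite /quad sum_sqr_enorm exprVn [_ * enorm _ ^+ 2]mulrC.
  have : enorm (x - y) ^+ 2 / r ^+ 2 <= (1 / 2) ^+ 2.
    rewrite ler_pdivrMr ?exprn_gt0// -exprMn ler_pXn2r ?nnegrE ?enorm_ge0//; last first.
      by rewrite mulr_ge0// ltW.
    by rewrite mul1r mulrC.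
  by move: (_ / r ^+ 2) => a; lra.
have q1 : quad y r x <= 1.
  rewrite /quad gerBl mulr_ge0 ?exprn_ge0// ?invr_ge0 ?(ltW r0)//.
  by rewrite sumr_ge0// => i _; rewrite sqr_ge0.
have q00 : 0 < quad y r x by lra.
rewrite /bumpf /flat q00 -[leLHS]mul1r ler_pM ?expR_ge0//.
- by rewrite exprn_ege1// invf_ge1.
- rewrite ler_expR lerN2 -[leRHS]invrK lef_pV2 ?posrE//; first by lra.
Qed.

Lemma smooth_quad y r : smooth (quad y r).
Proof.
rewrite /quad; apply: smoothD; first exact: smooth_cst.
apply: smoothN; apply: smoothM; first exact: smooth_cst.
apply: smooth_sum => i; apply: smoothM.
  by apply: smoothD; [exact: smooth_coord|exact: smooth_cst].
by apply: smoothD; [exact: smooth_coord|exact: smooth_cst].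
Qed.

Lemma smooth_bumpf k y r : smooth (bumpf k y r).
Proof. by apply: smooth_flat; exact: smooth_quad. Qed.

Lemma vanish_bumpf k y r : 0 < r -> vanish (enorm y + r) (bumpf k y r).
Proof.
move=> r0 x hx; rewrite bumpf_eq0//.
by have := enormB_ge x y; lra.
Qed.

Lemma rintegrable_bumpf k y r : 0 < r -> rintegrable mu (bumpf k y r).
Proof.
by move=> r0; exact: (rintegrable_vanish (smooth_bumpf k y r [::]).1 (vanish_bumpf k r0)).
Qed.

Lemma is_derive_quad y r x i : is_derive x (e_ i) (quad y r)
  (- 2 * r^-1 ^+ 2 * (x 0 i - y 0 i)).
Proof.
have d1 j := is_deriveB (is_derive_coord j x (e_ i)) (is_derive_cst (y 0 j) x (e_ i)).
have d2 j := is_deriveX 2 (d1 j).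
have d3 := is_derive_sum d2.
have d4 := is_deriveZ (r^-1 ^+ 2) d3.
have d5 := is_deriveB (is_derive_cst (1 : R) x (e_ i)) d4.
rewrite (_ : quad y r = cst 1 - (r^-1 ^+ 2) *: \sum_(j < n) ((fun x : V => x 0 j) - cst (y 0 j)) ^+ 2); last first.
  apply/funext => z; rewrite /quad /= fctE; congr (1 - _ * _).
  by rewrite fct_sumE; apply: eq_bigr => j _.
apply: (is_derive_eq d5); rewrite (bigD1 i)//= big1 ?addr0; last first.
  by move=> j ji; rewrite mxE (negbTE ji) andbF subr0 scaler0.
rewrite mxE !eqxx subr0 sub0r /GRing.scale /= fctE /= -[(- cst (y 0 i)) x]/(- y 0 i); ring.
Qed.

Lemma partial_bumpf k y r i : partial i (bumpf k y r) =
  (fun x => (bumpf k.+2 y r x - k%:R * bumpf k.+1 y r x) * (- 2 * r^-1 ^+ 2 * (x 0 i - y 0 i))).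
Proof.
apply/funext => x.
by have [_] := is_derive_flat_comp k (is_derive_quad y r x i).
Qed.

Lemma partial2_bumpf0 y r i x : partial i (partial i (bumpf 0 y r)) x =
  4 * r^-1 ^+ 4 * (x 0 i - y 0 i) ^+ 2 * (bumpf 4 y r x - 2 * bumpf 3 y r x)
  - 2 * r^-1 ^+ 2 * bumpf 2 y r x.
Proof.
have -> : partial i (bumpf 0 y r) =
    bumpf 2 y r * ((- 2 * r^-1 ^+ 2) *: ((fun x : V => x 0 i) - cst (y 0 i))).
  by rewrite partial_bumpf; apply/funext => z; rewrite mul0r subr0.
have d1 := is_derive_flat_comp 2 (is_derive_quad y r x i).
have d2 := is_deriveZ (- 2 * r^-1 ^+ 2) (is_deriveB (is_derive_coord i x (e_ i)) (is_derive_cst (y 0 i) x (e_ i))).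
have [_ E] := is_deriveM d1 d2; apply: (etrans E) => {E}.
rewrite mxE !eqxx subr0 /GRing.scale /= /bumpf.
rewrite !fctE /= /GRing.scale /=; ring.
Qed.

Definition Lap f x := \sum_i partial i (partial i f) x.

Lemma Lap_bumpf0 y r x : Lap (bumpf 0 y r) x =
  4 * r^-1 ^+ 4 * (\sum_i (x 0 i - y 0 i) ^+ 2) * (bumpf 4 y r x - 2 * bumpf 3 y r x)
  - n%:R * (2 * r^-1 ^+ 2 * bumpf 2 y r x).
Proof.
rewrite /Lap; under eq_bigr do rewrite partial2_bumpf0.
rewrite big_split/= sumrN sumr_const card_ord -[X in _ - X]mulr_natl.
by congr (_ - _); rewrite mulr_sumr mulr_suml.
Qed.

End bumpf_functions.

(** * Averages against the radial kernel *)

Section averages.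
Context {R : realType} {n : nat}.
Local Notation V := 'rV[R]_n.
Local Notation mu := (leb n).
Implicit Types u f g : V -> R.
Implicit Types x y z : V.
Local Notation e_ i := (delta_mx 0 i : V).

Definition mass : R := \int[mu]_x bumpf 2 (0 : V) 1 x.

Lemma mass_gt0 : 0 < mass.
Proof.
(* Small enough for the sup-norm ball of radius [d] to lie in the Euclidean ball of radius 1/2,
   where [bumpf_lower] applies. *)
pose d : R := (2 * n.+1%:R)^-1.
have d0 : 0 < d by rewrite invr_gt0 mulr_gt0.
have mB : measurable (ball (0 : V) d) by exact: measurable_rV_ball.
have muB : mu (ball (0 : V) d) = ((d *+ 2) ^+ n)%:E by exact: leb_ball.
have i0 : rintegrable mu (\1_(ball (0 : V) d) : V -> R).
  apply/rintegrableP; split; first exact: measurable_indic.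
  rewrite (eq_integral (fun x => (\1_(ball (0 : V) d) x)%:E)).
    by rewrite integral_indic ?setIT// [X in (X < _)%E]muB ltry.
  by move=> x _; rewrite ger0_norm.
have i1 := rintegrableZ (expR (-2)) i0.
apply: (@lt_le_trans _ _ (\int[mu]_x (expR (-2) * \1_(ball (0 : V) d) x))).
  rewrite RintegralZl// mulr_gt0 ?expR_gt0// /Rintegral integral_indic ?setIT//.
  by rewrite [X in fine X]muB/= exprn_gt0// mulrn_wgt0.
apply: le_RintegralT => //; first exact: rintegrable_bumpf.
move=> x; rewrite indicE; have [h|h] := boolP (x \in (ball (0 : V) d : set V)); last by rewrite mulr0 bumpf_ge0.
rewrite mulr1; apply: bumpf_lower => //.
rewrite subr0 (le_trans (enorm_le_norm _))//.
move: h; rewrite inE -ball_normE /= sub0r normrN /d => /ltW h.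
apply: (@le_trans _ _ (n%:R * (2 * n.+1%:R)^-1)); first by rewrite ler_wpM2l.
rewrite ler_pdivrMr ?mulr_gt0//.
by rewrite (_ : 1 / 2 * (2 * n.+1%:R) = n.+1%:R) ?ler_nat//; field.
Qed.

(** The index 2 is forced by the gradient of [bumpf 0], which is -2 r^-2 (x - y) times [bumpf 2].
    The derivative in r of a rescaled density is -1/r times the divergence of (x - y) times that
    density, and here this is a multiple of the Laplacian of [bumpf 0], as [is_derive_ker]
    computes. *)
Definition ker y (r : R) x : R := mass^-1 * r^-1 ^+ n * bumpf 2 y r x.

Definition M u y (r : R) : R := \int[mu]_x (u x * ker y r x).

Let c0 r : 0 < r -> 0 < mass^-1 * r^-1 ^+ n.
Proof. by move=> r0; rewrite mulr_gt0 ?invr_gt0 ?mass_gt0// exprn_gt0// invr_gt0. Qed.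

Lemma ker_ge0 y r x : 0 < r -> 0 <= ker y r x.
Proof. by move=> r0; rewrite mulr_ge0 ?bumpf_ge0// ltW// c0. Qed.

Lemma ker_eq0 y r x : 0 < r -> r <= enorm (x - y) -> ker y r x = 0.
Proof. by move=> r0 h; rewrite /ker bumpf_eq0// mulr0. Qed.

Lemma ker_le y r x : 0 < r -> ker y r x <= mass^-1 * r^-1 ^+ n * 2.
Proof. by move=> r0; rewrite ler_wpM2l ?(ltW (c0 _))//; exact: (bumpf_le 2). Qed.

Lemma ker_lower y r x : 0 < r -> enorm (x - y) <= r / 2 ->
  mass^-1 * r^-1 ^+ n * expR (-2) <= ker y r x.
Proof. by move=> r0 h; rewrite ler_wpM2l ?(ltW (c0 _))// bumpf_lower. Qed.

Lemma smooth_ker y r : smooth (ker y r).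
Proof. by apply: smoothM; [exact: smooth_cst|exact: smooth_bumpf]. Qed.

Lemma measurable_ker y r : measurable_fun setT (ker y r).
Proof. exact: (continuous_measurable_rV (smooth_ker y r [::]).1). Qed.

Lemma norm_ker_le y r x : 0 < r -> `|ker y r x| <= mass^-1 * r^-1 ^+ n * 2.
Proof. by move=> r0; rewrite ger0_norm ?ker_ge0// ker_le. Qed.

Lemma vanish_ker y r : 0 < r -> vanish (enorm y + r) (ker y r).
Proof. by move=> r0 x hx; rewrite /ker (vanish_bumpf _ r0)// mulr0. Qed.

Lemma ker_shift y z r x : ker (y + z) r x = ker z r (x - y).
Proof.
rewrite /ker /bumpf /quad; congr (_ * flat _ (_ - _ * _)).
by apply: eq_bigr => i _; rewrite !mxE opprD addrA.
Qed.

Lemma mollifier_ker r : 0 < r -> mollifier r (ker 0 r).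
Proof.
move=> r0; have vk : vanish r (ker 0 r).
  by have := vanish_ker (y := 0) r0; rewrite enorm0 add0r.
split => //.
- exact: (smooth_lip (smooth_ker 0 r) vk).
- by move=> x; exact: ker_ge0.
- have rb : rintegrable mu (bumpf 2 (0 : V) 1) by exact: rintegrable_bumpf.
  have r'0 : 0 < r^-1 by rewrite invr_gt0.
  have H := Rintegral_affine (0 : V) r'0 rb.
  have E x : bumpf 2 (0 : V) 1 (r^-1 *: x + 0) = bumpf 2 0 r x.
    rewrite /bumpf /quad; congr (flat _ (_ - _)).
    rewrite invr1 expr1n mul1r mulr_sumr; apply: eq_bigr => i _.
    by rewrite !mxE addr0 !subr0 exprMn.
  rewrite RintegralZl//; last exact: rintegrable_bumpf.
  under eq_Rintegral do rewrite -E.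
  have rn : r^-1 ^+ n != 0 by rewrite gt_eqF// exprn_gt0.
  by rewrite H -/mass mulrA -(mulrA mass^-1) mulfV// mulr1 mulVf// gt_eqF// mass_gt0.
Qed.

Lemma mol_ker u r : mol (ker 0 r) u = (fun y => M u y r).
Proof.
by apply/funext => y; apply: eq_Rintegral => x _; rewrite -ker_shift addr0.
Qed.

Lemma rintegrable_uker u y r : 0 < r -> rintegrable mu u ->
  rintegrable mu (fun x => u x * ker y r x).
Proof.
move=> r0 ru; apply: (rintegrable_mull ru (measurable_ker y r)).
by move=> x; exact: norm_ker_le.
Qed.

Lemma M_le u y r : 0 < r -> rintegrable mu u ->
  `|M u y r| <= mass^-1 * r^-1 ^+ n * 2 * \int[mu]_x `|u x|.
Proof.
move=> r0 ru; have ri := rintegrable_uker y r0 ru.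
apply: (le_trans (le_normr_Rintegral measurableT ri)).
rewrite -RintegralZl//; last exact: rintegrable_norm.
apply: le_RintegralT; [exact: rintegrable_norm|by apply: rintegrableZ; exact: rintegrable_norm|].
by move=> x; rewrite normrM mulrC ler_wpM2r// norm_ker_le.
Qed.

Lemma MD u v y r : 0 < r -> rintegrable mu u -> rintegrable mu v ->
  M (fun x => u x + v x) y r = M u y r + M v y r.
Proof.
move=> r0 ru rv; rewrite /M -RintegralD//; [|exact: rintegrable_uker|exact: rintegrable_uker].
by apply: eq_Rintegral => x _; rewrite mulrDl.
Qed.

Lemma MB u v y r : 0 < r -> rintegrable mu u -> rintegrable mu v ->
  M (fun x => u x - v x) y r = M u y r - M v y r.
Proof.
move=> r0 ru rv; rewrite /M -RintegralB//; [|exact: rintegrable_uker|exact: rintegrable_uker].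
by apply: eq_Rintegral => x _; rewrite mulrBl.
Qed.

Lemma M_sum (I : Type) (s : seq I) (F : I -> V -> R) y r : 0 < r ->
  (forall i, rintegrable mu (F i)) ->
  M (fun x => \sum_(i <- s) F i x) y r = \sum_(i <- s) M (F i) y r.
Proof.
move=> r0 rF; rewrite /M -Rintegral_sum; last by move=> i; exact: rintegrable_uker.
by apply: eq_Rintegral => x _; rewrite mulr_suml.
Qed.

Lemma is_derive_ker y x (r : R) : 0 < r ->
  is_derive r 1 (fun s : R => ker y s x)
    (mass^-1 / 2 * r^-1 ^+ n * r * Lap (bumpf 0 y r) x).
Proof.
move=> r0; have rn0 : r != 0 by rewrite gt_eqF.
set S := \sum_i (x 0 i - y 0 i) ^+ 2.
have d0 : is_derive r 1 (fun t : R => t^-1) (- r ^- 2).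
  apply: DeriveDef; first exact: (derivableV rn0 (@derivable_id _ _ r 1)).
  by rewrite (deriveV rn0 (@derivable_id _ _ r 1)) derive_id [LHS]mulr1.
have d1 := is_deriveX n d0.
have d2 := is_deriveZ mass^-1 d1.
have d3 := is_deriveM (is_deriveX 2 d0) (is_derive_cst S r 1).
have d4 := is_deriveB (is_derive_cst (1 : R) r 1) d3.
have d5 := is_derive1_comp (is_derive_flat 2 _) d4.
have d6 := is_deriveM d2 d5.
have powE m (t : R) : ((fun t : R => t^-1) ^+ m) t = t^-1 ^+ m.
  by elim: m => [|j IH]; rewrite ?expr0// !exprS -IH.
rewrite (_ : (fun s : R => ker y s x) = (mass^-1 *: (fun t : R => t^-1) ^+ n) *
   (flat 2 \o (cst 1 - (fun t : R => t^-1) ^+ 2 * cst S))); last first.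
  by apply/funext => t; rewrite /ker /bumpf /quad !fctE /= -!powE.
apply: (is_derive_eq d6).
rewrite Lap_bumpf0 -/S !fctE /= ?powE /GRing.scale /= /bumpf /quad -/S.
set f2 := flat 2 _; set f3 := flat 3 _; set f4 := flat 4 _.
have hn : n%:R * r^-1 ^+ n.-1 = n%:R * r^-1 ^+ n * r.
  by case: (n) => [|m]; rewrite ?mul0r//= exprSr mulrA mulfVK.
rewrite hn; move: (r^-1 ^+ n) (mass^-1) (n%:R : R) => a m nn.
by move: (f2 : R) (f3 : R) (f4 : R) (S : R) => f2' f3' f4' S'; field.
Qed.

End averages.
Arguments mass {R} n.

(** * Dependence of the averages on radius and centre *)

Section average_estimates.
Context {R : realType} {n : nat}.
Local Notation V := 'rV[R]_n.
Local Notation mu := (leb n).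
Implicit Types u f g : V -> R.
Implicit Types x y z : V.

Lemma Lap_bumpf0_le y (s : R) x : 0 < s ->
  `|Lap (bumpf 0 y s) x| <= (144 + 4 * n%:R) * s^-1 ^+ 2.
Proof.
move=> s0; rewrite Lap_bumpf0.
have t0 : 0 < s^-1 by rewrite invr_gt0.
have n0 : 0 <= n%:R :> R by [].
have h2 := norm_bumpf_le 2 y s x; have h3 := norm_bumpf_le 3 y s x.
have h4 := norm_bumpf_le 4 y s x.
have [h|h] := leP s (enorm (x - y)).
  rewrite !(bumpf_eq0 _ s0 h) !(mulr0, subr0) normr0.
  by apply: mulr_ge0; [apply: addr_ge0 => //; apply: mulr_ge0|apply: sqr_ge0].
have S1 : s^-1 ^+ 2 * (\sum_i (x 0 i - y 0 i) ^+ 2) <= 1.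
  rewrite sum_sqr_enorm exprVn mulrC ler_pdivrMr ?exprn_gt0// mul1r.
  by rewrite ler_pXn2r ?nnegrE ?enorm_ge0// ltW.
have S0 : 0 <= s^-1 ^+ 2 * (\sum_i (x 0 i - y 0 i) ^+ 2).
  by rewrite mulr_ge0 ?sqr_ge0// sumr_ge0// => i _; rewrite sqr_ge0.
have -> : 4 * s^-1 ^+ 4 * (\sum_i (x 0 i - y 0 i) ^+ 2) *
    (bumpf 4 y s x - 2 * bumpf 3 y s x) - n%:R * (2 * s^-1 ^+ 2 * bumpf 2 y s x) =
   (4 * (s^-1 ^+ 2 * (\sum_i (x 0 i - y 0 i) ^+ 2)) *
     (bumpf 4 y s x - 2 * bumpf 3 y s x) - 2 * n%:R * bumpf 2 y s x) * s^-1 ^+ 2 by ring.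
rewrite normrM [X in _ * X]ger0_norm ?sqr_ge0// ler_wpM2r ?sqr_ge0//.
rewrite (le_trans (ler_normB _ _))// lerD//.
  rewrite normrM [X in X * _]ger0_norm; last by rewrite mulr_ge0.
  (* 36 = 4! + 2 * 3!, from the bounds on [bumpf 4] and [bumpf 3]. *)
  apply: (@le_trans _ _ (4 * 1 * 36)); last by lra.
  apply: ler_pM => //; first by rewrite mulr_ge0.
    by rewrite ler_wpM2l.
  rewrite (le_trans (ler_normB _ _))// normrM [X in X * _]ger0_norm//.
  move: h3 h4; rewrite /factorial /=; move: `|bumpf 4 _ _ _| `|bumpf 3 _ _ _| => a b; lra.
rewrite normrM ger0_norm ?mulr_ge0//.
move: h2; rewrite /factorial /=; move: `|bumpf 2 _ _ _| => a h2.
rewrite (_ : 4 * n%:R = 2 * n%:R * 2); last by ring.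
by rewrite ler_wpM2l ?mulr_ge0//; lra.
Qed.

Lemma is_derive_M u y (r : R) : 0 < r -> rintegrable mu u ->
  is_derive r 1 (M u y)
    ((mass n)^-1 / 2 * r^-1 ^+ n * r * \int[mu]_x (u x * Lap (bumpf 0 y r) x)).
Proof.
move=> r0 ru.
pose F (t : R) x := u x * ker y t x.
(* A neighbourhood of [r] bounded away from 0, on which t^-1 <= 2 / r provides a single dominating
   function. *)
have I0 : (`]r / 2, r * 2[%classic : set R) r by rewrite /= in_itv/=; apply/andP; split; lra.
have Ipos (t : R) : `]r / 2, r * 2[%classic t -> 0 < t.
  by rewrite /= in_itv/= => /andP[h _]; lra.
have iF (t : R) : `]r / 2, r * 2[%classic t -> mu.-integrable setT (EFin \o F t).
  by move=> /Ipos t0; exact: rintegrable_uker.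
pose c (t : R) : R := (mass n)^-1 / 2 * t^-1 ^+ n * t.
have dF (t : R) x : 0 < t -> is_derive t 1 (F ^~ x) (c t * (u x * Lap (bumpf 0 y t) x)).
  move=> t0; have := is_deriveZ (u x) (is_derive_ker y x t0).
  by move/is_derive_eq; apply; rewrite /GRing.scale /= /c; ring.
have dF' (t : R) x : `]r / 2, r * 2[%classic t -> setT x -> derivable (F ^~ x) t 1.
  by move=> /Ipos t0 _; have [] := dF t x t0.
have pF (t : R) x : 0 < t -> partial1of2 F t x = c t * (u x * Lap (bumpf 0 y t) x).
  by move=> t0; rewrite partial1of2E; have [_ ] := dF t x t0.
pose C := (mass n)^-1 / 2 * (2 / r) ^+ n * (2 / r) * (144 + 4 * n%:R).
have m0 : 0 < (mass n)^-1 / 2 :> R by rewrite divr_gt0 ?invr_gt0 ?mass_gt0.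
have n0 : 0 <= 144 + 4 * n%:R :> R by rewrite addr_ge0// mulr_ge0.
have C0 : 0 <= C.
  have r20 : 0 <= 2 / r by rewrite divr_ge0// ltW.
  apply: mulr_ge0 => //; apply: mulr_ge0 => //; apply: mulr_ge0; first exact: ltW.
  exact: exprn_ge0.
pose G x := C * `|u x|.
have G0 x : 0 <= G x by rewrite mulr_ge0.
have iG : mu.-integrable setT (EFin \o G) by apply: rintegrableZ; exact: rintegrable_norm.
have GF (t : R) x : `]r / 2, r * 2[%classic t -> setT x -> `|partial1of2 F t x| <= G x.
  move=> It _; have t0 := Ipos _ It; rewrite (pF _ _ t0) normrM [`|u x * _|]normrM mulrCA mulrC /G.
  rewrite ler_wpM2r//.
  have tr : t^-1 <= 2 / r.
    rewrite -[leRHS]invrK lef_pV2 ?posrE ?invr_gt0 ?divr_gt0// invf_div.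
    by move: It; rewrite /= in_itv/= => /andP[/ltW].
  have ct : `|c t| = c t.
    by rewrite ger0_norm// /c mulr_ge0 ?(ltW t0)// mulr_ge0 ?(ltW m0)// exprn_ge0// invr_ge0 ltW.
  rewrite ct; apply: (@le_trans _ _ (c t * ((144 + 4 * n%:R) * t^-1 ^+ 2))).
    by rewrite ler_wpM2l ?Lap_bumpf0_le// -ct.
  have -> : c t * ((144 + 4 * n%:R) * t^-1 ^+ 2) =
      (mass n)^-1 / 2 * (t^-1 ^+ n * t^-1) * (144 + 4 * n%:R).
    rewrite /c; move: (t^-1 ^+ n) ((mass n)^-1) => a b; field; by rewrite gt_eqF.
  rewrite /C -[X in _ <= X * _]mulrA ler_wpM2r// ler_wpM2l ?(ltW m0)//.
  by rewrite ler_pM ?exprn_ge0 ?invr_ge0 ?(ltW t0)// lerXn2r ?nnegrE ?invr_ge0 ?(ltW t0) ?divr_ge0 ?(ltW r0).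
have iL : rintegrable mu (fun x => u x * Lap (bumpf 0 y r) x).
  apply: (rintegrable_mull ru) => [|x]; last exact: Lap_bumpf0_le.
  apply: continuous_measurable_rV.
  have sL : smooth (Lap (bumpf 0 y r)).
    apply: smooth_sum => i; do 2 apply: smooth_partial; exact: smooth_bumpf.
  exact: (sL [::]).1.
have E : \int[mu]_x partial1of2 F r x = c r * \int[mu]_x (u x * Lap (bumpf 0 y r) x).
  by rewrite -RintegralZl//; apply: eq_Rintegral => x _; rewrite pF.
apply: DeriveDef.
  exact: (derivable_under_integral measurableT I0 iF dF' G0 iG GF).
rewrite -derive1E -/(c r) -E.
exact: (differentiation_under_integral measurableT I0 iF dF' G0 iG GF).
Qed.

(** By the formula of [is_derive_M] the hypothesis amounts to a bound on the derivative of [M u y]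
    over the interval. *)
Lemma M_lip u y (r A : R) : rintegrable mu u -> 
  (forall s, 0 < s < r ->
    `|\int[mu]_x (u x * Lap (bumpf 0 y s) x)| * s <= A * s ^+ n) ->
  forall s t, 0 < s < r -> 0 < t < r ->
    `|M u y s - M u y t| <= ((mass n)^-1 / 2 * A) * `|s - t|.
Proof.
move=> ru H s t hs ht.
apply: (@lip_of_derive R (M u y) (fun r => (mass n)^-1 / 2 * r^-1 ^+ n * r *
   \int[mu]_x (u x * Lap (bumpf 0 y r) x)) `]0, r[); rewrite ?in_itv//=.
  by move=> z; rewrite in_itv/= => /andP[z0 _]; exact: is_derive_M.
move=> z; rewrite in_itv/= => hz; have /andP[z0 _] := hz.
have m0 : 0 < (mass n)^-1 / 2 :> R by rewrite divr_gt0 ?invr_gt0 ?mass_gt0.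
rewrite -2!mulrA normrM (gtr0_norm m0) ler_wpM2l ?(ltW m0)//.
have zn : 0 <= z^-1 ^+ n by rewrite exprn_ge0// invr_ge0 ltW.
have := H z hz; move: (\int[mu]_x _) => L; rewrite -ler_pdivrMr ?exprn_gt0// => h.
by rewrite normrM (ger0_norm zn) normrM (gtr0_norm z0) exprVn mulrC [z * _]mulrC.
Qed.

(** The constant is 4! + 2 * 3!, from the derivative of [flat 2] and the bounds of [flat_le]. *)
Lemma flat2_lip (a b : R) : `|flat 2 a - flat 2 b| <= 36 * `|a - b|.
Proof.
apply: (@lip_of_derive R (flat 2) _ `]-oo, +oo[) => // [t _|t _].
  exact: is_derive_flat.
rewrite (le_trans (ler_normB _ _))// normrM !ger0_norm ?flat_ge0//.
have := flat_le 4 t; have := flat_le 3 t; rewrite /factorial/=; lra.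
Qed.

(** 144 is the 36 of [flat2_lip] times 4: where one of the kernels is nonzero, |x - y| and |x - z|
    are both below 2 s, so their sum is below 4 s. *)
Lemma ker_lip y z (s : R) x : 0 < s -> enorm (y - z) <= s ->
  `|ker y s x - ker z s x| <= (mass n)^-1 * s^-1 ^+ n * (144 * (enorm (y - z) / s)).
Proof.
move=> s0 yz.
have c0 : 0 <= (mass n)^-1 * s^-1 ^+ n.
  by rewrite mulr_ge0 ?exprn_ge0 ?invr_ge0 ?(ltW s0) ?(ltW (mass_gt0)).
have r0 : 0 <= enorm (y - z) / s by rewrite divr_ge0 ?enorm_ge0// ltW.
rewrite /ker -mulrBr normrM (ger0_norm c0) ler_wpM2l//.
have T1 : enorm (x - y) - enorm (x - z) <= enorm (y - z).
  by have := enorm_triangle z x y; rewrite [enorm (z - y)]enormBC; lra.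
have T2 : enorm (x - z) - enorm (x - y) <= enorm (y - z).
  by have := enorm_triangle y x z; lra.
have p0 := enorm_ge0 (x - y); have q0 := enorm_ge0 (x - z).
(* If one distance is at least 2 s, the other is at least s and both kernels vanish. *)
have [hx|hx] := leP (2 * s) (enorm (x - y)).
  rewrite (bumpf_eq0 _ s0 (y := y)); last by lra.
  rewrite (bumpf_eq0 _ s0 (y := z)); last by lra.
  by rewrite subrr normr0; apply: mulr_ge0.
have [hz|hz] := leP (2 * s) (enorm (x - z)).
  rewrite (bumpf_eq0 _ s0 (y := y)); last by lra.
  rewrite (bumpf_eq0 _ s0 (y := z)); last by lra.
  by rewrite subrr normr0; apply: mulr_ge0.
apply: (le_trans (flat2_lip _ _)).
apply: (@le_trans _ _ (36 * (4 * (enorm (y - z) / s)))); last by lra.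
rewrite ler_wpM2l//.
rewrite /quad !sum_sqr_enorm.
have -> : 1 - s^-1 ^+ 2 * enorm (x - y) ^+ 2 - (1 - s^-1 ^+ 2 * enorm (x - z) ^+ 2) =
  (enorm (x - z) - enorm (x - y)) * (enorm (x - z) + enorm (x - y)) / s ^+ 2.
  by rewrite exprVn; ring.
rewrite normrM normrM [X in _ * X]ger0_norm; last by rewrite invr_ge0 sqr_ge0.
rewrite ler_pdivrMr ?exprn_gt0//.
have -> : 4 * (enorm (y - z) / s) * s ^+ 2 = enorm (y - z) * (4 * s).
  by field; rewrite gt_eqF.
apply: ler_pM => //.
  by rewrite ler_norml; apply/andP; split; lra.
by rewrite ger0_norm; lra.
Qed.

(** 144 comes from [ker_lip], 10^n from comparing the normalisations at radii s and 10 s, and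
    exp(-2) from the lower bound for the larger kernel on half its radius. *)
Definition Cker : R := 144 * 10 ^+ n / expR (-2).

Lemma Cker_ge0 : 0 <= Cker.
Proof. by rewrite !mulr_ge0 ?exprn_ge0// invr_ge0 expR_ge0. Qed.

(** The kernels at [y] and [z] live within 3 s + s + s = 5 s of [w], half the radius of the kernel
    at [w]. Dominating their difference by that kernel lets information at [w] alone control the
    averages at [y] and [z]. *)
Lemma ker_diff_le y z w (s : R) x : 0 < s -> enorm (y - z) <= s ->
  enorm (y - w) <= 3 * s ->
  `|ker y s x - ker z s x| <= Cker * (enorm (y - z) / s) * ker w (10 * s) x.
Proof.
move=> s0 yz yw.
have c0 : 0 <= (mass n)^-1 * s^-1 ^+ n.
  by rewrite mulr_ge0 ?exprn_ge0 ?invr_ge0 ?(ltW s0) ?(ltW (mass_gt0)).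
have r0 : 0 <= enorm (y - z) / s by rewrite divr_ge0 ?enorm_ge0// ltW.
have s10 : 0 < 10 * s by lra.
have [hx|hx] := leP (5 * s) (enorm (x - w)).
  have h1 : enorm (x - w) <= enorm (x - y) + enorm (y - w).
    exact: enorm_triangle.
  have h2 : enorm (x - y) <= enorm (x - z) + enorm (y - z).
    by rewrite [enorm (y - z)]enormBC; exact: enorm_triangle.
  rewrite (ker_eq0 s0 (y := y)); last by lra.
  rewrite (ker_eq0 s0 (y := z)); last by lra.
  rewrite subrr normr0; apply: mulr_ge0; last exact: ker_ge0.
  by apply: mulr_ge0; rewrite ?Cker_ge0.
apply: (le_trans (ker_lip _ s0 yz)).
have hk : (mass n)^-1 * (10 * s)^-1 ^+ n * expR (-2) <= ker w (10 * s) x.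
  by apply: ker_lower => //; lra.
apply: le_trans (ler_wpM2l _ hk); last by rewrite mulr_ge0 ?Cker_ge0.
rewrite /Cker le_eqVlt; apply/orP; left; apply/eqP.
rewrite invfM exprMn [10^-1 ^+ _]exprVn.
have e0 : expR (-2) != 0 :> R by rewrite gt_eqF// expR_gt0.
have t0 : 10 ^+ n != 0 :> R by rewrite gt_eqF// exprn_gt0.
move: (s^-1 ^+ n) ((mass n)^-1) (enorm (y - z) / s) => a b c.
by field; rewrite e0 t0.
Qed.

End average_estimates.

(** * Sobolev functions on the unit ball *)

Section sobolev_pairs.
Context {R : realType} {n : nat}.
Local Notation V := 'rV[R]_n.
Local Notation mu := (leb n).
Implicit Types f g h phi psi : V -> R.
Implicit Types x y z : V.
Implicit Types F G : 'I_n -> V -> R.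
Local Notation e_ i := (delta_mx 0 i : V).

Definition weak_grad f G := forall phi s, smooth phi -> s < 1 -> vanish s phi ->
  forall i, \int[mu]_x (f x * partial i phi x) = - \int[mu]_x (G i x * phi x).

(* H^1 functions on the unit ball, extended by zero to the whole space together
   with their weak gradient. *)
Record sob f G : Prop := Sob {
  sob_sqi : sqi mu f ;
  sob_vanish : vanish 1 f ;
  sob_gsqi : forall i, sqi mu (G i) ;
  sob_gvanish : forall i, vanish 1 (G i) ;
  sob_weak : weak_grad f G }.

Lemma sqi_vanish_continuous f s : continuous f -> vanish s f -> sqi mu f.
Proof.
move=> cf vf; have [C C0 hC] := vanish_bounded cf vf.
exact: (sqi_bounded (continuous_measurable_rV cf) vf hC).
Qed.

Lemma smooth_continuous f : smooth f -> continuous f.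
Proof. by move=> sf; case: (sf [::]). Qed.

Lemma smooth_derivable f x i : smooth f -> derivable f x (e_ i).
Proof. by move=> sf; case: (sf [::]). Qed.

Lemma sqi_test phi s : smooth phi -> vanish s phi -> sqi mu phi.
Proof. by move=> /smooth_continuous; exact: sqi_vanish_continuous. Qed.

Lemma sqi_partial phi s i : smooth phi -> vanish s phi -> sqi mu (partial i phi).
Proof.
move=> sp vp; apply: (@sqi_vanish_continuous _ (s + 1)).
  exact: (sp [:: i]).1.
by apply: vanish_partial vp; rewrite ltrDl.
Qed.

Lemma vanish_le f r s : r <= s -> vanish r f -> vanish s f.
Proof. by move=> rs vf x hx; apply: vf; exact: le_trans hx. Qed.

(** Integration by parts: the integral of each partial derivative of the product of two test
    functions vanishes. *)
Lemma sob_test phi s : smooth phi -> s < 1 -> vanish s phi ->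
  sob phi (fun i => partial i phi).
Proof.
move=> sp s1 vp; split.
- exact: sqi_test vp.
- exact: vanish_le (ltW s1) vp.
- by move=> i; exact: sqi_partial vp.
- by move=> i; exact: vanish_partial vp.
- move=> psi t spsi t1 vpsi i.
  have H := @Rintegral_partial R n (fun x => phi x * psi x) s i.
  have sm : smooth (fun x => phi x * psi x) by exact: smoothM.
  have E : partial i (fun x => phi x * psi x) =
      (fun x => phi x * partial i psi x + partial i phi x * psi x).
    apply/funext => x; rewrite /partial.
    rewrite (deriveM (smooth_derivable sp) (smooth_derivable spsi)).
    by rewrite /GRing.scale /= [psi x * _]mulrC.
  move: H; rewrite E RintegralD//; last 2 first.
    by apply: sqi_mul; [exact: sqi_test vp|exact: sqi_partial vpsi].
    by apply: sqi_mul; [exact: sqi_partial vp|exact: sqi_test vpsi].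
  move=> H; apply/eqP; rewrite -addr_eq0; apply/eqP; apply: H.
  + exact: smooth_continuous.
  + by move=> x; exact: smooth_derivable.
  + by rewrite -E; exact: (sm [:: i]).1.
  + by move=> x hx; rewrite vp// mul0r.
Qed.

Lemma sob_lin f g F G a b : sob f F -> sob g G ->
  sob (fun x => a * f x + b * g x) (fun i x => a * F i x + b * G i x).
Proof.
move=> [sf vf sF vF wf] [sg vg sG vG wg]; split.
- by apply: sqiD; exact: sqiZ.
- by move=> x hx; rewrite vf// vg// !mulr0 addr0.
- by move=> i; apply: sqiD; exact: sqiZ.
- by move=> i x hx; rewrite vF// vG// !mulr0 addr0.
- move=> phi s sp s1 vp i.
  have sd := sqi_partial i sp vp; have sph := sqi_test sp vp.
  have i1 := sqi_mul sf sd; have i2 := sqi_mul sg sd.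
  have i3 := sqi_mul (sF i) sph; have i4 := sqi_mul (sG i) sph.
  have E (u v w : V -> R) : rintegrable mu (fun x => u x * w x) ->
      rintegrable mu (fun x => v x * w x) ->
      \int[mu]_x ((a * u x + b * v x) * w x) =
      a * \int[mu]_x (u x * w x) + b * \int[mu]_x (v x * w x).
    move=> h1 h2; rewrite -!RintegralZl// -RintegralD//; [|exact: rintegrableZ|exact: rintegrableZ].
    by apply: eq_Rintegral => x _; rewrite mulrDl !mulrA.
  by rewrite !E// (wf _ _ sp s1 vp) (wg _ _ sp s1 vp); ring.
Qed.

Definition hrad (m : nat) : R := m.+1%:R^-1.

Lemma hrad_gt0 m : 0 < hrad m. Proof. by rewrite invr_gt0. Qed.

Lemma hrad_le1 m : hrad m <= 1. Proof. by rewrite invf_le1// ler1n. Qed.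

Lemma hrad_le i j : (i <= j)%N -> hrad j <= hrad i.
Proof. by move=> ij; rewrite lef_pV2 ?posrE// ler_nat. Qed.

Lemma cvg_hrad : hrad m @[m --> \oo] --> 0.
Proof. exact: cvg_harmonic. Qed.

Lemma cvg_M h : sqi mu h -> vanish 1 h ->
  sqn mu (fun y => M h y (hrad j) - h y) @[j --> \oo] --> 0.
Proof.
move=> sh vh.
have := @mol_cvg R n (fun j => ker 0 (hrad j)) hrad (fun j => mollifier_ker (hrad_gt0 j))
   hrad_le1 cvg_hrad 1 h sh vh.
have E j : (fun y => M h y (hrad j)) = mol (ker 0 (hrad j)) h.
  by apply/esym; exact: mol_ker.
apply: cvg_trans; apply: near_eq_cvg; apply: nearW => j.
exact: (congr1 (fun g : V -> R => sqn mu (fun y => g y - h y)) (esym (E j))).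
Qed.

Lemma sqi_M h r : 0 < r -> sqi mu h -> vanish 1 h -> sqi mu (fun y => M h y r).
Proof.
by move=> r0 sh vh; rewrite -mol_ker; exact: (sqi_mol (mollifier_ker r0) sh vh).
Qed.

Lemma smooth_M h r : 0 < r -> sqi mu h -> vanish 1 h -> smooth (fun y => M h y r).
Proof.
move=> r0 sh vh; rewrite -mol_ker.
exact: (smooth_mol (smooth_ker 0 r) (moll_vanish (mollifier_ker r0)) (sqi_rintegrable sh vh)).
Qed.

Lemma vanish_M h s r : 0 < r -> vanish s h -> vanish (s + r) (fun y => M h y r).
Proof.
by move=> r0 vh; rewrite -mol_ker; exact: (vanish_mol (moll_vanish (mollifier_ker r0)) vh).
Qed.

Lemma partial_ker y r i x : partial i (ker y r) x = partial i (ker 0 r) (x - y).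
Proof.
have -> : ker y r = (fun x => ker 0 r (x - y)).
  by apply/funext => z; rewrite -ker_shift addr0.
rewrite /partial derive1P [RHS]derive1P.
by rewrite (_ : (fun t : R => _) = (fun t : R => ker 0 r (t *: e_ i + (x - y))))//;
   apply/funext => t; rewrite addrA.
Qed.

(** As long as its ball stays inside the unit ball, the kernel centred at [y] is itself a test
    function for the weak derivative. *)
Lemma partial_M f G i y r : 0 < r -> sob f G -> enorm y + r < 1 ->
  partial i (fun z => M f z r) y = M (G i) y r.
Proof.
move=> r0 [sf vf sG vG wf] yr; rewrite -mol_ker /partial.
have [_ ->] := is_derive_mol i y (smooth_ker 0 r) (moll_vanish (mollifier_ker r0)) (sqi_rintegrable sf vf).
have := wf _ _ (smooth_ker y r) yr (vanish_ker r0) i => /(congr1 -%R).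
rewrite opprK -/(M (G i) y r) => <-; rewrite /mol -mulN1r -RintegralZl//; last first.
  by apply: sqi_mul => //; exact: (sqi_partial i (smooth_ker y r) (vanish_ker r0)).
by apply: eq_Rintegral => x _; rewrite (partial_ker y r i x); ring.
Qed.

Lemma ae_eq0_of_sqn h (E : set V) : measurable E -> sqi mu h ->
  \int[mu]_x ((\1_E x * h x) ^+ 2) <= 0 -> {ae mu, forall x, E x -> h x = 0}.
Proof.
move=> mE sh h0; have [mh ih] := sh.
have mEh : measurable_fun setT (fun x => (\1_E x * h x)).
  by apply: measurable_funM => //; exact: measurable_indic.
have sEh : sqi mu (fun x => \1_E x * h x).
  apply: (le_sqi mEh sh) => x; rewrite indicE.
  by case: (x \in E); rewrite ?mul1r// mul0r normr0.
have [m2 i2] := sEh.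
have I0 : (\int[mu]_x `|((\1_E x * h x) ^+ 2)%:E| = 0)%E.
  rewrite (eq_integral (fun x => ((\1_E x * h x) ^+ 2)%:E)); last first.
    by move=> x _; rewrite /= ger0_norm// sqr_ge0.
  apply/eqP; rewrite eq_le integral_ge0 ?andbT; last first.
    by move=> x _; rewrite lee_fin sqr_ge0.
  rewrite -[leLHS]fineK ?lee_fin//.
  exact: integrable_fin_num.
have mE2 : measurable_fun setT (fun x => ((\1_E x * h x) ^+ 2)%:E).
  by apply/measurable_EFinP; exact: measurable_funX.
have /(ae_eq_integral_abs mu measurableT mE2) := I0.
move=> H; apply: filterS H => x /(_ I) /= + Ex.
move=> [/eqP]; rewrite sqrf_eq0 indicE mem_set// mul1r => /eqP //.
Qed.

(** Mollifications converge to [h] in L^2 but vanish on slightly smaller annuli, so the integral of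
    [h ^+ 2] there is bounded by a null sequence. A negative [a] turns the annulus into a ball, so
    that one statement serves both uniqueness and locality of weak gradients. *)
Lemma ae_eq0_annulus h (a b : R) : sqi mu h -> vanish 1 h ->
  (forall y r, 0 < r -> a + r < enorm y -> enorm y < b - r -> M h y r = 0) ->
  {ae mu, forall x, a < enorm x -> enorm x < b -> h x = 0}.
Proof.
move=> sh vh H.
pose E m := [set x : V | a + hrad m < enorm x < b - hrad m].
have mE m : measurable (E m).
  have -> : E m = @enorm R n @^-1` `]a + hrad m, b - hrad m[%classic.
    by apply/seteqP; split => x; rewrite /E /= in_itv.
  rewrite -[X in measurable X]setTI; apply: measurable_enorm => //.
have HE m : {ae mu, forall x, E m x -> h x = 0}.
  apply: ae_eq0_of_sqn => //.
  apply: (cvgr_to_ge (cvg_M sh vh)); exists m => // j /= mj.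
  have rj0 := hrad_gt0 j.
  have sD : sqi mu (fun y => M h y (hrad j) - h y) by apply: sqiB => //; exact: sqi_M.
  apply: le_sqn => //.
    apply: (le_sqi _ sh).
      by apply: measurable_funM; [exact: measurable_indic|case: sh].
    by move=> x; rewrite indicE; case: (x \in E m); rewrite ?mul1r// mul0r normr0.
  move=> x; rewrite indicE; have [xE|xE] := boolP (x \in E m); last first.
    by rewrite mul0r normr0.
  have rjm := hrad_le mj.
  move: xE; rewrite inE /E /= => /andP[h1 h2].
  by rewrite H// ?sub0r ?normrN ?mul1r//; lra.
have := ae_foralln HE.
apply: filterS => x hx ax xb.
have [m hm] : exists m, hrad m < Num.min (enorm x - a) (b - enorm x).
  have e0 : 0 < Num.min (enorm x - a) (b - enorm x) by rewrite lt_min !subr_gt0 ax.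
  have [m _ /(_ m (leqnn m))] := near_infty_natSinv_lt (PosNum e0).
  by exists m.
apply: (hx m); rewrite /E /=; move: hm; rewrite lt_min => /andP[h1 h2].
by apply/andP; split; lra.
Qed.

Lemma eq_Rintegral_ae f g : measurable_fun setT f -> measurable_fun setT g ->
  {ae mu, forall x, f x = g x} -> \int[mu]_x f x = \int[mu]_x g x.
Proof.
move=> mf mg fg; rewrite /Rintegral; congr fine.
apply: ae_eq_integral => //; [exact/measurable_EFinP|exact/measurable_EFinP|].
by apply: filterS fg => x + _; move=> ->.
Qed.

Lemma partial_ker_eq0 y r x i : 0 < r -> r <= enorm (x - y) ->
  partial i (ker y r) x = 0.
Proof.
move=> r0 h; have [d1 _] := is_derive_flat_comp 2 (is_derive_quad y r x i).
rewrite /partial /ker (deriveM (derivable_cst (_ : R) _ _) d1) derive_cst scaler0 addr0.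
by rewrite -/(partial i (bumpf 2 y r) x) partial_bumpf !bumpf_eq0// mulr0 subrr mul0r scaler0.
Qed.

(** Tests with kernels supported in the annulus: up to sign, the average of [h] is an integral of
    [f] against a function that vanishes wherever [f] may not. *)
Lemma ae_eq0_weak h (a b : R) i f : b <= 1 ->
  sqi mu h -> vanish 1 h -> sqi mu f ->
  (forall phi s, smooth phi -> s < 1 -> vanish s phi ->
    \int[mu]_x (f x * partial i phi x) = - \int[mu]_x (h x * phi x)) ->
  {ae mu, forall x, a < enorm x -> enorm x < b -> f x = 0} ->
  {ae mu, forall x, a < enorm x -> enorm x < b -> h x = 0}.
Proof.
move=> b1 sh vh sf wf f0; apply: ae_eq0_annulus => // y r r0 h1 h2.
have yr : enorm y + r < 1 by lra.
have := wf _ _ (smooth_ker y r) yr (vanish_ker r0) => /(congr1 -%R).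
rewrite opprK /M => <-.
have sk := sqi_partial i (smooth_ker y r) (vanish_ker r0).
rewrite (@eq_Rintegral_ae _ (cst 0)) ?Rintegral_cst ?mul0r ?oppr0//.
  exact: (rintegrable_measurable (sqi_mul sf sk)).
apply: filterS f0 => x hx; have [hr|hr] := leP r (enorm (x - y)).
  by rewrite partial_ker_eq0// mulr0.
have := enormB_ge x y; have := enorm_triangle y x 0; rewrite !subr0 => h3 h4.
have h5 := enorm_triangle x y 0; rewrite !subr0 [enorm (y - x)]enormBC in h5.
by rewrite hx ?mul0r//; lra.
Qed.

Lemma sob_unique f F G i : sob f F -> sob f G ->
  {ae mu, forall x, F i x = G i x}.
Proof.
move=> [sf vf sF vF wF] [_ _ sG vG wG].
have sD : sqi mu (fun x => F i x - G i x) by exact: sqiB.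
have vD : vanish 1 (fun x => F i x - G i x) by move=> x hx; rewrite vF// vG// subrr.
(* The difference of two weak gradients of [f] is a weak gradient of 0; the inner radius -1 makes
   the annulus contain the origin. *)
have := @ae_eq0_weak (fun x => F i x - G i x) (-1) 1 i (cst 0) (lexx _) sD vD (sqi0 _).
case.
- move=> phi s sp s1 vp; rewrite (@eq_Rintegral _ _ _ _ _ (cst 0)); last first.
    by move=> x _; rewrite mul0r.
  rewrite Rintegral_cst// mul0r.
  have sph := sqi_test sp vp.
  under eq_Rintegral do rewrite mulrBl.
  rewrite RintegralB//; [|exact: sqi_mul|exact: sqi_mul].
  by have := wF _ _ sp s1 vp i; rewrite (wG _ _ sp s1 vp i); lra.
- exact: aeW.
move=> N [mN N0 hN]; exists N; split => // x /= hx; apply: hN => /= h; apply: hx.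
have [h1|h1] := ltP (enorm x) 1; last by rewrite vF// vG.
have : -1 < enorm x by rewrite (lt_le_trans _ (enorm_ge0 _)).
by move/h => /(_ h1) /eqP; rewrite subr_eq0 => /eqP.
Qed.

(** Allows a function supported in a smaller ball to be cut off without changing its gradient almost
    everywhere. *)
Lemma sob_local f F (a : R) i : sob f F ->
  {ae mu, forall x, a < enorm x -> f x = 0} ->
  {ae mu, forall x, a < enorm x -> F i x = 0}.
Proof.
move=> [sf vf sF vF wF] f0.
have := @ae_eq0_weak (F i) a 1 i f (lexx _) (sF i) (vF i) sf (fun phi s sp s1 vp => wF phi s sp s1 vp i).
case; first by apply: filterS f0 => x + h _; exact.
move=> N [mN N0 hN]; exists N; split => // x /= hx; apply: hN => /= h; apply: hx => ax.
have [h1|h1] := ltP (enorm x) 1; first exact: h.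
by rewrite vF.
Qed.

Lemma sob_ae f g F G : sob f F -> sqi mu g -> vanish 1 g ->
  (forall i, sqi mu (G i)) -> (forall i, vanish 1 (G i)) ->
  {ae mu, forall x, f x = g x} -> (forall i, {ae mu, forall x, F i x = G i x}) ->
  sob g G.
Proof.
move=> [sf vf sF vF wF] sg vg sG vG fg FG; split => // phi s sp s1 vp i.
have sph := sqi_test sp vp; have spd := sqi_partial i sp vp.
have mm (u v : V -> R) : sqi mu u -> sqi mu v -> measurable_fun setT (fun x => u x * v x).
  by move=> su sv; exact: rintegrable_measurable (sqi_mul su sv).
rewrite (@eq_Rintegral_ae _ (fun x => f x * partial i phi x)); [|exact: mm|exact: mm|].
  rewrite (@eq_Rintegral_ae (fun x => G i x * phi x) (fun x => F i x * phi x)); [|exact: mm|exact: mm|].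
    exact: wF sp s1 vp i.
  by apply: filterS (FG i) => x ->.
by apply: filterS fg => x ->.
Qed.

End sobolev_pairs.
Arguments hrad {R} m.
Arguments hrad_gt0 {R} m.
Arguments hrad_le1 {R} m.
Arguments cvg_hrad {R}.

(** * The weak gradient of an absolute value *)

Section absolute_value.
Context {R : realType}.
Implicit Types d s t : R.

(** A smooth substitute for the absolute value: it is 1-Lipschitz, its derivative [dsabs d] is
    bounded by 1, and |t| is recovered as [d] tends to 0. *)
Definition sabs d t : R := Num.sqrt (t ^+ 2 + d ^+ 2).

Definition dsabs d t : R := t / sabs d t.

Lemma sabs_ge d t : 0 < d -> d <= sabs d t.
Proof.
move=> d0; rewrite -{1}(gtr0_norm d0) -sqrtr_sqr ler_sqrt ?lerDr ?sqr_ge0//.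
by rewrite addr_ge0 ?sqr_ge0.
Qed.

Lemma sabs_gt0 d t : 0 < d -> 0 < sabs d t.
Proof. by move=> d0; apply: lt_le_trans (sabs_ge t d0). Qed.

Lemma sqr_sabs d t : sabs d t ^+ 2 = t ^+ 2 + d ^+ 2.
Proof. by rewrite sqr_sqrtr// addr_ge0 ?sqr_ge0. Qed.

Lemma norm_le_sabs d t : `|t| <= sabs d t.
Proof. by rewrite -sqrtr_sqr ler_sqrt ?lerDl ?sqr_ge0// addr_ge0 ?sqr_ge0. Qed.

Lemma sabs_le d t : 0 < d -> sabs d t <= `|t| + d.
Proof.
move=> d0; have h0 : 0 <= `|t| + d by rewrite addr_ge0// ltW.
rewrite -(ger0_norm h0) -sqrtr_sqr ler_sqrt ?sqr_ge0//.
by rewrite -(real_normK (num_real t)) sqrrD lerD2r lerDl mulrn_wge0// mulr_ge0// ltW.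
Qed.

Lemma sabs_lip d s t : 0 < d -> `|sabs d s - sabs d t| <= `|s - t|.
Proof.
move=> d0; have a0 := sabs_gt0 s d0; have b0 := sabs_gt0 t d0.
have ab0 : 0 < sabs d s + sabs d t by rewrite addr_gt0.
rewrite -(ler_pM2r ab0) -{1}(gtr0_norm ab0) -normrM -subr_sqr !sqr_sabs.
have -> : s ^+ 2 + d ^+ 2 - (t ^+ 2 + d ^+ 2) = (s - t) * (s + t) by ring.
by rewrite normrM ler_wpM2l// (le_trans (ler_normD _ _))// lerD// norm_le_sabs.
Qed.

Lemma dsabs_le1 d t : 0 < d -> `|dsabs d t| <= 1.
Proof.
move=> d0; have a0 := sabs_gt0 t d0.
rewrite normrM normfV (gtr0_norm a0) ler_pdivrMr// mul1r.
exact: norm_le_sabs.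
Qed.

Lemma dsabs_lip d s t : 0 < d -> `|dsabs d s - dsabs d t| <= 2 / d * `|s - t|.
Proof.
move=> d0; have a0 := sabs_gt0 s d0; have b0 := sabs_gt0 t d0.
(* Isolates the increment of the denominator, which [sabs_lip] controls. *)
have -> : dsabs d s - dsabs d t =
    (s - t - dsabs d t * (sabs d s - sabs d t)) / sabs d s.
  by rewrite /dsabs; field; rewrite !gt_eqF.
rewrite normrM normfV (gtr0_norm a0) ler_pdivrMr//.
have h1 : `|s - t - dsabs d t * (sabs d s - sabs d t)| <= 2 * `|s - t|.
  rewrite (le_trans (ler_normB _ _))// (_ : 2 * `|s - t| = `|s - t| + 1 * `|s - t|); last by ring.
  by rewrite lerD2l normrM ler_pM// ?dsabs_le1// sabs_lip.
apply: (le_trans h1).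
rewrite (_ : 2 / d * _ * _ = 2 * `|s - t| * (sabs d s / d)); last by ring.
by rewrite ler_peMr ?mulr_ge0// ler_pdivlMr// mul1r sabs_ge.
Qed.

Lemma is_derive_sabs d t : 0 < d -> is_derive t 1 (sabs d) (dsabs d t).
Proof.
move=> d0; have a0 := sabs_gt0 t d0.
have p0 : 0 < t ^+ 2 + d ^+ 2 by rewrite -sqr_sabs exprn_gt0.
have h1 := is_deriveD (is_deriveX 2 (is_derive_id t 1)) (is_derive_cst (d ^+ 2) t 1).
have h2 : is_derive ((@id R ^+ 2 + cst (d ^+ 2)) t) 1 Num.sqrt (2 * sabs d t)^-1.
  exact: is_derive1_sqrt.
have h3 := is_derive1_comp h2 h1.
apply: (is_derive_eq h3); rewrite /dsabs /GRing.scale /= addr0 mulr1.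
by field; rewrite gt_eqF.
Qed.

Lemma cvg_dsabs t : dsabs (hrad m) t @[m --> \oo] --> Num.sg t.
Proof.
have [->|t0] := eqVneq t 0.
  rewrite sgr0; under eq_fun do rewrite /dsabs mul0r; exact: cvg_cst.
have h : sabs (hrad m) t @[m --> \oo] --> `|t|.
  apply/cvgrPdist_le => e e0; have := @cvg_hrad R; move/cvgr0Pnorm_le => /(_ _ e0).
  apply: filterS => m; rewrite gtr0_norm ?hrad_gt0// => hm.
  rewrite distrC ger0_norm ?subr_ge0 ?norm_le_sabs// lerBlDl.
  by apply: (le_trans (sabs_le _ (hrad_gt0 _))); rewrite lerD2l.
have t0' : `|t| != 0 by rewrite normr_eq0.
rewrite (_ : Num.sg t = t / `|t|); last by rewrite {2}[t]numEsg mulfK.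
by apply: cvgM; [exact: cvg_cst|exact: cvgV].
Qed.

End absolute_value.

Section sobolev_absolute_value.
Context {R : realType} {n : nat}.
Local Notation V := 'rV[R]_n.
Local Notation mu := (leb n).
Implicit Types f g h phi psi : V -> R.
Implicit Types x y z : V.
Implicit Types F G : 'I_n -> V -> R.
Local Notation e_ i := (delta_mx 0 i : V).

Lemma continuous_sabs (d : R) : 0 < d -> continuous (sabs d).
Proof.
move=> d0 t; apply: differentiable_continuous; apply/derivable1_diffP.
by have [] := is_derive_sabs t d0.
Qed.

Lemma continuous_dsabs (d : R) : 0 < d -> continuous (dsabs d).
Proof.
move=> d0 t; apply: cvgM; first exact: cvg_id.
by apply: cvgV; [rewrite gt_eqF// sabs_gt0|exact: continuous_sabs].
Qed.

Lemma is_derive_sabs_comp (d : R) f x v df : 0 < d -> is_derive x v f df ->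
  is_derive x v (fun y => sabs d (f y)) (dsabs d (f x) * df).
Proof.
move=> d0 [fv fdf].
have dh : is_derive (0:R) 1 (fun t : R => f (t *: v + x)) df.
  by apply: DeriveDef; [exact: (derivable1P f x v).1|rewrite -derive1P].
have h0 : f (0 *: v + x) = f x by rewrite scale0r add0r.
have [d1 d2] := is_derive1_comp (is_derive_sabs (f (0 *: v + x)) d0) dh.
rewrite h0 in d2.
by apply: DeriveDef; [exact: (derivable1P _ x v).2|rewrite derive1P -d2].
Qed.

Lemma ibp_sabs (d : R) f phi s i : 0 < d -> smooth f -> smooth phi -> vanish s phi ->
  \int[mu]_x (sabs d (f x) * partial i phi x) =
  - \int[mu]_x (dsabs d (f x) * partial i f x * phi x).
Proof.
move=> d0 sf sp vp.
have cf := smooth_continuous sf; have cp := smooth_continuous sp.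
have cs : continuous (fun x => sabs d (f x)).
  by move=> x; apply: (@continuous_comp _ _ _ f (sabs d)); [exact: cf|exact: continuous_sabs].
have cds : continuous (fun x => dsabs d (f x)).
  by move=> x; apply: (@continuous_comp _ _ _ f (dsabs d)); [exact: cf|exact: continuous_dsabs].
have D x : is_derive x (e_ i) (fun y => sabs d (f y) * phi y)
    (sabs d (f x) * partial i phi x + dsabs d (f x) * partial i f x * phi x).
  have d1 := is_derive_sabs_comp d0 (derivableP (smooth_derivable sf (x := x) (i := i))).
  have d2 := derivableP (smooth_derivable sp (x := x) (i := i)).
  have := is_deriveM d1 d2; move/is_derive_eq; apply.
  by rewrite /GRing.scale /= [phi x * _]mulrC.
have E : partial i (fun y => sabs d (f y) * phi y) =
  (fun x => sabs d (f x) * partial i phi x + dsabs d (f x) * partial i f x * phi x).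
  by apply/funext => x; have [_] := D x.
have c1 : continuous (fun x => sabs d (f x) * partial i phi x).
  by move=> x; apply: (@cvgM _ _ (nbhs x)); [exact: cs|exact: (sp [:: i]).1].
have c2 : continuous (fun x => dsabs d (f x) * partial i f x * phi x).
  move=> x; apply: (@cvgM _ _ (nbhs x)); last exact: cp.
  by apply: (@cvgM _ _ (nbhs x)); [exact: cds|exact: (sf [:: i]).1].
have H := @Rintegral_partial R n (fun y => sabs d (f y) * phi y) s i.
move: H; rewrite E RintegralD//; last 2 first.
  apply: (@rintegrable_vanish _ _ _ (s + 1)) => // x hx.
    have ss : s < s + 1 by rewrite ltrDl.
    by rewrite (vanish_partial i ss vp)// mulr0.
  apply: (@rintegrable_vanish _ _ _ s) => // x hx.
  by rewrite vp// mulr0.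
move=> H; apply/eqP; rewrite -addr_eq0; apply/eqP; apply: H.
- by move=> x; apply: (@cvgM _ _ (nbhs x)); [exact: cs|exact: cp].
- by move=> x; have [] := D x.
- by move=> x; apply: (@cvgD _ _ _ (nbhs x)); [exact: c1|exact: c2].
- by move=> x hx; rewrite vp// mulr0.
Qed.

Lemma cvg_Rintegral_of_le (u_ : nat -> V -> R) u (c_ : nat -> R) :
  (forall j, rintegrable mu (u_ j)) -> rintegrable mu u ->
  (\forall j \near \oo, `|\int[mu]_x (u_ j x - u x)| <= c_ j) ->
  c_ j @[j --> \oo] --> 0 ->
  \int[mu]_x u_ j x @[j --> \oo] --> \int[mu]_x u x.
Proof.
move=> iu_ iu h c0; apply/cvgrPdist_le => e e0.
move/cvgr0Pnorm_le : c0 => /(_ _ e0); apply: filterS2 h => j h hc.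
rewrite distrC -RintegralB; [|by []|exact: iu_|exact: iu].
apply: (le_trans h).
exact: le_trans (ler_norm _) hc.
Qed.

Lemma norm_Rintegral_mul_le f g : sqi mu f -> sqi mu g ->
  `|\int[mu]_x (f x * g x)| <= Num.sqrt (sqn mu f) * Num.sqrt (sqn mu g).
Proof.
move=> sf sg; rewrite -sqrtrM ?sqn_ge0// -sqrtr_sqr.
by rewrite ler_sqrt ?mulr_ge0 ?sqn_ge0//; exact: Rintegral_CauchySchwarz.
Qed.

Lemma cvg_sqrt0 (c_ : nat -> R) : c_ j @[j --> \oo] --> 0 ->
  Num.sqrt (c_ j) @[j --> \oo] --> 0.
Proof.
move=> h; have := cvg_comp _ _ h (@sqrt_continuous R 0).
by rewrite sqrtr0.
Qed.

(** The chain rule holds for mollifications of [f] by [ibp_sabs]. For small radii [partial_M]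
    identifies their gradients on the support of [phi], and both sides converge because [sabs d] and
    [dsabs d] are Lipschitz. *)
Lemma sob_abs_aux (d : R) f F phi s i : 0 < d -> sob f F -> smooth phi ->
  s < 1 -> vanish s phi ->
  \int[mu]_x (sabs d (f x) * partial i phi x) =
  - \int[mu]_x (dsabs d (f x) * F i x * phi x).
Proof.
move=> d0 sobf sp s1 vp; have [sf vf sF vF wF] := sobf.
have sph := sqi_test sp vp; have spd := sqi_partial i sp vp.
have cs := continuous_sabs d0; have cds := continuous_dsabs d0.
have ms (u : V -> R) : measurable_fun setT u -> measurable_fun setT (fun x => sabs d (u x)).
  by move=> mu_; apply: (measurableT_comp _ mu_); exact: continuous_measurable_fun.
have mds (u : V -> R) : measurable_fun setT u -> measurable_fun setT (fun x => dsabs d (u x)).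
  by move=> mu_; apply: (measurableT_comp _ mu_); exact: continuous_measurable_fun.
have sdsm (u v : V -> R) : measurable_fun setT u -> sqi mu v ->
    sqi mu (fun x => dsabs d (u x) * v x).
  move=> mu_ sv; apply: (le_sqi _ sv); first by apply: measurable_funM; [exact: mds|case: sv].
  by move=> x; rewrite normrM ler_piMl// dsabs_le1.
pose f_ j y := M f y (hrad j).
pose F_ j y := M (F i) y (hrad j).
have sf_ j : sqi mu (f_ j) by apply: sqi_M => //; exact: hrad_gt0.
have sF_ j : sqi mu (F_ j) by apply: sqi_M => //; exact: hrad_gt0.
have smf j : smooth (f_ j) by apply: smooth_M => //; exact: hrad_gt0.
have mf_ j : measurable_fun setT (f_ j) by case: (sf_ j).
have mf : measurable_fun setT f by case: sf.
have f_f := cvg_M sf vf; have F_F := cvg_M (sF i) (vF i).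
have [K K0 phiK] := vanish_bounded (smooth_continuous sp) vp.
have is_ (u : V -> R) : sqi mu u -> rintegrable mu (fun x => sabs d (u x) * partial i phi x).
  move=> su; have [mu_ _] := su.
  apply: (@le_rintegrable _ _ _ _ _ (fun x => `|u x| * `|partial i phi x| + d * `|partial i phi x|)).
  - by apply: measurable_funM; [exact: ms|case: spd].
  - apply: rintegrableD; first by apply: sqi_mul; exact: sqi_norm.
    apply: rintegrableZ; apply: rintegrable_norm.
    have s2 : s < s + 1 by rewrite ltrDl.
    exact: (sqi_rintegrable spd (vanish_partial i s2 vp)).
  - move=> x; rewrite normrM -mulrDl ler_wpM2r// ger0_norm; first exact: sabs_le.
    by rewrite ltW// sabs_gt0.
have c1 : \int[mu]_x (sabs d (f_ j x) * partial i phi x) @[j --> \oo] -->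
    \int[mu]_x (sabs d (f x) * partial i phi x).
  apply: (@cvg_Rintegral_of_le _ _ (fun j => Num.sqrt (sqn mu (fun y => f_ j y - f y)) * Num.sqrt (sqn mu (partial i phi)))).
  - by move=> j; exact: is_.
  - exact: is_.
  - apply: nearW => j.
    have sD : sqi mu (fun x => sabs d (f_ j x) - sabs d (f x)).
      apply: (@le_sqi _ _ _ _ _ (fun y => f_ j y - f y)); last by move=> x; exact: sabs_lip.
        by apply: measurable_funB; exact: ms.
      exact: sqiB.
    under eq_Rintegral do rewrite -mulrBl.
    apply: (le_trans (norm_Rintegral_mul_le sD spd)).
    rewrite ler_wpM2r ?sqrtr_ge0// ler_sqrt ?sqn_ge0//.
    by apply: le_sqn => //; [exact: sqiB|move=> x; exact: sabs_lip].
  - by have := cvgM (cvg_sqrt0 f_f) (cvg_cst (Num.sqrt (sqn mu (partial i phi)))); rewrite mul0r; apply.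
have c2 : \int[mu]_x (dsabs d (f_ j x) * F_ j x * phi x) @[j --> \oo] -->
    \int[mu]_x (dsabs d (f x) * F i x * phi x).
  apply: (@cvg_Rintegral_of_le _ _ (fun j => Num.sqrt (sqn mu (fun y => F_ j y - F i y)) * Num.sqrt (sqn mu phi) +
     2 / d * K * (Num.sqrt (sqn mu (fun y => f_ j y - f y)) * Num.sqrt (sqn mu (F i))))).
  - by move=> j; apply: sqi_mul => //; exact: sdsm.
  - by apply: sqi_mul => //; exact: sdsm.
  - apply: nearW => j.
    have sA : sqi mu (fun x => F_ j x - F i x) by exact: sqiB.
    have sB : sqi mu (fun x => f_ j x - f x) by exact: sqiB.
    have i1 : rintegrable mu (fun x => dsabs d (f_ j x) * (F_ j x - F i x) * phi x).
      by apply: sqi_mul => //; exact: sdsm.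
    have i2 : rintegrable mu (fun x => (dsabs d (f_ j x) - dsabs d (f x)) * F i x * phi x).
      under eq_fun do rewrite mulrBl mulrBl.
      by apply: rintegrableB; apply: sqi_mul => //; exact: sdsm.
    (* The gradient error is paired with [phi] in L^2. The error of [dsabs] multiplies [F i], which
       already uses up Cauchy-Schwarz, so there [phi] enters through its bound [K]. *)
    have -> : \int[mu]_x (dsabs d (f_ j x) * F_ j x * phi x - dsabs d (f x) * F i x * phi x) =
        \int[mu]_x (dsabs d (f_ j x) * (F_ j x - F i x) * phi x) +
        \int[mu]_x ((dsabs d (f_ j x) - dsabs d (f x)) * F i x * phi x).
      by rewrite -RintegralD//; apply: eq_Rintegral => x _; ring.
    rewrite (le_trans (ler_normD _ _))// lerD//.
      apply: (le_trans (norm_Rintegral_mul_le (sdsm _ _ (mf_ j) sA) sph)).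
      rewrite ler_wpM2r ?sqrtr_ge0// ler_sqrt ?sqn_ge0//.
      apply: le_sqn => //; first exact: sdsm.
      by move=> x; rewrite normrM ler_piMl// dsabs_le1.
    apply: (le_trans (le_normr_Rintegral measurableT i2)).
    apply: (@le_trans _ _ (\int[mu]_x (2 / d * K * (`|f_ j x - f x| * `|F i x|)))).
      apply: le_RintegralT; first exact: rintegrable_norm.
        by apply: rintegrableZ; apply: sqi_mul; exact: sqi_norm.
      move=> x; rewrite !normrM.
      have h1 := dsabs_lip (f_ j x) (f x) d0; have h2 := phiK x.
      rewrite (_ : 2 / d * K * _ = 2 / d * `|f_ j x - f x| * `|F i x| * K); last by ring.
      by apply: ler_pM => //; rewrite ler_wpM2r.
    rewrite RintegralZl; [|by []|by apply: sqi_mul; exact: sqi_norm].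
    rewrite ler_wpM2l//; first by rewrite mulr_ge0// divr_ge0// ltW.
    rewrite -[leLHS]ger0_norm; last by apply: Rintegral_ge0 => x _; rewrite mulr_ge0.
    apply: (le_trans (norm_Rintegral_mul_le (sqi_norm sB) (sqi_norm (sF i)))).
    by rewrite /sqn; under eq_Rintegral do rewrite real_normK ?num_real//;
       under [X in _ * Num.sqrt X <= _]eq_Rintegral do rewrite real_normK ?num_real//.
  - have h1 := cvgM (cvg_sqrt0 F_F) (cvg_cst (Num.sqrt (sqn mu phi))).
    have h2 := cvgM (cvg_cst (2 / d * K)) (cvgM (cvg_sqrt0 f_f) (cvg_cst (Num.sqrt (sqn mu (F i))))).
    by have := cvgD (h1 _ _) (h2 _ _ _ _); rewrite !mul0r mulr0 addr0; apply.
have c3 : (- \int[mu]_x (dsabs d (f_ j x) * F_ j x * phi x)) @[j --> \oo] -->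
    \int[mu]_x (sabs d (f x) * partial i phi x).
  apply: cvg_trans c1; apply: near_eq_cvg.
  (* Once the radius is below 1 - s, kernels centred on the support of [phi] stay inside the unit
     ball. *)
  have s2 : 0 < 1 - s by rewrite subr_gt0.
  have [m _ hm] := near_infty_natSinv_lt (PosNum s2).
  exists m => // j mj; have {hm} rj : hrad j < 1 - s := hm j mj.
  rewrite (ibp_sabs i d0 (smf j) sp vp); congr (- _).
  apply: eq_Rintegral => x _.
  have [hx|hx] := leP s (enorm x); first by rewrite vp// !mulr0.
  congr (_ * _ * _); rewrite /F_ /f_ (partial_M i (hrad_gt0 j) sobf)//; lra.
rewrite -(cvg_lim (@Rhausdorff R) c3); apply: (cvg_lim (@Rhausdorff R)).
by apply: cvgN.
Qed.

(** Lets the parameter of [sob_abs_aux] tend to 0. The factors [dsabs] converge pointwise to the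
    sign, with value 0 where [f] vanishes, and domination by |F i| gives L^2 convergence. *)
Lemma sob_abs f F : sob f F ->
  sob (fun x => `|f x|) (fun i x => Num.sg (f x) * F i x).
Proof.
move=> sobf; have [sf vf sF vF wF] := sobf.
have mf : measurable_fun setT f by case: sf.
have mds d (u : V -> R) : 0 < d -> measurable_fun setT u -> measurable_fun setT (fun x => dsabs d (u x)).
  by move=> d0 mu_; apply: (measurableT_comp _ mu_); apply: continuous_measurable_fun; exact: continuous_dsabs.
have H i := @sqn_dominated _ _ _ mu (fun j x => dsabs (hrad j) (f x) * F i x)
  (fun x => Num.sg (f x) * F i x) (fun x => `|F i x|).
have {}H i : sqi mu (fun x => Num.sg (f x) * F i x) /\
   sqn mu (fun x => dsabs (hrad j) (f x) * F i x - Num.sg (f x) * F i x) @[j --> \oo] --> 0.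
  apply: H.
  - move=> j; apply: measurable_funM; last by case: (sF i).
    by apply: mds => //; exact: hrad_gt0.
  - exact: sqi_norm.
  - by move=> x; apply: cvgM; [exact: cvg_dsabs|exact: cvg_cst].
  - by move=> j x; rewrite normrM ler_piMl// dsabs_le1// hrad_gt0.
split.
- exact: sqi_norm.
- by move=> x hx; rewrite vf// normr0.
- by move=> i; case: (H i).
- by move=> i x hx; rewrite vF// mulr0.
move=> phi s sp s1 vp i.
have sph := sqi_test sp vp; have spd := sqi_partial i sp vp.
have vpd : vanish (s + 1) (partial i phi) by apply: vanish_partial vp; rewrite ltrDl.
have ipd : rintegrable mu (fun x => `|partial i phi x|).
  exact: rintegrable_norm (sqi_rintegrable spd vpd).
have [sH cH] := H i.
have sdF j : sqi mu (fun x => dsabs (hrad j) (f x) * F i x).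
  apply: (le_sqi _ (sF i)).
    apply: measurable_funM; last by case: (sF i).
    by apply: mds => //; exact: hrad_gt0.
  by move=> x; rewrite normrM ler_piMl// dsabs_le1// hrad_gt0.
have c2 := cvg_Rintegral_mul sdF sH sph cH.
have is_ j : rintegrable mu (fun x => sabs (hrad j) (f x) * partial i phi x).
  apply: (@le_rintegrable _ _ _ _ _ (fun x => `|f x| * `|partial i phi x| + hrad j * `|partial i phi x|)).
  - apply: measurable_funM; last by case: spd.
    apply: (measurableT_comp _ mf); apply: continuous_measurable_fun.
    by apply: continuous_sabs; exact: hrad_gt0.
  - by apply: rintegrableD; [apply: sqi_mul; exact: sqi_norm|exact: rintegrableZ].
  - move=> x; rewrite normrM -mulrDl ler_wpM2r// ger0_norm; first by apply: sabs_le; exact: hrad_gt0.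
    by rewrite ltW// sabs_gt0// hrad_gt0.
have iabs : rintegrable mu (fun x => `|f x| * partial i phi x).
  by apply: sqi_mul => //; exact: sqi_norm.
have c1 : \int[mu]_x (sabs (hrad j) (f x) * partial i phi x) @[j --> \oo] -->
    \int[mu]_x (`|f x| * partial i phi x).
  apply: (@cvg_Rintegral_of_le _ _ (fun j => hrad j * \int[mu]_x `|partial i phi x|)) => //.
    apply: nearW => j.
    apply: (le_trans (le_normr_Rintegral measurableT (rintegrableB (is_ j) iabs))).
    rewrite -RintegralZl//; apply: le_RintegralT; first by apply: rintegrable_norm; exact: rintegrableB.
      exact: rintegrableZ.
    move=> x; rewrite -mulrBl normrM ler_wpM2r// ger0_norm ?subr_ge0 ?norm_le_sabs//.
    by rewrite lerBlDl sabs_le// hrad_gt0.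
  by have := cvgM (cvg_hrad) (cvg_cst (\int[mu]_x `|partial i phi x|)); rewrite mul0r; apply.
have c3 : (- \int[mu]_x (dsabs (hrad j) (f x) * F i x * phi x)) @[j --> \oo] -->
    \int[mu]_x (`|f x| * partial i phi x).
  apply: cvg_trans c1; apply: near_eq_cvg; apply: nearW => j.
  by rewrite (sob_abs_aux i (hrad_gt0 j) sobf sp s1 vp).
rewrite -(cvg_lim (@Rhausdorff R) c3); apply: (cvg_lim (@Rhausdorff R)).
by apply: cvgN.
Qed.

End sobolev_absolute_value.

(** * The spaces H^1 and H^1_0 of the unit ball *)

Section Lfun2.
Context {d : measure_display} {T : measurableType d} {R : realType}.
Context {mu : {measure set T -> \bar R}}.
Implicit Types f : T -> R.

Lemma Lnorm2E f : ('N[mu]_2%:E[EFin \o f] =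
  (\int[mu]_x (f x ^+ 2)%:E) `^ (2^-1)%R)%E.
Proof.
rewrite unlock; congr (_ `^ _)%E; apply: eq_integral => x _ /=.
by rewrite -[2]/(2%:R) powR_mulrn// real_normK// num_real.
Qed.

Lemma integral_sqr f : sqi mu f -> (\int[mu]_x (f x ^+ 2)%:E = (sqn mu f)%:E)%E.
Proof. by move=> [_ h]; rewrite /sqn /Rintegral fineK//; exact: integrable_fin_num. Qed.

Lemma Lnorm2_sqi f : sqi mu f -> 'N[mu]_2%:E[EFin \o f]%E = (Num.sqrt (sqn mu f))%:E.
Proof. by move=> sf; rewrite Lnorm2E integral_sqr// poweR_EFin powR12_sqrt// sqn_ge0. Qed.

Lemma Lfun2_sqi f : f \in Lfun mu 2%:E <-> sqi mu f.
Proof.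
split=> [h|sf].
  split; last exact: Lfun2_integrable_sqr.
  by move: h; rewrite inE => /andP[h _]; move: h; rewrite inE.
rewrite inE; apply/andP; split; rewrite inE/=; first by case: sf.
by rewrite /finite_norm Lnorm2_sqi// ltry.
Qed.

End Lfun2.

Section bridge.
Context {R : realType} {n : nat}.
Local Notation V := 'rV[R]_n.
Local Notation mu := (@leb R n).
Local Notation B := (@eball R n 1).
Implicit Types (f g phi : V -> R) (F G : 'I_n -> V -> R).

Lemma L2_sqi f : L2 B f <-> sqi mu (f \_ B).
Proof. exact: (@Lfun2_sqi _ _ _ (@lebesgue_rV R n) (f \_ B)). Qed.

Lemma vanish_restrict f : vanish 1 (f \_ B).
Proof. by move=> x hx; rewrite patchE memNset// /eball/= ltNge hx. Qed.

Lemma restrict_id f : vanish 1 f -> f \_ B = f.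
Proof.
move=> vf; apply/funext => x; rewrite patchE; case: ifPn => // /negP.
by rewrite inE /eball/= => /negP; rewrite -leNgt => /vf ->.
Qed.

Lemma restrict_in f x : enorm x < 1 -> (f \_ B) x = f x.
Proof. by move=> hx; rewrite patchE mem_set. Qed.

Lemma Rintegral_eball_mul f g :
  \int[mu]_(x in B) (f x * g x) = \int[mu]_x ((f \_ B) x * g x).
Proof.
rewrite Rintegral_mkcond; apply: eq_Rintegral => x _; rewrite !patchE.
by case: ifP; rewrite ?mul0r.
Qed.

(** Trades compact support in the open ball for vanishing beyond some radius below 1, in both
    directions. *)
Lemma weak_partialP i f g : weak_partial B i f g <->
  (forall phi s, smooth phi -> s < 1 -> vanish s phi ->
    \int[mu]_x ((f \_ B) x * partial i phi x) = - \int[mu]_x ((g \_ B) x * phi x)).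
Proof.
split=> h phi => [s sp s1 vp|tp].
  by rewrite -!Rintegral_eball_mul; exact: (h phi (vanish_test_function s1 sp vp)).
have [sp [s /andP[_ s1] vp]] := test_function_vanish ltr01 tp.
by have := h phi s sp s1 vp; rewrite -!Rintegral_eball_mul.
Qed.

Lemma wpartialP i f : H1 B f -> L2 B (wpartial B i f) /\ weak_partial B i f (wpartial B i f).
Proof.
move=> [_ /(_ i) [g hg]].
exact: (@xgetPex _ (cst 0) [set g | L2 B g /\ weak_partial B i f g] (ex_intro _ g hg)).
Qed.

Lemma H1_sob f : H1 B f -> sob (f \_ B) (fun i => wpartial B i f \_ B).
Proof.
move=> h; split.
- by case: h => h _; apply/L2_sqi.
- exact: vanish_restrict.
- by move=> i; by case: (wpartialP i h) => hw _; apply/L2_sqi.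
- by move=> i; exact: vanish_restrict.
move=> phi s sp s1 vp i; have [_ /weak_partialP hw] := wpartialP i h.
exact: hw sp s1 vp.
Qed.

Lemma sob_H1 f F : sob (f \_ B) F -> H1 B f.
Proof.
move=> [sf vf sF vF wF]; split; first exact/L2_sqi.
move=> i; exists (F i); split; first by apply/L2_sqi; rewrite (restrict_id (vF i)).
by apply/weak_partialP => phi s sp s1 vp; rewrite (restrict_id (vF i)); exact: wF sp s1 vp i.
Qed.

(** [wpartial] is an arbitrary choice among weak derivatives; uniqueness ties it to any gradient
    produced explicitly, such as that of a sorted competitor. *)
Lemma wpartial_ae f F i : sob (f \_ B) F ->
  {ae mu, forall x, (wpartial B i f \_ B) x = F i x}.
Proof. by move=> h; exact: (sob_unique i (H1_sob (sob_H1 h)) h). Qed.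

Lemma H1normE f F : sob (f \_ B) F ->
  H1norm B f = (Num.sqrt (sqn mu (f \_ B) + \sum_i sqn mu (F i)))%:E.
Proof.
move=> h; rewrite /H1norm.
have hw := H1_sob (sob_H1 h).
have sw i : sqi mu (wpartial B i f \_ B) by case: hw.
have [sf _ _ _ _] := h.
have -> : (\int[mu]_(x in B) (f x ^+ 2 + \sum_i wpartial B i f x ^+ 2)%:E)%E =
  (sqn mu (f \_ B) + \sum_i sqn mu (F i))%:E.
  have ig : rintegrable mu (fun x => (f \_ B) x ^+ 2 + \sum_i (wpartial B i f \_ B) x ^+ 2).
    apply: rintegrableD; first by case: sf.
    by apply: rintegrable_sum => i; case: (sw i).
  rewrite integral_mkcond; transitivity (\int[mu]_x
      ((f \_ B) x ^+ 2 + \sum_i (wpartial B i f \_ B) x ^+ 2)%:E)%E.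
    apply: eq_integral => x _; rewrite !patchE; case: ifPn => hx.
      by congr (_ + _)%:E; apply: eq_bigr => i _; rewrite patchE hx.
    by rewrite expr0n/= add0r big1// => i _; rewrite patchE (negbTE hx) expr0n.
  rewrite -[LHS]fineK; last exact: integrable_fin_num.
  congr (_%:E); rewrite -[LHS]/(\int[mu]_x _) RintegralD//; [|by case: sf|]; last first.
    by apply: rintegrable_sum => i; case: (sw i).
  congr (_ + _); rewrite Rintegral_sum; last by move=> i; case: (sw i).
  apply: eq_bigr => i _; apply: eq_Rintegral_ae.
  - by apply: measurable_funX; case: (sw i).
  - by apply: measurable_funX; case: h => _ _ /(_ i)[].
  by have := wpartial_ae i h; apply: filterS => x ->.
rewrite poweR_EFin powR12_sqrt// addr_ge0 ?sqn_ge0// sumr_ge0// => i _; exact: sqn_ge0.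
Qed.

End bridge.

(** * Sobolev functions supported in a smaller ball belong to H^1_0 *)

Section H10.
Context {R : realType} {n : nat}.
Local Notation V := 'rV[R]_n.
Local Notation mu := (@leb R n).
Local Notation B := (@eball R n 1).
Implicit Types (f g phi : V -> R) (F G : 'I_n -> V -> R).

Lemma sqi_restrict f (E : set V) : measurable E -> sqi mu f -> sqi mu (f \_ E).
Proof.
move=> mE sf; apply: (le_sqi _ sf).
  by apply/(measurable_restrictT _ mE); apply: measurable_funTS; case: sf.
by move=> x; rewrite patchE; case: ifP => //; rewrite normr0.
Qed.

Lemma restrict_eball_out f r x : r <= enorm x -> (f \_ (eball n r)) x = 0.
Proof. by move=> hx; rewrite patchE memNset// /eball/= ltNge hx. Qed.

Lemma restrict_eball_in f r x : enorm x < r -> (f \_ (eball n r)) x = f x.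
Proof. by move=> hx; rewrite patchE mem_set. Qed.

Lemma partial_M_vanish f F i y a r : 0 < r -> a + r + r < 1 -> sob f F ->
  vanish a f -> vanish a (F i) -> partial i (fun z => M f z r) y = M (F i) y r.
Proof.
move=> r0 ar sobf vf vF.
have [hy|hy] := ltP (enorm y + r) 1; first exact: partial_M.
have hy2 : a + r < enorm y by lra.
rewrite (vanish_M r0 vF) ?ltW//.
by apply: (vanish_partial i hy2 (vanish_M r0 vf)).
Qed.

(** Cuts [f] off at a radius [a] between [rho] and 1, so that it vanishes beyond [a] everywhere and
    not only almost everywhere; its mollifications are then test functions and converge together
    with their gradients. *)
Lemma sob_H10 f F rho : rho < 1 -> sob (f \_ B) F ->
  {ae mu, forall x, rho < enorm x -> (f \_ B) x = 0} -> H10 B f.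
Proof.
move=> rho1 sobf ff; split; first exact: sob_H1 sobf.
have fF i := sob_local i sobf ff.
have [sf vf sF vF _] := sobf.
pose a := (rho + 1) / 2; have [rhoa a1] : rho < a /\ a < 1 by rewrite /a; split; lra.
pose g : V -> R := (f \_ B) \_ (eball n a).
pose G i : V -> R := F i \_ (eball n a).
have mE : measurable (@eball R n a) by exact: measurable_eball.
have sg : sqi mu g by exact: sqi_restrict.
have sG i : sqi mu (G i) by exact: sqi_restrict.
have va (h : V -> R) : vanish a (h \_ (eball n a)) by move=> x; exact: restrict_eball_out.
have vg : vanish a g by exact: va.
have vG i : vanish a (G i) by exact: va.
have a1' := ltW a1.
have gae (h : V -> R) : {ae mu, forall x, rho < enorm x -> h x = 0} ->
    {ae mu, forall x, h x = (h \_ (eball n a)) x}.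
  apply: filterS => x hx; have [xa|xa] := ltP (enorm x) a.
    by rewrite restrict_eball_in.
  by rewrite restrict_eball_out// hx//; exact: lt_le_trans xa.
have sobg : sob g G.
  apply: (sob_ae sobf) => // [|i||i]; [exact: vanish_le vg|exact: vanish_le (vG i)|exact: gae|].
  exact/gae/fF.
move=> e e0.
pose c j := sqn mu (fun y => M g y (hrad j) - g y) +
  \sum_i sqn mu (fun y => M (G i) y (hrad j) - G i y).
have cc : c j @[j --> \oo] --> 0.
  have h1 : \sum_i sqn mu (fun y => M (G i) y (hrad j) - G i y) @[j --> \oo] --> \sum_(i < n) (0 : R).
    apply: cvg_big => [|i _]; first exact: add_continuous.
    by apply: cvg_M => //; exact: vanish_le (vG i).
  have h2 : sqn mu (fun y => M g y (hrad j) - g y) @[j --> \oo] --> 0.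
    by apply: cvg_M => //; exact: vanish_le vg.
  by have := cvgD h2 h1; rewrite big1// addr0; apply.
have e2 : 0 < e ^+ 2 by rewrite exprn_gt0.
have b0 : 0 < (1 - a) / 2 by rewrite divr_gt0// subr_gt0.
(* A radius below (1 - a) / 2 gives a + 2 r < 1: each point either has its kernel inside the unit
   ball or lies beyond the mollified support, the two cases of [partial_M_vanish]. *)
have [j cj rj] : exists2 j, c j < e ^+ 2 & hrad j < (1 - a) / 2.
  have : \forall j \near \oo, c j < e ^+ 2 /\ hrad j < (1 - a) / 2.
    near=> j; split; near: j.
      exact: (@cvgr_lt _ _ _ _ _ _ cc).
    exact: (@cvgr_lt _ _ _ _ _ _ (@cvg_hrad R)).
  by move=> [m _ /(_ m (leqnn m))[]]; exists m.
rewrite {cc}/c in cj.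
have r0 := @hrad_gt0 R j; move: (hrad j) => r in rj r0 cj *.
have ar : a + r + r < 1 by lra.
have ar1 : a + r < 1 by lra.
pose phi y := M g y r.
have vg1 : vanish 1 g := vanish_le a1' vg.
have sp : smooth phi by exact: smooth_M.
have vp : vanish (a + r) phi by exact: vanish_M.
exists phi; first exact: vanish_test_function ar1 sp vp.
have dp i : partial i phi = fun y => M (G i) y r.
  by apply/funext => y; exact: (partial_M_vanish y r0 ar sobg vg (vG i)).
have sobp := sob_test sp ar1 vp.
have E : (f \- phi) \_ B = fun x => (f \_ B) x - phi x.
  apply/funext => x; rewrite patchE; case: ifPn => hx.
    by rewrite patchE hx.
  rewrite patchE (negbTE hx) vp ?subrr//; move/negP: hx.
  by rewrite inE /eball/= => /negP; rewrite -leNgt; apply: le_trans; exact: ltW.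
have sobd : sob ((f \- phi) \_ B) (fun i x => - (M (G i) x r - G i x)).
  rewrite E; apply: (sob_ae (sob_lin 1 (-1) sobg sobp)).
  - by apply: sqiB => //; exact: sqi_test sp vp.
  - by move=> x hx; rewrite vf// (vanish_le (ltW ar1) vp)// subrr.
  - by move=> i; apply: sqiN; apply: sqiB => //; apply: sqi_M => //; exact: vanish_le (vG i).
  - move=> i x hx; rewrite (vanish_M r0 (vG i)) ?(vanish_le a1' (vG i))// ?subrr ?oppr0//.
    exact: le_trans (ltW ar1) hx.
  - by have := gae _ ff; apply: filterS => x ->; rewrite mul1r mulN1r.
  - by move=> i; apply: aeW => x; rewrite mul1r mulN1r opprB dp.
rewrite (H1normE sobd) lte_fin -[ltRHS]gtr0_norm// -sqrtr_sqr ltr_sqrt//.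
apply: le_lt_trans cj; rewrite lerD//.
  rewrite le_eqVlt; apply/orP; left; apply/eqP; apply: eq_Rintegral_ae.
  - by apply: measurable_funX; case: sobd => -[].
  - by apply: measurable_funX; have [] := sqiB (sqi_test sp vp) sg.
  - have := gae _ ff; apply: filterS => x hx.
    by rewrite E hx -/g -/(phi x) -sqrrN opprB.
apply: ler_sum => i _; rewrite le_eqVlt; apply/orP; left; apply/eqP.
by apply: eq_Rintegral => x _; rewrite sqrrN.
Unshelve. all: by end_near.
Qed.

End H10.

(** * Pointwise sorting *)

Section sorting_network.
Context {R : realType} {N : nat}.
Implicit Types (y z u : 'I_N -> R) (a b i j k : 'I_N).

(** Compare-exchange, the maximum going to the first index. Sorting will be a fixed list of such
    steps, the same at every point of space, so that each step acts on whole functions. *)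
Definition cex (p : 'I_N * 'I_N) y i : R :=
  if i == p.1 then Num.max (y p.1) (y p.2)
  else if i == p.2 then Num.min (y p.1) (y p.2) else y i.

Definition exchanges (s : seq ('I_N * 'I_N)) y := foldl (fun y p => cex p y) y s.

Definition nonincr y := forall i j, (i <= j)%N -> y j <= y i.

Lemma cex_val p y i : exists j, cex p y i = y j.
Proof.
rewrite /cex; case: ifP => _.
  by rewrite /Num.max; case: ifP => _; eexists.
by case: ifP => _; [rewrite /Num.min; case: ifP => _|]; eexists.
Qed.

Lemma exchanges_val s y i : exists j, exchanges s y i = y j.
Proof.
elim: s y i => [|p s IH] y i; first by exists i.
have [j h] := IH (cex p y) i; have [k hk] := cex_val p y j.
by exists k; rewrite -hk -h.
Qed.

Lemma cex_nonincr a b y : (a < b)%N -> nonincr y -> cex (a, b) y = y.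
Proof.
move=> ab sy; apply/funext => i; rewrite /cex/=; have yab := sy _ _ (ltnW ab).
case: eqP => [->|_]; first by rewrite max_l.
by case: eqP => [->|//]; rewrite min_r.
Qed.

Lemma exchanges_nonincr s y : all (fun p : 'I_N * 'I_N => p.1 < p.2)%N s -> nonincr y ->
  exchanges s y = y.
Proof.
elim: s => [//|[a b] s IH] /= /andP[ab hs] sy.
by rewrite /exchanges/= cex_nonincr//; exact: IH.
Qed.

(** One round of selection sort: comparing [k] with every later position brings the largest
    remaining entry to [k]. *)
Definition row_net k := [seq (k, b) | b <- enum 'I_N & (k < b)%N].

Fixpoint sort_net (m : nat) := if m is m'.+1 then
  sort_net m' ++ (if insub m' is Some k then row_net k else [::]) else [::].

Definition settled (m : nat) y := forall i j, (i < m)%N -> (i < j)%N -> y j <= y i.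

Lemma cex_settled k b y : (k < b)%N -> settled k y -> settled k (cex (k, b) y).
Proof.
move=> kb sy i j ik ij; rewrite /cex/=.
have -> : (i == k) = false by apply/negbTE/eqP => ik'; rewrite ik' ltnn in ik.
have -> : (i == b) = false.
  by apply/negbTE/eqP => ib; rewrite ib ltnNge ltnW in ik.
have h1 := sy i k ik ik; have h2 := sy i b ik (ltn_trans ik kb).
case: ifP => _; first by rewrite ge_max h1.
by case: ifP => _; [rewrite ge_min h1|exact: sy].
Qed.

(** [D] collects the positions already compared with [k]; the entry at [k] only increases during the
    round, so those comparisons are never undone. *)
Lemma row_settled k s y (D : pred 'I_N) : all (fun b => k < b)%N s ->
  settled k y -> (forall b, D b -> (k < b)%N -> y b <= y k) ->
  settled k (exchanges [seq (k, b) | b <- s] y) /\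
  forall b, D b || (b \in s) -> (k < b)%N ->
    exchanges [seq (k, b) | b <- s] y b <= exchanges [seq (k, b) | b <- s] y k.
Proof.
elim: s y D => [|b s IH] y D /=.
  by move=> _ sy hD; split => // c; rewrite orbF; exact: hD.
move=> /andP[kb hs] sy hD.
have [c|s1 s2] := IH (cex (k, b) y) (fun c => D c || (c == b)) hs (cex_settled kb sy).
  move=> /orP hc kc; rewrite /cex/= eqxx.
  have -> : (c == k) = false by apply/negbTE/eqP => ck; rewrite ck ltnn in kc.
  case: eqP => [_|/eqP cb]; first by rewrite ge_min le_max lexx.
  by case: hc => [Dc|]; [rewrite le_max hD|rewrite (negbTE cb)].
by split => // c hc; apply: s2; rewrite -orbA -in_cons.
Qed.

Lemma sort_net_settled m y : settled m (exchanges (sort_net m) y).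
Proof.
elim: m => [//|m IH] /=; rewrite /exchanges foldl_cat -!/(exchanges _ _).
case: insubP => [k _ km|]; last first.
  rewrite -leqNgt => Nm i j _ ij; apply: IH => //.
  by apply: leq_trans Nm.
rewrite -km in IH *; rewrite /row_net.
have [|//|s1 s2] := @row_settled k [seq b : 'I_N <- enum 'I_N | (k < b)%N] _ pred0 _ IH.
  exact: filter_all.
move=> i j; rewrite ltnS leq_eqVlt => /orP[/eqP/val_inj ->|]; last exact: s1.
by move=> kj; apply: s2 => //=; rewrite mem_filter kj mem_enum.
Qed.

Lemma sort_net_nonincr y : nonincr (exchanges (sort_net N) y).
Proof.
move=> i j; rewrite leq_eqVlt => /orP[/eqP/val_inj -> //|].
exact: sort_net_settled.
Qed.

Lemma sort_net_lt m : all (fun p : 'I_N * 'I_N => p.1 < p.2)%N (sort_net m).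
Proof.
elim: m => [//|m IH] /=; rewrite all_cat IH/=; case: insubP => //= k _ _.
rewrite /row_net all_map; apply/allP => b; rewrite mem_filter.
by case/andP.
Qed.

(** The last index, having no successor, always belongs to this set; this is the 1 in
    [potential_jumps]. For a nonincreasing vector the cardinality is the number of distinct
    values. *)
Definition jumps y : {set 'I_N} :=
  [set i : 'I_N | [forall j : 'I_N, (j == i.+1 :> nat) ==> (y j < y i)]].

Lemma potential_jumps (y : 'rV[R]_N) : (0 < N)%N ->
  potential y + 1 = #|jumps (fun i => y 0 i)|%:R.
Proof.
move=> N0; have lN : (N.-1 < N)%N by rewrite prednK.
rewrite /potential -sum1_card natr_sum [RHS]big_mkcond/=.
rewrite (bigD1 (Ordinal lN))//= [RHS](bigD1 (Ordinal lN))//=.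
rewrite big_pred0 => [|j]; last first.
  by apply/negbTE; rewrite /= prednK// neq_ltn ltn_ord.
rewrite add0r ifT; last first.
  rewrite inE; apply/forallP => j; apply/implyP => /eqP /= jN.
  by have := ltn_ord j; rewrite jN prednK// ltnn.
rewrite addrC; congr (_ + _); apply: eq_bigr => i iN.
have iN1 : (i.+1 < N)%N.
  rewrite ltn_neqAle ltn_ord andbT; apply: contra iN => /eqP iN.
  by apply/eqP/val_inj; exact: (congr1 predn iN).
rewrite (big_pred1 (Ordinal iN1)) => [|j]; last by [].
rewrite inE; case: forallP => [/(_ (Ordinal iN1))|h].
  by rewrite eqxx/= => ->.
case: ltP => // hy; exfalso; apply: h => j; apply/implyP => /eqP ji.
by rewrite (_ : j = Ordinal iN1)//; exact: val_inj.
Qed.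

(* Every value of [y], hence of [z], is attained at a jump of [u], while [z] is
   injective on its own jumps. *)
Lemma jumps_le u y z : nonincr z -> (forall i, exists j, z i = y j) ->
  (forall i j, j = i.+1 :> nat -> ~~ (u j < u i) -> y j = y i) ->
  (#|jumps z| <= #|jumps u|)%N.
Proof.
move=> sz zy uy.
(* Moving right from [j], [y] stays constant until the first jump of [u], and one is reached because
   the last index is a jump. *)
have val (m : nat) j : (N - j <= m)%N -> exists2 e, e \in jumps u & y e = y j.
  elim: m j => [|m IH] j hj.
    by have := ltn_ord j; rewrite -subn_gt0 ltnNge hj.
  have [ju|] := boolP (j \in jumps u); first by exists j.
  rewrite inE negb_forall => /existsP[i]; rewrite negb_imply => /andP[/eqP ij hu].
  have [|e eu ey] := IH i.
    by rewrite ij subnS -subn1 leq_subLR add1n.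
  by exists e => //; rewrite ey; exact: uy.
rewrite !cardE -(size_map z) -(size_map y (enum (jumps u))).
apply: uniq_leq_size.
  rewrite map_inj_in_uniq ?enum_uniq// => i j.
  rewrite !mem_enum => hi hj zij; apply/val_inj/eqP.
  (* In a sorted vector, equal values at a < b rule out a strict drop just after [a]. *)
  have aux a b : a \in jumps z -> z a = z b -> ~~ (a < b)%N.
    rewrite inE => /forallP ha zab; apply/negP => ab.
    have aN : (a.+1 < N)%N := leq_ltn_trans ab (ltn_ord b).
    have := ha (Ordinal aN); rewrite eqxx/= ltNge => /negP; apply.
    by rewrite zab; exact: sz.
  by rewrite eqn_leq (leqNgt i) (leqNgt j) (aux _ _ hj (esym zij)) (aux _ _ hi zij).
move=> r /mapP[i _ ->]; have [j ->] := zy i.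
have [e eu <-] := val N j (leq_subr _ _).
by apply: map_f; rewrite mem_enum.
Qed.

Lemma potential_ge0 (y : 'rV[R]_N) : 0 <= potential y.
Proof. by apply: sumr_ge0 => i _; apply: sumr_ge0 => j _; rewrite ler0n. Qed.

Lemma potential_le (y : 'rV[R]_N) : (0 < N)%N -> potential y <= N%:R.
Proof.
move=> N0; apply: (@le_trans _ _ (potential y + 1)); first by rewrite lerDl.
rewrite potential_jumps// ler_nat (leq_trans (max_card _))// card_ord//.
Qed.

End sorting_network.

(** * Energy and potential under sorting *)

Section sobolev_sort.
Context {R : realType} {n N : nat}.
Local Notation V := 'rV[R]_n.
Local Notation mu := (@leb R n).
Implicit Types (f g : 'I_N -> V -> R) (F G : 'I_N -> 'I_n -> V -> R).

Definition energy F x : R := \sum_i \sum_k F i k x ^+ 2.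

Lemma max_half (a b : R) : Num.max a b = 2^-1 * (a + b) + 2^-1 * `|a - b|.
Proof.
have [h|h] := leP a b; [rewrite ler0_norm ?subr_le0//|rewrite gtr0_norm ?subr_gt0//]; lra.
Qed.

Lemma min_half (a b : R) : Num.min a b = 2^-1 * (a + b) + (- 2^-1) * `|a - b|.
Proof.
have [h|h] := leP a b; [rewrite ler0_norm ?subr_le0//|rewrite gtr0_norm ?subr_gt0//]; lra.
Qed.

(** Parallelogram law: the two sides differ by (1 - s^2) (a - b)^2 / 2, where [s] stands for the
    sign of the difference of two components. The factors 1 and -1 match the shape produced by
    [sob_lin]. *)
Lemma half_sqr_le (a b s : R) : s ^+ 2 <= 1 ->
  (2^-1 * (1 * a + 1 * b) + 2^-1 * (s * (1 * a + -1 * b))) ^+ 2 +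
  (2^-1 * (1 * a + 1 * b) + - 2^-1 * (s * (1 * a + -1 * b))) ^+ 2 <= a ^+ 2 + b ^+ 2.
Proof.
move=> s1; rewrite -subr_ge0.
rewrite (_ : _ - _ = (1 - s ^+ 2) * (a - b) ^+ 2 / 2); last by field.
by rewrite divr_ge0// mulr_ge0 ?sqr_ge0// subr_ge0.
Qed.

Lemma cex_sob p f F : p.1 != p.2 -> (forall i, sob (f i) (F i)) ->
  exists G, (forall i, sob (fun x => cex p (f^~ x) i) (G i)) /\
    forall x, energy G x <= energy F x.
Proof.
case: p => a b /= ab sf; have ba : b != a by rewrite eq_sym.
pose A k x := 1 * F a k x + 1 * F b k x.
pose D k x := Num.sg (1 * f a x + -1 * f b x) * (1 * F a k x + -1 * F b k x).
have sA : sob (fun x => 1 * f a x + 1 * f b x) A by exact: sob_lin.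
have sD : sob (fun x => `|1 * f a x + -1 * f b x|) D by apply: sob_abs; exact: sob_lin.
pose G i k x := if i == a then 2^-1 * A k x + 2^-1 * D k x
  else if i == b then 2^-1 * A k x + (- 2^-1) * D k x else F i k x.
exists G; split.
  move=> i; rewrite /cex /G /=; have [_|_] := eqVneq i a.
    have := sob_lin (2^-1) (2^-1) sA sD.
    by under eq_fun do rewrite !mul1r mulN1r -max_half.
  have [_|_] := eqVneq i b; last exact: sf.
  have := sob_lin (2^-1) (- 2^-1) sA sD.
  by under eq_fun do rewrite !mul1r mulN1r -min_half.
move=> x; rewrite /energy; have sp (H : 'I_N -> R) :
    \sum_i H i = H a + (H b + \sum_(i < N | (i != a) && (i != b)) H i).
  by rewrite (bigD1 a)//= (bigD1 b).
rewrite !sp !addrA lerD//.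
  rewrite -!big_split/=; apply: ler_sum => k _; rewrite /G !eqxx (negbTE ba) /A /D.
  apply: half_sqr_le; case: sgrP => _; rewrite ?expr0n ?expr1n ?sqrrN ?expr1n//.
rewrite le_eqVlt; apply/orP; left; apply/eqP.
apply: eq_bigr => i /andP[ia ib]; apply: eq_bigr => k _.
by rewrite /G (negbTE ia) (negbTE ib).
Qed.

Lemma exchanges_sob s f F : all (fun p : 'I_N * 'I_N => p.1 < p.2)%N s ->
  (forall i, sob (f i) (F i)) ->
  exists G, (forall i, sob (fun x => exchanges s (f^~ x) i) (G i)) /\
    forall x, energy G x <= energy F x.
Proof.
elim: s f F => [|p s IH] f F /=; first by move=> _ sf; exists F.
move=> /andP[pp hs] sf.
have [|G [sG eG]] := @cex_sob p f F _ sf; first by apply: contraTN pp => /eqP ->; rewrite ltnn.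
have [H [sH eH]] := IH (fun i x => cex p (f^~ x) i) G hs sG.
by exists H; split => // x; exact: le_trans (eH x) (eG x).
Qed.

Definition pot f x : R := potential (\row_i f i x).

Lemma measurable_pot f : (forall i, measurable_fun setT (f i)) ->
  measurable_fun setT (pot f).
Proof.
move=> mf; rewrite /pot /potential.
apply: measurable_sum => i; apply: (eq_measurable_fun (fun x : V =>
  \sum_(j < N) if j == i.+1 :> nat then (f j x < f i x)%R%:R else (0 : R))).
  by move=> x _; rewrite -big_mkcond/=; apply: eq_bigr => j _; rewrite !mxE.
apply: measurable_sum => j; case: (j == i.+1 :> nat); last exact: measurable_cst.
have mb : measurable_fun [set: bool] (fun b : bool => b%:R : R) by [].
exact: (measurableT_comp mb (measurable_fun_ltr (mf j) (mf i))).
Qed.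

Lemma pot_eq0 f x : (forall i, f i x = 0) -> pot f x = 0.
Proof.
move=> f0; rewrite /pot /potential big1// => i _; rewrite big1// => j _.
by rewrite !mxE !f0 ltxx.
Qed.

Lemma rintegrable_pot f : (0 < N)%N -> (forall i, measurable_fun setT (f i)) ->
  (forall i, vanish 1 (f i)) -> rintegrable mu (pot f).
Proof.
move=> N0 mf vf.
have vp : vanish 1 (pot f) by move=> x hx; apply: pot_eq0 => i; exact: vf.
apply: (sqi_rintegrable _ vp); apply: (sqi_bounded _ vp); first exact: measurable_pot.
by move=> x; rewrite ger0_norm ?potential_ge0//; exact: potential_le.
Qed.

End sobolev_sort.

(** * Competitors and the basic estimates *)

Section competitors.
Context {R : realType} {n N : nat}.
Local Notation V := 'rV[R]_n.
Local Notation mu := (@leb R n).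
Local Notation B := (@eball R n 1).
Implicit Types (U : V -> 'rV[R]_N) (F G : 'I_N -> 'I_n -> V -> R).

Definition trunc U (i : 'I_N) : V -> R := component U i \_ B.

Definition gradU U (i : 'I_N) (k : 'I_n) : V -> R := wpartial B k (component U i) \_ B.

Lemma sob_trunc U : admissible B U -> forall i, sob (trunc U i) (gradU U i).
Proof. by move=> [h _] i; exact: H1_sob. Qed.

Lemma rintegrable_energy F : (forall i k, sqi mu (F i k)) -> rintegrable mu (energy F).
Proof.
move=> sF; apply: rintegrable_sum => i; apply: rintegrable_sum => k.
by case: (sF i k).
Qed.

Lemma Rintegral_energy F : (forall i k, sqi mu (F i k)) ->
  \int[mu]_x energy F x = \sum_i \sum_k sqn mu (F i k).
Proof.
move=> sF; rewrite /energy Rintegral_sum.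
  apply: eq_bigr => i _; rewrite Rintegral_sum// => k.
  by case: (sF i k).
by move=> i; apply: rintegrable_sum => k; case: (sF i k).
Qed.

(** The functional is defined through the choice [wpartial]; with an arbitrary weak gradient
    instead, the energy of a sorted competitor can be computed. *)
Lemma JNE U G : (0 < N)%N -> (forall i, sob (trunc U i) (G i)) ->
  JN B U = (\int[mu]_x energy G x + \int[mu]_x pot (trunc U) x)%:E.
Proof.
move=> N0 sG.
have sU i := sob_H1 (sG i); have sW i := H1_sob (sU i).
have sW2 i k : sqi mu (gradU U i k) := sob_gsqi (sW i) k.
have sG2 i k : sqi mu (G i k) := sob_gsqi (sG i) k.
have ip : rintegrable mu (pot (trunc U)).
  by apply: rintegrable_pot => // i; case: (sG i) => -[].
have ie := rintegrable_energy sW2.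
transitivity (\int[mu]_x (energy (gradU U) x + pot (trunc U) x)%:E)%E.
  rewrite /JN integral_mkcond; apply: eq_integral => x _; rewrite patchE.
  case: ifPn => hx.
    congr (_ + _)%:E.
      by apply: eq_bigr => i _; apply: eq_bigr => k _; rewrite /gradU patchE hx.
    congr potential; apply/rowP => i; rewrite mxE.
    by rewrite /trunc patchE hx.
  rewrite pot_eq0 => [|i]; last by rewrite /trunc patchE (negbTE hx).
  rewrite addr0 /energy big1// => i _; rewrite big1// => k _.
  by rewrite /gradU patchE (negbTE hx) expr0n.
rewrite -[LHS]fineK; last exact: integrable_fin_num (rintegrableD ie ip).
congr (_%:E); rewrite -[LHS]/(\int[mu]_x _) RintegralD//; congr (_ + _).
rewrite !Rintegral_energy//; apply: eq_bigr => i _; apply: eq_bigr => k _.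
apply: eq_Rintegral_ae.
- by apply: measurable_funX; case: (sW2 i k).
- by apply: measurable_funX; case: (sG2 i k).
by have := wpartial_ae k (sG i); apply: filterS => x hx; rewrite /gradU hx.
Qed.

Lemma nonincr_adjacent (y : 'I_N -> R) :
  (forall i j : 'I_N, j = i.+1 :> nat -> y j <= y i) -> nonincr y.
Proof.
move=> h i j; rewrite leq_eqVlt => /orP[/eqP/val_inj -> //|].
have [m] := ubnP (j - i)%N; elim: m j => [//|m IH] j; rewrite ltnS => hm ij.
have jN : (j.-1 < N)%N := leq_ltn_trans (leq_pred _) (ltn_ord j).
have j0 : (0 < j)%N := leq_ltn_trans (leq0n _) ij.
apply: (@le_trans _ _ (y (Ordinal jN))); first by apply: h; rewrite /= prednK.
have [jl|jl] := ltnP i j.-1.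
  by apply: IH => //=; apply: leq_trans hm; rewrite ltn_sub2r// prednK.
rewrite (_ : Ordinal jN = i)//; apply/val_inj/eqP => /=.
by rewrite eqn_leq jl/= -ltnS prednK.
Qed.

Lemma trunc_nonincr U : admissible B U -> {ae mu, forall x, nonincr (trunc U ^~ x)}.
Proof.
move=> [_]; apply: filterS => x h; apply: nonincr_adjacent => i j ij.
rewrite /trunc !patchE; case: ifP => // /set_mem hx; exact: h hx i j ij.
Qed.

Definition sorted_sum (u phi : 'I_N -> V -> R) i x :=
  exchanges (sort_net N) (fun j => u j x + phi j x) i.

(** Minimality against the sorted perturbation, with its Dirichlet energy replaced by the larger one
    of [U + phi] and the square expanded. *)
Lemma competitor U (phi : 'I_N -> V -> R) s : (0 < N)%N -> minimizer B U ->
  (forall i, smooth (phi i)) -> s < 1 -> (forall i, vanish s (phi i)) ->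
  0 <= 2 * (\sum_i \sum_k \int[mu]_x (gradU U i k x * partial k (phi i) x)) +
    \sum_i \sum_k sqn mu (partial k (phi i)) +
    \int[mu]_x (pot (sorted_sum (trunc U) phi) x - pot (trunc U) x).
Proof.
move=> N0 [aU mU] sp s1 vp.
have sU := sob_trunc aU.
have sphi i := sob_test (sp i) s1 (vp i).
have sD i := sob_lin 1 1 (sU i) (sphi i).
have [G [sG eG]] := exchanges_sob (sort_net_lt N) sD.
pose v i x := exchanges (sort_net N) (fun j => 1 * trunc U j x + 1 * phi j x) i.
have vE : sorted_sum (trunc U) phi = v.
  apply/funext => i; apply/funext => x; rewrite /v /sorted_sum.
  by congr exchanges; apply/funext => j; rewrite !mul1r.
rewrite {}vE; pose W x : 'rV[R]_N := \row_i v i x.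
have cW i : component W i = v i by apply/funext => x; rewrite /component mxE.
have tW i : trunc W i = v i.
  by rewrite /trunc cW; apply: restrict_id; case: (sG i).
have sW i : sob (trunc W i) (G i) by rewrite tW; exact: sG.
have aW : admissible B W.
  split=> [i|]; first exact: sob_H1 (sW i).
  apply: aeW => x _ i j ij; rewrite !mxE; apply: sort_net_nonincr.
  by rewrite ij.
have hW i : H10 B (component W i \- component U i).
  have E : (component W i \- component U i) \_ B = fun x => 1 * v i x + -1 * trunc U i x.
    apply/funext => x; rewrite -tW /trunc !patchE; case: ifP => _.
      by rewrite mul1r mulN1r.
    by rewrite !mulr0 addr0.
  apply: (@sob_H10 _ _ _ _ s s1).
    by rewrite E; exact: (sob_lin 1 (-1) (sG i) (sU i)).
  (* Beyond radius [s] the perturbation vanishes and [U] is sorted almost everywhere, so the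
     exchanges do nothing; this places the difference in H^1_0. *)
  rewrite E; have := trunc_nonincr aU; apply: filterS => x nx hx.
  rewrite /v (_ : (fun j => _) = trunc U ^~ x); last first.
    by apply/funext => j; rewrite vp ?ltW// mulr0 addr0 mul1r.
  by rewrite exchanges_nonincr ?sort_net_lt// mul1r mulN1r subrr.
have := mU W aW hW; rewrite (JNE N0 sU) (JNE N0 sW) lee_fin.
have -> : pot (trunc W) = pot v.
  by apply/funext => x; congr potential; apply/rowP => i; rewrite !mxE tW.
have sG2 i k : sqi mu (G i k) := sob_gsqi (sG i) k.
have sU2 i k : sqi mu (gradU U i k) := sob_gsqi (sU i) k.
have sp2 i k : sqi mu (partial k (phi i)) := sob_gsqi (sphi i) k.
have sD2 i k : sqi mu (fun x => gradU U i k x + partial k (phi i) x) by exact: sqiD.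
have le1 : \int[mu]_x energy G x <= \sum_i \sum_k (sqn mu (gradU U i k) +
    2 * \int[mu]_x (gradU U i k x * partial k (phi i) x) + sqn mu (partial k (phi i))).
  apply: (@le_trans _ _ (\int[mu]_x energy (fun i k x => gradU U i k x + partial k (phi i) x) x)).
    apply: le_RintegralT; [exact: rintegrable_energy|exact: rintegrable_energy|].
    move=> x; apply: (le_trans (eG x)); rewrite /energy.
    by under eq_bigr do under eq_bigr do rewrite !mul1r.
  rewrite Rintegral_energy// le_eqVlt; apply/orP; left; apply/eqP.
  apply: eq_bigr => i _; apply: eq_bigr => k _; rewrite /sqn.
  have im := sqi_mul (sU2 i k) (sp2 i k).
  have [_ i1] := sU2 i k; have [_ i2] := sp2 i k.
  rewrite -RintegralZl// -RintegralD//; last exact: rintegrableZ.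
  rewrite -RintegralD//; last by apply: rintegrableD => //; exact: rintegrableZ.
  by apply: eq_Rintegral => x _; ring.
rewrite (Rintegral_energy sU2) => le2.
have ipv : rintegrable mu (pot v).
  by apply: rintegrable_pot => // i; case: (sG i) => -[].
have ipu : rintegrable mu (pot (trunc U)).
  by apply: rintegrable_pot => // i; case: (sU i) => -[].
rewrite RintegralB//.
have E : \sum_i \sum_k (sqn mu (gradU U i k) +
    2 * \int[mu]_x (gradU U i k x * partial k (phi i) x) + sqn mu (partial k (phi i))) =
  \sum_i \sum_k sqn mu (gradU U i k) +
  2 * (\sum_i \sum_k \int[mu]_x (gradU U i k x * partial k (phi i) x)) +
  \sum_i \sum_k sqn mu (partial k (phi i)).
  rewrite mulr_sumr -!big_split/=; apply: eq_bigr => i _.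
  by rewrite mulr_sumr -!big_split.
rewrite {}E in le1.
have aux (a b c d e f : R) : a <= c + 2 * d + e -> c + f <= a + b ->
  0 <= 2 * d + e + (b - f) by lra.
exact: aux le1 le2.
Qed.

End competitors.

(** * First variation against bumps *)

Section key_estimates.
Context {R : realType} {n N : nat}.
Local Notation V := 'rV[R]_n.
Local Notation mu := (@leb R n).
Local Notation B := (@eball R n 1).
Implicit Types (U : V -> 'rV[R]_N) (b h f g : V -> R) (c : 'I_N -> R).

Lemma le_Rintegral_ae f g : rintegrable mu f -> rintegrable mu g ->
  {ae mu, forall x, f x <= g x} -> \int[mu]_x f x <= \int[mu]_x g x.
Proof.
move=> rf rg fg; have mf := rintegrable_measurable rf.
have mg := rintegrable_measurable rg.
have mfg : measurable_fun setT (fun x => Num.max (f x) (g x)) by exact: measurable_maxr.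
rewrite (@eq_Rintegral_ae _ _ g (fun x => Num.max (f x) (g x)))//.
  apply: le_RintegralT => //; last by move=> x; rewrite le_max lexx.
  apply: (le_rintegrable mfg (rintegrableD (rintegrable_norm rf) (rintegrable_norm rg))).
  move=> x; have [_|_] := leP (f x) (g x); rewrite ?lerDl ?lerDr//.
by apply: filterS fg => x /max_r ->.
Qed.

Lemma indic_ball (y : V) (r : R) : 0 < r -> rintegrable mu (\1_(ball y r) : V -> R) /\
  \int[mu]_x (\1_(ball y r) : V -> R) x = (2 * r) ^+ n.
Proof.
move=> r0; have mB : measurable (ball y r) by exact: measurable_rV_ball.
have muB : mu (ball y r) = ((r *+ 2) ^+ n)%:E by exact: leb_ball.
split.
  apply/rintegrableP; split; first exact: measurable_indic.
  rewrite (eq_integral (fun x => (\1_(ball y r) x)%:E)).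
    by rewrite integral_indic ?setIT// [X in (X < _)%E]muB ltry.
  by move=> x _; rewrite ger0_norm.
rewrite /Rintegral integral_indic ?setIT//.
by rewrite [X in fine X]muB/= mulr_natl.
Qed.

Lemma Rintegral_Lap f F b s : sob f F -> smooth b -> s < 1 -> vanish s b ->
  \int[mu]_x (f x * Lap b x) = - \sum_k \int[mu]_x (F k x * partial k b x).
Proof.
move=> sobf sb s1 vb; pose s' := (s + 1) / 2.
have [ss' s'1] : s < s' /\ s' < 1 by rewrite /s'; split; lra.
have spb k : smooth (partial k b) by exact: smooth_partial.
have vpb k : vanish s' (partial k b) by exact: vanish_partial vb.
rewrite -sumrN /Lap; under eq_Rintegral do rewrite mulr_sumr.
rewrite Rintegral_sum => [|k].
  by apply: eq_bigr => k _; case: sobf => _ _ _ _ wf; exact: wf (spb k) s'1 (vpb k) k.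
apply: sqi_mul; first by case: sobf.
exact: sqi_partial (spb k) (vpb k).
Qed.

Lemma partialZ (a : R) b k : smooth b ->
  partial k (fun x => a * b x) = (fun x => a * partial k b x).
Proof.
move=> sb; apply/funext => x.
exact: (deriveZ a (@smooth_derivable _ _ b x k sb)).
Qed.

Lemma competitor_along U c b s (t : R) h : (0 < N)%N -> minimizer B U ->
  smooth b -> s < 1 -> vanish s b -> rintegrable mu h ->
  {ae mu, forall x, pot (sorted_sum (trunc U) (fun j x => t * c j * b x)) x -
    pot (trunc U) x <= h x} ->
  0 <= - 2 * t * (\sum_j c j * \int[mu]_x (trunc U j x * Lap b x)) +
    t ^+ 2 * ((\sum_j c j ^+ 2) * \sum_k sqn mu (partial k b)) + \int[mu]_x h x.
Proof.
move=> N0 mU sb s1 vb rh hh; have [aU _] := mU.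
have sU := sob_trunc aU.
have sphi j : smooth (fun x => t * c j * b x).
  by apply: smoothM => //; exact: smooth_cst.
have vphi j : vanish s (fun x => t * c j * b x).
  by move=> x hx; rewrite vb// mulr0.
have := competitor N0 mU sphi s1 vphi.
have spb k : sqi mu (partial k b) := sob_gsqi (sob_test sb s1 vb) k.
have -> : \sum_i \sum_k \int[mu]_x (gradU U i k x * partial k (fun x => t * c i * b x) x) =
    - t * (\sum_j c j * \int[mu]_x (trunc U j x * Lap b x)).
  rewrite mulr_sumr; apply: eq_bigr => j _.
  rewrite (Rintegral_Lap (sU j) sb s1 vb) mulrN mulrN mulNr opprK mulrA mulr_sumr.
  apply: eq_bigr => k _; rewrite -RintegralZl//; last first.
    by apply: sqi_mul => //; exact: (sob_gsqi (sU j) k).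
  by apply: eq_Rintegral => x _; rewrite partialZ//; ring.
have -> : \sum_i \sum_k sqn mu (partial k (fun x => t * c i * b x)) =
    t ^+ 2 * ((\sum_j c j ^+ 2) * \sum_k sqn mu (partial k b)).
  rewrite mulr_suml mulr_sumr; apply: eq_bigr => j _.
  rewrite mulrA -exprMn mulr_sumr; apply: eq_bigr => k _.
  by rewrite partialZ// sqnZ.
have pv : rintegrable mu (pot (sorted_sum (trunc U) (fun j x => t * c j * b x))).
  have sD i := sob_lin 1 1 (sU i) (sob_test (sphi i) s1 (vphi i)).
  have [G [sG _]] := exchanges_sob (sort_net_lt N) sD.
  have E : sorted_sum (trunc U) (fun j x => t * c j * b x) =
      fun i x => exchanges (sort_net N) (fun j => 1 * trunc U j x + 1 * (t * c j * b x)) i.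
    apply/funext => i; apply/funext => x; rewrite /sorted_sum.
    by congr exchanges; apply/funext => j; rewrite !mul1r.
  by rewrite E; apply: rintegrable_pot => // i; case: (sG i) => -[].
have pu : rintegrable mu (pot (trunc U)).
  by apply: rintegrable_pot => // i; case: (sU i) => -[].
have := le_Rintegral_ae (rintegrableB pv pu) rh hh.
set a := \int[mu]_x (_ - _); set e := \int[mu]_x h x.
set S := \sum_j c j * _; set Q := t ^+ 2 * _.
have aux (a' e' S' Q' : R) : a' <= e' -> 0 <= 2 * (- t * S') + Q' + a' ->
  0 <= - 2 * t * S' + Q' + e' by lra.
exact: aux.
Qed.

Lemma norm_partial_bumpf0 k (y : V) (r : R) x : 0 < r ->
  `|partial k (bumpf 0 y r) x| <= 4 / r * \1_(ball y r) x.
Proof.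
move=> r0; rewrite partial_bumpf mul0r subr0.
have [h|h] := leP r (enorm (x - y)).
  by rewrite bumpf_eq0// mul0r normr0 mulr_ge0// divr_ge0// ltW.
rewrite indicE mem_set ?mulr1; last first.
  rewrite -ball_normE /= -normrN opprB; exact: le_lt_trans (norm_le_enorm _) h.
have hk : `|x 0 k - y 0 k| <= r.
  by apply: le_trans (ltW h); have := le_coord_enorm (x - y) k; rewrite !mxE.
have hb := norm_bumpf_le 2 y r x.
rewrite normrM normrM normrM normrN normr_nat.
have r2 : 0 <= r^-1 ^+ 2 by rewrite exprn_ge0// invr_ge0 ltW.
rewrite (ger0_norm r2).
(* The outer 2 bounds [bumpf 2]; the rest bounds 2 r^-2 |x_k - y_k| inside the ball. *)
apply: (@le_trans _ _ (2 * (2 * r^-1 ^+ 2 * r))); last first.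
  by rewrite expr2 -!mulrA mulVf ?gt_eqF// mulr1 mulrA -natrM.
apply: ler_pM => //; first by apply: mulr_ge0 => //; exact: mulr_ge0.
by rewrite ler_wpM2l//; exact: mulr_ge0.
Qed.

(** (2 r)^n is the volume of the enclosing sup-norm ball, and 16 r^-2 the square of the pointwise
    bound 4 / r. *)
Lemma sqn_partial_bumpf0 k (y : V) (r : R) : 0 < r ->
  sqn mu (partial k (bumpf 0 y r)) <= 16 * r^-1 ^+ 2 * (2 * r) ^+ n.
Proof.
move=> r0; have [i1 <-] := indic_ball y r0.
have s1 : sqi mu (partial k (bumpf 0 y r)).
  by apply: sqi_partial (smooth_bumpf 0 y r) (vanish_bumpf 0 r0).
rewrite -RintegralZl//; apply: le_RintegralT; [by case: s1|exact: rintegrableZ|].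
move=> x; rewrite -real_normK ?num_real//.
have := norm_partial_bumpf0 k y x r0; rewrite indicE.
case: (_ \in _); last first.
  by rewrite !mulr0 normr_le0 => /eqP ->; rewrite normr0 expr0n.
rewrite !mulr1 => h; rewrite (_ : 16 * _ = (4 / r) ^+ 2).
  by rewrite ler_sqr ?nnegrE// divr_ge0// ltW.
by rewrite expr_div_n exprVn -natrX.
Qed.

(** Half of (16 n + N) 2^n: 16 n from the gradient of the bump, N from the potential, 2^n from the
    cube of side 2 r. *)
Definition Clap : R := (8 * n%:R + N%:R / 2) * 2 ^+ n.

(** Amplitudes r and -r make the Dirichlet term t^2 r^(n-2) and the change of the potential both of
    order r^n; the two signs give the absolute value. *)
Lemma lap_le U i (y : V) (r : R) : (0 < N)%N -> minimizer B U -> 0 < r -> enorm y + r < 1 ->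
  `|\int[mu]_x (trunc U i x * Lap (bumpf 0 y r) x)| * r <= Clap * r ^+ n.
Proof.
move=> N0 mU r0 yr.
have sb := smooth_bumpf 0 y r; have vb := vanish_bumpf 0 (y := y) r0.
have [aU _] := mU; have ni := trunc_nonincr aU.
have [i1 E1] := indic_ball y r0.
have key (t : R) : t ^+ 2 = r ^+ 2 ->
    0 <= - 2 * t * (\int[mu]_x (trunc U i x * Lap (bumpf 0 y r) x)) +
      (16 * n%:R + N%:R) * (2 * r) ^+ n.
  move=> tr; pose c (j : 'I_N) : R := (j == i)%:R.
  have := @competitor_along U c _ _ t (fun x => N%:R * \1_(ball y r) x) N0 mU sb yr vb.
  have -> : \sum_j c j * \int[mu]_x (trunc U j x * Lap (bumpf 0 y r) x) =
      \int[mu]_x (trunc U i x * Lap (bumpf 0 y r) x).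
    rewrite (bigD1 i)//= /c eqxx mul1r big1 ?addr0// => j ji.
    by rewrite (negbTE ji) mul0r.
  have -> : \sum_j c j ^+ 2 = 1.
    rewrite (bigD1 i)//= /c eqxx expr1n big1 ?addr0// => j ji.
    by rewrite (negbTE ji) expr0n.
  rewrite mul1r RintegralZl// E1 => H.
  apply: (le_trans (H _ _)); first exact: rintegrableZ.
    apply: filterS ni => x nx.
    (* Off the bump the vector is unchanged and already sorted; on it the potential grows by at most
       N. *)
    have [h|h] := leP r (enorm (x - y)).
      rewrite (_ : pot _ x = pot (trunc U) x).
        by rewrite subrr mulr_ge0.
      congr potential; apply/rowP => j; rewrite !mxE /sorted_sum.
      rewrite (_ : (fun j0 => _) = trunc U ^~ x).
        by rewrite exchanges_nonincr// sort_net_lt.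
      by apply/funext => j'; rewrite bumpf_eq0// mulr0 addr0.
    rewrite indicE mem_set ?mulr1.
      by rewrite lerBlDr (le_trans (potential_le _ N0))// lerDl potential_ge0.
    by rewrite -ball_normE /= -normrN opprB; exact: le_lt_trans (norm_le_enorm _) h.
  rewrite -addrA lerD2l [leRHS]mulrDl lerD2r tr. 
  apply: (@le_trans _ _ (r ^+ 2 * \sum_(k < n) (16 * r^-1 ^+ 2 * (2 * r) ^+ n))).
    by rewrite ler_wpM2l ?sqr_ge0//; apply: ler_sum => k _; exact: sqn_partial_bumpf0.
  rewrite sumr_const card_ord -[_ *+ n]mulr_natl le_eqVlt; apply/orP; left; apply/eqP.
  by move: ((2 * r) ^+ n) => q; field; rewrite gt_eqF.
have k1 := key r erefl; have k2 := key (- r) (sqrrN _).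
move: k1 k2; rewrite /Clap exprMn.
set L := \int[mu]_x _; move: (2 ^+ n) (r ^+ n) (L) => p q l k1 k2.
by have [_|_] := ger0P l; lra.
Qed.

End key_estimates.

(** * Harmonic partial sums and Lipschitz averages *)

Section harmonic_sums.
Context {R : realType} {n N : nat}.
Local Notation V := 'rV[R]_n.
Local Notation mu := (@leb R n).
Local Notation B := (@eball R n 1).
Implicit Types (U : V -> 'rV[R]_N).

Lemma rintegrable0 : rintegrable mu (fun=> 0 : R).
Proof. exact: integrable0. Qed.

Definition psum U (i : 'I_N) x : R := \sum_(j < N | (j <= i)%N) trunc U j x.

Lemma rintegrable_trunc U (i : 'I_N) : admissible B U -> rintegrable mu (trunc U i).
Proof. by move=> /sob_trunc /(_ i) [sU vU _ _ _]; exact: sqi_rintegrable vU. Qed.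

(** There is no potential cost for any amplitude, however large: if the perturbation reverses the
    order at the gap, sorting restores it without creating new values. Hence -2 t L + t^2 Q >= 0 for
    all real t, which forces L = 0. *)
Lemma lap_eq0 U (i : 'I_N) (y : V) (r : R) : (0 < N)%N -> minimizer B U -> 0 < r ->
  enorm y + r < 1 ->
  {ae mu, forall x, enorm (x - y) < r -> forall j : 'I_N, j = i.+1 :> nat ->
    trunc U j x < trunc U i x} ->
  \int[mu]_x (psum U i x * Lap (bumpf 0 y r) x) = 0.
Proof.
move=> N0 mU r0 yr gap.
have sb := smooth_bumpf 0 y r; have vb := vanish_bumpf 0 (y := y) r0.
have [aU _] := mU; have ni := trunc_nonincr aU; have sU := sob_trunc aU.
pose c (j : 'I_N) : R := (j <= i)%N%:R.
pose L := \sum_j c j * \int[mu]_x (trunc U j x * Lap (bumpf 0 y r) x).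
pose Q := (\sum_j c j ^+ 2) * \sum_k sqn mu (partial k (bumpf 0 y r)).
have Q0 : 0 <= Q.
  by rewrite mulr_ge0// sumr_ge0// => j _; [exact: sqr_ge0|exact: sqn_ge0].
have key (t : R) : 0 <= 0 + t * (2 * - L) + t ^+ 2 * Q.
  have H := @competitor_along _ _ _ U c _ _ t (fun=> 0) N0 mU sb yr vb.
  have := H _ _; rewrite Rintegral_cst// mul0r addr0 -/L -/Q => {}H.
  rewrite (_ : 0 + t * (2 * - L) = - 2 * t * L); last by ring.
  apply: H; first exact: rintegrable0.
  move: ni gap; apply: filterS2 => x nx gx.
  rewrite subr_le0 -(lerD2r 1) !potential_jumps// ler_nat.
  have [h|h] := leP r (enorm (x - y)).
    rewrite leq_eqVlt; apply/orP; left; apply/eqP; congr #|jumps _|.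
    apply/funext => j; rewrite !mxE /sorted_sum.
    rewrite (_ : (fun j0 => _) = trunc U ^~ x).
      by rewrite exchanges_nonincr// sort_net_lt.
    by apply/funext => j'; rewrite bumpf_eq0// mulr0 addr0.
  apply: (@jumps_le _ _ _ (fun j => trunc U j x + t * c j * bumpf 0 y r x)).
  - move=> j k jk; rewrite !mxE; exact: sort_net_nonincr.
  - by move=> j; rewrite mxE; exact: exchanges_val.
  move=> a b ab; rewrite !mxE -leNgt => uab.
  have -> : trunc U b x = trunc U a x.
    by apply/eqP; rewrite eq_le uab andbT; apply: nx; rewrite ab.
  (* [c] changes only from [i] to its successor, where the gap excludes equality of the two
     components. *)
  congr (_ + t * _ * _); rewrite /c ab; congr (_%:R : R); rewrite ltn_neqAle.
  case: eqP => // /val_inj ai; subst a.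
  by have := gx h b ab; rewrite ltNge uab.
have := discriminant_le (lexx 0) Q0 key; rewrite mul0r sqrrN => L2.
have {L2} L0 : L = 0 by apply/eqP; rewrite -sqrf_eq0 eq_le L2 sqr_ge0.
rewrite -[RHS]L0 /L /psum.
under eq_Rintegral do rewrite big_mkcond mulr_suml.
rewrite Rintegral_sum => [|j].
  apply: eq_bigr => j _; rewrite /c; case: (j <= i)%N.
    by rewrite mul1r.
  by rewrite mul0r; under eq_Rintegral do rewrite mul0r; rewrite Rintegral_cst// mul0r.
have sL : sqi mu (Lap (bumpf 0 y r)).
  apply: sqi_sum => k.
  have v1 : vanish (enorm y + r + 1) (partial k (bumpf 0 y r)).
    by apply: vanish_partial vb; rewrite ltrDl.
  exact: sqi_partial (smooth_partial k sb) v1.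
apply: sqi_mul => //; case: (j <= i)%N; first by case: (sU j).
exact: sqi0.
Qed.

Lemma M_psum_const U (i : 'I_N) (y : V) (r s t : R) : (0 < N)%N -> minimizer B U ->
  enorm y + r <= 1 -> 0 < s < r -> 0 < t < r ->
  {ae mu, forall x, enorm (x - y) < r -> forall j : 'I_N, j = i.+1 :> nat ->
    trunc U j x < trunc U i x} ->
  M (psum U i) y s = M (psum U i) y t.
Proof.
move=> N0 mU yr hs ht gap; have [aU _] := mU.
have rT : rintegrable mu (psum U i).
  rewrite /psum; under eq_fun do rewrite big_mkcond.
  apply: rintegrable_sum => j; case: (j <= i)%N; first exact: rintegrable_trunc.
  exact: rintegrable0.
have H := @M_lip _ _ (psum U i) y r 0 rT.
apply/eqP; rewrite -subr_eq0 -normr_le0.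
apply: (le_trans (H _ _ _ hs ht)); last by rewrite mulr0 mul0r.
move=> s' /andP[s'0 s'r]; rewrite lap_eq0 ?normr0 ?mul0r//.
  by apply: lt_le_trans yr; rewrite ltrD2l.
by apply: filterS gap => x gx hx; apply: gx; exact: lt_trans s'r.
Qed.

Definition Clip : R := (mass n)^-1 / 2 * @Clap R n N.

Lemma Clip_ge0 : 0 <= Clip.
Proof.
apply: mulr_ge0; first by rewrite divr_ge0// invr_ge0 ltW// mass_gt0.
by apply: mulr_ge0; [rewrite addr_ge0// divr_ge0|exact: exprn_ge0].
Qed.

Lemma M_trunc_lip U (i : 'I_N) (y : V) (s t : R) : (0 < N)%N -> minimizer B U ->
  0 < s < 1 - enorm y -> 0 < t < 1 - enorm y ->
  `|M (trunc U i) y s - M (trunc U i) y t| <= Clip * `|s - t|.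
Proof.
move=> N0 mU hs ht; have [aU _] := mU.
apply: (M_lip (rintegrable_trunc i aU) _ hs ht) => r /andP[r0 r1].
by apply: lap_le => //; lra.
Qed.

End harmonic_sums.

(** * Lipschitz regularity *)

Section regularization.
Context {R : realType} {n : nat}.
Local Notation V := 'rV[R]_n.
Local Notation mu := (@leb R n).
Implicit Types (u v : V -> R) (y z w : V) (s t r L : R).

Definition M_lipschitz L u := forall y s t, 0 < s < 1 - enorm y ->
  0 < t < 1 - enorm y -> `|M u y s - M u y t| <= L * `|s - t|.

(* Under [M_lipschitz L u] this is the limit of [M u y s] as [s] tends to 0,
   since [M u y s - L * s] is then nonincreasing in [s]. *)
Definition avg_lim L u y : R :=
  sup [set M u y s - L * s | s in [set s : R | 0 < s < 1 - enorm y]].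

(** Since |s - t| <= s + t, every M s - L s is at most M t + L t; the supremum is thus caught
    between M t - L t and M t + L t. *)
Lemma avg_lim_M L u y t : 0 <= L -> M_lipschitz L u -> 0 < t < 1 - enorm y ->
  `|avg_lim L u y - M u y t| <= L * t.
Proof.
move=> L0 ML ht.
have ub : ubound [set M u y s - L * s | s in [set s : R | 0 < s < 1 - enorm y]]
    (M u y t + L * t).
  move=> _ [s /= hs <-]; have := ML y s t hs ht.
  have /andP[s0 _] := hs; have /andP[t0 _] := ht.
  have st : L * `|s - t| <= L * s + L * t.
    rewrite -mulrDr ler_wpM2l// (le_trans (ler_normB _ _))//.
    by rewrite (gtr0_norm s0) (gtr0_norm t0).
  by rewrite ler_norml => /andP[_] h; rewrite lerBlDr; lra.
have in_t : [set M u y s - L * s | s in [set s : R | 0 < s < 1 - enorm y]] (M u y t - L * t).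
  by exists t.
have h1 : M u y t - L * t <= avg_lim L u y by apply: ub_le_sup => //; exists (M u y t + L * t).
have h2 : avg_lim L u y <= M u y t + L * t by apply: ge_sup => //; exists (M u y t - L * t).
by rewrite ler_norml; apply/andP; split; lra.
Qed.

(** The averages converge to [avg_lim] uniformly on the smaller ball, by [avg_lim_M], and to [u] in
    L^2, by [cvg_M]. *)
Lemma avg_lim_ae L u r : 0 <= L -> M_lipschitz L u -> sqi mu u -> vanish 1 u -> r < 1 ->
  {ae mu, forall x, enorm x < r -> avg_lim L u x = u x}.
Proof.
move=> L0 ML su vu r1; pose E := @eball R n r.
have mE : measurable E by exact: measurable_eball.
have b0 : 0 < 1 - r by rewrite subr_gt0.
(* Starting the radii at index [m] keeps them below 1 - |x| for all points of the smaller ball at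
   once. *)
have [m _ hm] := near_infty_natSinv_lt (PosNum b0).
have hr j x : E x -> 0 < hrad (m + j) < 1 - enorm x.
  rewrite /E /eball/= => hx; rewrite hrad_gt0/=.
  by have : hrad (m + j) < 1 - r := hm (m + j)%N (leq_addr _ _); move: (hrad _) => d; lra.
have cM (j : nat) x : E x -> `|avg_lim L u x - M u x (hrad (m + j))| <= L * hrad (m + j).
  by move=> hx; apply: avg_lim_M => //; exact: hr.
have mM j : measurable_fun setT (fun x => M u x (hrad j)).
  by have [] := sqi_M (@hrad_gt0 R j) su vu.
have ch : L * hrad (m + j) @[j --> \oo] --> (0 : R).
  rewrite -(mulr0 L); apply: cvgMl_tmp.
  under eq_cvg do rewrite addnC.
  by have := @cvg_hrad R; rewrite -(cvg_shiftn m).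
have mrepr : measurable_fun E (avg_lim L u).
  apply: (@measurable_fun_cvg _ _ _ _ (fun j x => M u x (hrad (m + j)))).
    by move=> j; exact: measurable_funTS.
  move=> x hx; apply/cvgrPdist_le => e e0; near=> j.
  apply: (le_trans (cM j x hx)); near: j.
  exact: (@cvgr_le _ _ _ _ _ _ ch).
pose h := (fun x => avg_lim L u x - u x) \_ E : V -> R.
have mh : measurable_fun setT h.
  apply/(measurable_restrictT _ mE); apply: measurable_funB => //.
  by apply: measurable_funTS; case: su.
pose g j x := `|M u x (hrad (m + j)) - u x| + L * hrad (m + j) * \1_E x.
have sg1 j : sqi mu (fun x => M u x (hrad (m + j)) - u x).
  by apply: sqiB => //; apply: sqi_M => //; exact: hrad_gt0.
have sg2 : sqi mu (\1_E : V -> R) by exact: sqi_indic_eball.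
have sg j : sqi mu (g j).
  by apply: sqiD; [exact: sqi_norm|exact: sqiZ].
have hg j x : `|h x| <= `|g j x|.
  rewrite [leRHS]ger0_norm; last first.
    by rewrite addr_ge0// mulr_ge0// mulr_ge0// ltW// hrad_gt0.
  rewrite /h /g patchE indicE; case: ifPn => hx; last by rewrite normr0 mulr0 addr0.
  rewrite mulr1 (le_trans (ler_distD (M u x (hrad (m + j))) _ _))//.
  by rewrite addrC lerD2l; apply: cM; move: hx; rewrite inE.
have sh : sqi mu h by exact: le_sqi mh (sg 0) (hg 0).
have h0 : sqn mu h <= 0.
  have c1 : sqn mu (fun x => M u x (hrad (m + j)) - u x) @[j --> \oo] --> 0.
    under eq_cvg do rewrite addnC.
    have := cvg_M su vu; rewrite -(cvg_shiftn m); exact.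
  have c2 : (L * hrad (m + j)) ^+ 2 * sqn mu (\1_E : V -> R) @[j --> \oo] --> 0.
    have := cvgM (cvgM ch ch) (cvg_cst (sqn mu (\1_E : V -> R))).
    by rewrite !mul0r; apply.
  have c3 : 2 * (sqn mu (fun x => M u x (hrad (m + j)) - u x) +
      (L * hrad (m + j)) ^+ 2 * sqn mu (\1_E : V -> R)) @[j --> \oo] --> 0.
    have := cvgM (cvg_cst (2 : R)) (cvgD c1 c2).
    by rewrite addr0 mulr0; apply.
  have H := @cvgr_to_ge _ _ _ _ _ _ (sqn mu h) c3.
  apply: H; apply: nearW => j.
  apply: (le_trans (le_sqn sh (sg j) (hg j))).
  apply: (le_trans (sqnD_le (sqi_norm (sg1 j)) (sqiZ _ sg2))).
  rewrite ler_wpM2l// sqnZ// lerD2r le_eqVlt; apply/orP; left; apply/eqP.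
  by apply: eq_Rintegral => x _; rewrite real_normK ?num_real.
have : {ae mu, forall x, setT x -> h x = 0}.
  apply: ae_eq0_of_sqn => //; move: h0; rewrite /sqn.
  by under [X in _ -> X <= _]eq_Rintegral do rewrite indicT mul1r.
apply: filterS => x /(_ I); rewrite /h patchE => hx xr.
by move: hx; rewrite mem_set// => /eqP; rewrite subr_eq0 => /eqP.
Unshelve. all: by end_near.
Qed.

End regularization.

(** From a maximum outside [K] one walks right. The midpoint inequality lets the drop between
    neighbours grow by at most c per step, so d steps lose at most d^2 c in total, and the walk
    meets [K] at N at the latest. *)
Lemma discrete_max_principle (R : realFieldType) (a : nat -> R) (K : pred nat)
    (N : nat) (c m : R) : 0 <= c -> K 0%N -> K N ->
  (forall i, (i <= N)%N -> K i -> a i <= m) ->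
  (forall i, (i.+1 < N)%N -> ~~ K i.+1 -> 2 * a i.+1 <= a i + a i.+2 + c) ->
  forall i, (i <= N)%N -> a i <= m + N%:R ^+ 2 * c.
Proof.
move=> c0 K0 KN aK acc i iN.
have c_le (d : nat) : (d <= N)%N -> d%:R ^+ 2 * c <= N%:R ^+ 2 * c.
  by move=> dN; rewrite ler_wpM2r// ler_sqr ?nnegrE// ler_nat.
pose p := [arg max_(j > (ord0 : 'I_N.+1)) a j]%O.
have ap (j : nat) : (j <= N)%N -> a j <= a p.
  rewrite /p; case: arg_maxP => //= q _ hq jN; exact: (hq (Ordinal (jN : (j < N.+1)%N))).
have pN : (p <= N)%N by rewrite -ltnS.
apply: (le_trans (ap i iN)).
have [Kp|Kp] := boolP (K p).
  apply: (le_trans (aK p pN Kp)); rewrite lerDl mulr_ge0// sqr_ge0//.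
have p0 : (0 < p)%N by case: (nat_of_ord p) Kp => //; rewrite K0.
have pltN : (p < N)%N by rewrite ltn_neqAle pN andbT; apply: contra Kp => /eqP ->.
have walk (d : nat) : (p + d < N)%N -> (exists2 j, (j <= N)%N & K j /\ a p <= a j + N%:R ^+ 2 * c) \/
    (a p <= a (p + d).+1 + d.+1%:R ^+ 2 * c /\ a (p + d)%N <= a (p + d).+1 + d.+1%:R * c).
  elim: d => [|d IH] hd.
    right; rewrite addn0 in hd *; rewrite expr1n mul1r.
    have := acc p.-1; rewrite prednK// => /(_ pltN Kp) h1.
    have h2 := ap p.-1 (leq_trans (leq_pred _) pN).
    by split; lra.
  rewrite addnS in hd *.
  have [|[h1 h2]] := IH (ltnW hd); first by left.
  have [Kj|Kj] := boolP (K (p + d).+1).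
    left; exists (p + d).+1; first exact: ltnW.
    split=> //; apply: (le_trans h1); rewrite lerD2l; apply: c_le.
    by apply: leq_trans (ltnW hd); rewrite ltnS leq_addl.
  right; have h3 := acc _ hd Kj.
  have h4 : d.+2%:R ^+ 2 = (d.+1%:R ^+ 2 + d.+2%:R + d.+1%:R :> R).
    by rewrite -[d.+2]addn1 natrD; ring.
  have h5 : d.+2%:R = d.+1%:R + 1 :> R by rewrite -[d.+2]addn1 natrD.
  have h6 : 0 <= d.+1%:R * c by rewrite mulr_ge0.
  rewrite h4 h5; move: (d.+1%:R : R) h1 h2 h6 => e h1 h2 h6.
  by split; lra.
have hd : (p + (N - p).-1 < N)%N by rewrite -ltn_subRL prednK// subn_gt0.
have [[j jN [Kj apj]]|[h _]] := walk _ hd.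
  by apply: (le_trans apj); rewrite lerD2r aK.
have E : (p + (N - p).-1).+1 = N by rewrite -addnS prednK ?subn_gt0// subnKC// ltnW.
rewrite E prednK ?subn_gt0// in h; apply: (le_trans h); apply: lerD; first exact: aK.
by apply: c_le; exact: leq_subr.
Qed.

(** * Descent along dyadic scales *)

Section dyadic_iteration.
Context {R : realType} {n : nat}.
Local Notation V := 'rV[R]_n.
Local Notation mu := (@leb R n).
Implicit Types (u : nat -> V -> R) (y z w : V) (s t r L : R).

(** Indexed by the number of terms: the empty sum is available, and the end points of the maximum
    principle are the indices 0 and N. *)
Definition psums u m x : R := \sum_(j < m) u j x.

(** What the iteration uses of a minimizer, with natural numbers as indices. In [rf_harmonic] the
    separation premise is vacuous for the last component, so the sum of all components is harmonic
    unconditionally. *)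
Record regular_family (N : nat) L u : Prop := RegularFamily {
  rf_L : 0 <= L ;
  rf_sqi : forall m, sqi mu (u m) ;
  rf_vanish : forall m, vanish 1 (u m) ;
  rf_lip : forall m, M_lipschitz L (u m) ;
  rf_order : forall m, (m.+1 < N)%N -> {ae mu, forall x, u m.+1 x <= u m x} ;
  rf_harmonic : forall m y r s t, (m < N)%N -> enorm y + r <= 1 ->
    0 < s < r -> 0 < t < r ->
    ((m.+1 < N)%N -> {ae mu, forall x, enorm (x - y) < r -> u m.+1 x < u m x}) ->
    M (psums u m.+1) y s = M (psums u m.+1) y t }.

Context {N : nat} {L : R} {u : nat -> V -> R}.
Context (rf : regular_family N L u).

Let ru m : rintegrable mu (u m).
Proof. exact: sqi_rintegrable (rf_sqi rf m) (rf_vanish rf m). Qed.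

Let rS m : rintegrable mu (psums u m).
Proof. by apply: rintegrable_sum => j; exact: ru. Qed.

Lemma M_psumsS m y s : 0 < s -> M (psums u m.+1) y s = M (psums u m) y s + M (u m) y s.
Proof.
move=> s0; rewrite -MD//; apply: eq_Rintegral => x _.
by rewrite /psums big_ord_recr.
Qed.

Lemma M_psums0 y s : M (psums u 0) y s = 0.
Proof.
rewrite /M /psums; under eq_Rintegral do rewrite big_ord0 mul0r.
by rewrite Rintegral_cst// mul0r.
Qed.

Local Notation ut m := (avg_lim L (u m)).

Definition contact_const : R := 20 * L * @Cker R n.

Lemma contact_const_ge0 : 0 <= contact_const.
Proof. by rewrite mulr_ge0 ?Cker_ge0// mulr_ge0// (rf_L rf). Qed.

(** At a contact point both components have averages within 10 L s of [avg_lim] at radius 10 s, so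
    their nonnegative difference has average at most 20 L s. By [ker_diff_le] this is multiplied by
    a constant times |y - z| / s, and the scale cancels. *)
Lemma contact_le m y z w s : (m.+1 < N)%N -> 0 < s -> enorm (y - z) <= s ->
  enorm (y - w) <= 3 * s -> enorm w + 10 * s < 1 -> ut m w <= ut m.+1 w ->
  `|(M (u m) y s - M (u m.+1) y s) - (M (u m) z s - M (u m.+1) z s)| <=
  contact_const * enorm (y - z).
Proof.
move=> mN s0 yz yw ws touch; pose f x := u m x - u m.+1 x.
have s10 : 0 < 10 * s by rewrite mulr_gt0.
have rF : rintegrable mu f by exact: rintegrableB.
have ra : rintegrable mu (fun x => `|f x|) by exact: rintegrable_norm.
have ik p t : 0 < t -> rintegrable mu (fun x => f x * ker p t x).
  by move=> t0; exact: rintegrable_uker.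
have rk : rintegrable mu (fun x => `|f x| * ker w (10 * s) x) by exact: rintegrable_uker.
have ME p t : 0 < t -> M (u m) p t - M (u m.+1) p t = M f p t.
  by move=> t0; exact: esym (MB p t0 (ru m) (ru m.+1)).
have -> : M (u m) y s - M (u m.+1) y s - (M (u m) z s - M (u m.+1) z s) =
    M f y s - M f z s by exact: (f_equal2 (fun a b : R => a - b)) (ME y s s0) (ME z s s0).
have -> : M f y s - M f z s = \int[mu]_x (f x * ker y s x - f x * ker z s x).
  by rewrite [RHS]RintegralB//; exact: ik.
apply: (le_trans (le_normr_Rintegral measurableT (rintegrableB (ik y s s0) (ik z s s0)))).
pose q : R := @Cker R n * (enorm (y - z) / s).
have q0 : 0 <= q by rewrite mulr_ge0 ?Cker_ge0// divr_ge0 ?enorm_ge0// ltW.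
apply: (@le_trans _ _ (\int[mu]_x (q * (`|f x| * ker w (10 * s) x)))).
  apply: le_RintegralT; [|exact: rintegrableZ|].
    by apply: rintegrable_norm; apply: rintegrableB; exact: ik.
  move=> x; rewrite -mulrBr normrM mulrCA ler_wpM2l//.
  exact: ker_diff_le.
rewrite RintegralZl//.
have -> : \int[mu]_x (`|f x| * ker w (10 * s) x) = M f w (10 * s).
  apply: eq_Rintegral_ae.
  - exact: rintegrable_measurable rk.
  - exact: rintegrable_measurable (ik w _ s10).
  have := rf_order rf mN; apply: filterS => x hx.
  by rewrite ger0_norm// subr_ge0.
rewrite -(ME w _ s10).
have hs : 0 < 10 * s < 1 - enorm w by apply/andP; split; lra.
have h1 := avg_lim_M (rf_L rf) (@rf_lip _ _ _ rf m) hs.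
have h2 := avg_lim_M (rf_L rf) (@rf_lip _ _ _ rf m.+1) hs.
have h3 : M (u m) w (10 * s) - M (u m.+1) w (10 * s) <= 20 * L * s.
  by move: h1 h2; rewrite !ler_norml => /andP[h1 _] /andP[_ h2]; lra.
apply: (le_trans (ler_wpM2l q0 h3)); rewrite /q /contact_const.
rewrite le_eqVlt; apply/orP; left; apply/eqP; field; rewrite gt_eqF//.
Qed.

(** The factor 1/32 keeps the balls of the iteration inside the unit ball when |y| < 1/2, including
    those of radius 10 [scale k.+1] around contact points within 3 [scale k.+1] of [y]. *)
Definition scale (k : nat) : R := 2^-1 ^+ k / 32.

Lemma scale_gt0 k : 0 < scale k.
Proof. by rewrite divr_gt0// exprn_gt0// invr_gt0. Qed.

Lemma scaleS k : scale k.+1 = scale k / 2.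
Proof. by rewrite /scale exprS; field. Qed.

Lemma scale_le k : scale k <= 1 / 32.
Proof. by rewrite /scale ler_wpM2r// exprn_ile1// invf_le1// ler1n. Qed.

(** Index [m] refers to the gap between the components [m.-1] and [m]. The indices 0 and N are
    included because the empty sum and the full sum have averages independent of the radius without
    any condition. *)
Definition separated k y (m : nat) : bool := [|| m == 0%N, m == N |
  `[< forall x, enorm (x - y) < 3 * scale k.+1 -> ut m x < ut m.-1 x >]].

Context {y z : V}.
Context (y2 : enorm y < 2^-1) (z2 : enorm z < 2^-1).
Local Notation rho := (enorm (y - z)).

Definition osc k m : R := `|M (psums u m) y (scale k) - M (psums u m) z (scale k)|.

Lemma separated_S k m : separated k y m -> separated k.+1 y m.
Proof.
rewrite /separated => /or3P[->//|->|/asboolP h]; first by rewrite orbT.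
apply/or3P/Or33/asboolP => x hx; apply: h; apply: (lt_le_trans hx).
by have := scale_gt0 k.+1; rewrite (scaleS k.+1); lra.
Qed.

Lemma osc_separated k m : (m <= N)%N -> separated k y m -> 4 * rho <= scale k ->
  osc k.+1 m = osc k m.
Proof.
case: m => [|m] mN sep hr; first by rewrite /osc !M_psums0.
have sk0 := scale_gt0 k; have skle := scale_le k.
(* Larger than [scale k], as [rf_harmonic] compares radii strictly below [r], yet r + |y - z| <= 3
   [scale k.+1], so that the ball around [z] stays in the region of separation. *)
pose r := 5 / 4 * scale k.
have gap (p : V) : enorm (p - y) <= rho -> (m.+1 < N)%N ->
    {ae mu, forall x, enorm (x - p) < r -> u m.+1 x < u m x}.
  move=> py mN'; move: sep; rewrite /separated/= (ltn_eqF mN')/= => /asboolP h.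
  have q1 : 3 / 4 < 1 :> R by lra.
  have e1 := avg_lim_ae (rf_L rf) (@rf_lip _ _ _ rf m) (rf_sqi rf m) (rf_vanish rf m) q1.
  have e2 := avg_lim_ae (rf_L rf) (@rf_lip _ _ _ rf m.+1) (rf_sqi rf m.+1) (rf_vanish rf m.+1) q1.
  move: e1 e2; apply: filterS2 => x e1 e2 xp.
  have xy : enorm (x - y) < 3 * scale k.+1.
    have := enorm_triangle p x y; rewrite scaleS; move: xp; rewrite /r; lra.
  have hx : enorm x < 3 / 4.
    have := enorm_triangle y x 0; rewrite !subr0; move: xy y2; rewrite scaleS; lra.
  by rewrite -e1// -e2//; exact: h.
have H (p : V) : enorm p < 2^-1 -> enorm (p - y) <= rho ->
    M (psums u m.+1) p (scale k.+1) = M (psums u m.+1) p (scale k).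
  move=> p2 py; apply: (rf_harmonic rf (r := r)) => //.
  - by rewrite /r; lra.
  - by rewrite scale_gt0 scaleS /r/=; lra.
  - by rewrite sk0 /r/=; lra.
  - exact: gap.
have yy : enorm (y - y) <= rho by rewrite subrr enorm0 enorm_ge0.
have zy : enorm (z - y) <= rho by rewrite enormBC.
by rewrite /osc (H y y2 yy) (H z z2 zy).
Qed.

Lemma osc_contact k m : (m.+1 < N)%N -> ~~ separated k y m.+1 -> 4 * rho <= scale k ->
  2 * osc k.+1 m.+1 <= osc k.+1 m + osc k.+1 m.+2 + contact_const * rho.
Proof.
move=> mN nsep hr.
have [w wy hw] : exists2 w, enorm (w - y) < 3 * scale k.+1 & ut m w <= ut m.+1 w.
  apply: contrapT => h; case/negP: nsep; apply/or3P/Or33/asboolP => x hx; rewrite ltNge; apply/negP => le.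
  by apply: h; exists x.
have sk0 := scale_gt0 k.+1; have skle := scale_le k; have r0 := enorm_ge0 (y - z).
have w1 := enorm_triangle y w 0; rewrite !subr0 in w1.
have sk := scaleS k; have y1 := y2.
have h1 : rho <= scale k.+1 by lra.
have h2 : enorm (y - w) <= 3 * scale k.+1 by rewrite enormBC ltW.
have h3 : enorm w + 10 * scale k.+1 < 1 by lra.
have {h1 h2 h3} := contact_le mN sk0 h1 h2 h3 hw.
rewrite /osc !M_psumsS//; move: (contact_const * _) => c.
set a := M (psums u m) y _; set b := M (psums u m) z _.
set p := M (u m) y _; set q := M (u m) z _.
set p' := M (u m.+1) y _; set q' := M (u m.+1) z _.
move: a b p q p' q' => a b p q p' q' h {hr}.
have e : 2 * ((a + p) - (b + q)) = ((p - p') - (q - q')) + ((a - b) + ((a + p + p') - (b + q + q'))) by ring.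
rewrite -[X in X * _ <= _](@ger0_norm _ 2)// -normrM e.
apply: (le_trans (ler_normD _ _)); rewrite addrC lerD//.
exact: ler_normD.
Qed.

Definition sep_set k : {set 'I_N.+1} := [set m : 'I_N.+1 | separated k y m]%SET.

Local Notation sep_count k := #|sep_set k|.

(** Separation is tested at scale k while the sums are averaged at scale k.+1: separated indices
    inherit their oscillation from scale k, the others satisfy the midpoint inequality of
    [osc_contact]. *)
Lemma osc_le_of_separated k m0 : 4 * rho <= scale k ->
  (forall m, (m <= N)%N -> separated k y m -> osc k m <= m0) ->
  forall m, (m <= N)%N -> osc k.+1 m <= m0 + N%:R ^+ 2 * (contact_const * rho).
Proof.
move=> hr h; apply: (@discrete_max_principle _ _ (separated k y)).
- by rewrite mulr_ge0 ?enorm_ge0// contact_const_ge0.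
- by [].
- by rewrite /separated eqxx orbT.
- by move=> m mN sm; rewrite osc_separated//; exact: h.
- by move=> m mN sm; exact: osc_contact.
Qed.

Lemma osc_separated_le k A : 0 <= A -> (forall m, (m <= N)%N -> osc 0 m <= A) ->
  4 * rho <= scale k -> forall m, (m <= N)%N -> separated k y m ->
  osc k m <= A + (sep_count k)%:R * (N%:R ^+ 2 * (contact_const * rho)).
Proof.
move=> A0 hA; have B0 : 0 <= N%:R ^+ 2 * (contact_const * rho).
  by rewrite mulr_ge0 ?sqr_ge0// mulr_ge0 ?enorm_ge0// contact_const_ge0.
elim: k => [|k IH] hr m mN sm.
  by apply: (le_trans (hA m mN)); rewrite lerDl mulr_ge0.
have hr' : 4 * rho <= scale k.
  by apply: (le_trans hr); rewrite scaleS; have := scale_gt0 k; lra.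
have sub : sep_set k \subset sep_set k.+1.
  by apply/fintype.subsetP => j; rewrite !inE; exact: separated_S.
(* If no index is gained, [m] was already separated and its oscillation is unchanged; otherwise the
   larger count pays for one use of the maximum principle. *)
have [eqK|neK] := eqVneq (sep_count k) (sep_count k.+1).
  have skm : separated k y m.
    have : sep_set k = sep_set k.+1.
      by apply/eqP; rewrite eqEcard sub/= eqK.
    move/setP/(_ (Ordinal (mN : (m < N.+1)%N))); rewrite !inE/=.
    by rewrite sm => ->.
  by rewrite -eqK osc_separated//; exact: IH.
have lt : (sep_count k < sep_count k.+1)%N by rewrite ltn_neqAle neK subset_leq_card.
apply: (le_trans (osc_le_of_separated hr' (IH hr') mN)).
rewrite -addrA lerD2l -{2}[N%:R ^+ 2 * _]mul1r -mulrDl ler_wpM2r//.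
by rewrite natr1 ler_nat.
Qed.

(** A component is the difference of two consecutive partial sums, hence the factors 2; at each of
    the two points the average differs from [avg_lim] by at most L times the final scale, hence 8
    L. *)
Lemma avg_lim_lip_near A m : (m < N)%N -> 0 <= A -> 128 * rho <= 1 -> 0 < rho ->
  (forall m, (m <= N)%N -> osc 0 m <= A) ->
  `|ut m y - ut m z| <=
  2 * A + (2 * (N.+2%:R * (N%:R ^+ 2 * contact_const)) + 8 * L) * rho.
Proof.
move=> mN A0 hr r0 hA.
have [k hk] : exists k, scale k < 4 * rho.
  have [k hk] : exists k : nat, (4 * rho)^-1 < k%:R.
    by exists (Num.truncn (4 * rho)^-1).+1; exact: truncnS_gt.
  exists k; apply: (@le_lt_trans _ _ (k%:R^-1)).
    have k0 : (0 : R) < k%:R by apply: lt_trans hk; rewrite invr_gt0 mulr_gt0.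
    apply: (@le_trans _ _ (2^-1 ^+ k)); last first.
      by rewrite exprVn lef_pV2 ?posrE// ?exprn_gt0// -natrX ler_nat ltnW// ltn_expl.
    by rewrite /scale ler_piMr ?exprn_ge0 ?invr_ge0//; lra.
  rewrite -[ltRHS]invrK ltf_pV2 ?posrE ?invr_gt0 ?mulr_gt0//.
  by apply: lt_trans hk; rewrite invr_gt0 mulr_gt0.
have exk : exists k, scale k < 4 * rho by exists k.
(* The last scale with 4 |y - z| <= [scale j]; the assumption [128 * rho <= 1] is this condition at
   scale 0. Stopping here makes the remaining error L [scale j.+1] comparable to |y - z|. *)
have [j hj] : exists2 j, 4 * rho <= scale j & scale j.+1 < 4 * rho.
  case: (ex_minnP exk) => -[|j] h1 h2.
    by move: h1; rewrite /scale expr0; lra.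
  exists j => //; rewrite leNgt; apply/negP => /h2; by rewrite ltnn.
move=> hj1.
have B0 : 0 <= N%:R ^+ 2 * (contact_const * rho).
  by rewrite mulr_ge0 ?sqr_ge0// mulr_ge0 ?enorm_ge0// contact_const_ge0.
have Hs := osc_le_of_separated hj (osc_separated_le A0 hA hj).
have cnt : (sep_count j)%:R <= N.+1%:R :> R.
  by rewrite ler_nat (leq_trans (max_card _))// card_ord.
(* N + 2 counts the at most N + 1 separated indices and one last use of the maximum principle from
   scale j to j.+1. *)
have H p : (p <= N)%N -> osc j.+1 p <= A + N.+2%:R * (N%:R ^+ 2 * (contact_const * rho)).
  move=> pN; apply: (le_trans (Hs p pN)); rewrite -addrA lerD2l.
  by rewrite -[N.+2%:R]natr1 mulrDl mul1r lerD2r ler_wpM2r.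
have s0 := scale_gt0 j.+1; have sle := scale_le j.+1.
have ty : 0 < scale j.+1 < 1 - enorm y by move: y2; rewrite s0/=; lra.
have tz : 0 < scale j.+1 < 1 - enorm z by move: z2; rewrite s0/=; lra.
have h1 := avg_lim_M (rf_L rf) (@rf_lip _ _ _ rf m) ty.
have h2 := avg_lim_M (rf_L rf) (@rf_lip _ _ _ rf m) tz.
have h3 := H m (ltnW mN); have h4 := H m.+1 mN.
have Ls : L * scale j.+1 <= 4 * (L * rho).
  by rewrite [leRHS]mulrCA ler_wpM2l ?(rf_L rf)// ltW.
move: h3 h4; rewrite /osc M_psumsS// M_psumsS//.
set c := N.+2%:R * (_ * _); set a := M (psums u m) y _; set b := M (psums u m) z _.
have -> : (2 * (N.+2%:R * (N%:R ^+ 2 * contact_const)) + 8 * L) * rho =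
  2 * c + 8 * (L * rho) by rewrite /c; ring.
move: h1 h2 Ls; move: (M (u m) y _) (M (u m) z _) (L * scale _) (L * rho) c a b.
move: (ut m y) (ut m z) => f g p q l l' c a b.
rewrite !ler_norml => /andP[h1 h1'] /andP[h2 h2'] h /andP[h3 h3'] /andP[h4 h4'].
by apply/andP; split; lra.
Qed.

End dyadic_iteration.

(** Distant points use only the sup bound, once for each; 256 is twice the inverse of the threshold
    1/128 on their distance. *)
Lemma oscillation_far (R : realFieldType) (r A s p q : R) : 0 <= r -> 0 <= A ->
  0 <= s -> 0 <= p -> 0 <= q -> 1 < 128 * r ->
  s * (1 + A) + s * (1 + A) <= (2 * p + q + 256 * s) * (1 + A) * r.
Proof.
move=> r0 A0 s0 p0 q0 r1; rewrite -subr_ge0.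
have -> : (2 * p + q + 256 * s) * (1 + A) * r - (s * (1 + A) + s * (1 + A)) =
  (2 * p + q) * (1 + A) * r + 2 * (s * (1 + A)) * (128 * r - 1) by ring.
have A1 : 0 <= 1 + A by exact: addr_ge0.
apply: addr_ge0; first by rewrite mulr_ge0// mulr_ge0// addr_ge0// mulr_ge0.
by rewrite mulr_ge0 ?subr_ge0 ?(ltW r1)// mulr_ge0// mulr_ge0.
Qed.

Lemma oscillation_near (R : realFieldType) (r A s p q : R) : 0 <= r -> 0 <= A ->
  0 <= s -> 0 <= p -> 0 <= q ->
  2 * (p * A * r) + q * r <= (2 * p + q + 256 * s) * (1 + A) * r.
Proof.
move=> r0 A0 s0 p0 q0; rewrite -subr_ge0.
have -> : (2 * p + q + 256 * s) * (1 + A) * r - (2 * (p * A * r) + q * r) =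
  2 * (p * r) + q * A * r + 256 * (s * (1 + A) * r) by ring.
have A1 : 0 <= 1 + A by exact: addr_ge0.
by rewrite !addr_ge0// ?mulr_ge0// ?mulr_ge0// mulr_ge0.
Qed.

(** * Explicit constants for minimizers and conclusion *)

Section minimizers.
Context {R : realType} {n N' : nat}.
Local Notation N := N'.+1.
Local Notation V := 'rV[R]_n.
Local Notation mu := (@leb R n).
Local Notation B := (@eball R n 1).
Local Notation L := (@Clip R n N).
Implicit Types (U : V -> 'rV[R]_N) (x y z : V).

(** Beyond the last component [inord] defaults to index 0, so the unconditional fields of
    [regular_family] hold for every natural number. *)
Definition comp_seq U (m : nat) : V -> R := trunc U (inord m).

Lemma psums_comp_seq U m : (m < N)%N -> psums (comp_seq U) m.+1 = psum U (inord m).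
Proof.
move=> mN; apply/funext => x.
rewrite /psums /psum (big_ord_widen N (fun j => comp_seq U j x))//.
by apply: eq_big => j; rewrite ?inordK// /comp_seq inord_val.
Qed.

Lemma minimizer_regular U : minimizer B U -> regular_family N L (comp_seq U).
Proof.
move=> mU; have [aU _] := mU; have sU := sob_trunc aU; split.
- exact: Clip_ge0.
- by move=> m; case: (sU (inord m)).
- by move=> m; case: (sU (inord m)).
- by move=> m y s t hs ht; exact: M_trunc_lip.
- move=> m mN; have := trunc_nonincr aU; apply: filterS => x; apply.
  by rewrite !inordK// ltnW.
move=> m y r s t mN yr hs ht gap; rewrite psums_comp_seq//.
apply: (M_psum_const _ mU yr hs ht) => //.
have [mN1|mN1] := ltnP m.+1 N; last first.
  by apply: aeW => x _ j; rewrite inordK// => jm; have := ltn_ord j; rewrite jm ltnNge mN1.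
have := gap mN1; apply: filterS => x h xr j; rewrite inordK// => jm.
by rewrite -[j]inord_val jm; exact: h.
Qed.

Definition sqmass U : R := sqn mu ((@enorm R N \o U) \_ B).

Lemma sqi_enorm U : admissible B U -> sqi mu ((@enorm R N \o U) \_ B) /\
  forall i x, `|trunc U i x| <= ((@enorm R N \o U) \_ B) x.
Proof.
move=> aU; have sU := sob_trunc aU.
have E x : ((@enorm R N \o U) \_ B) x ^+ 2 = \sum_i trunc U i x ^+ 2.
  rewrite patchE; case: ifPn => hx.
    by rewrite /= sqr_enorm; apply: eq_bigr => i _; rewrite /trunc patchE hx.
  rewrite big1 => [|i _]; first by rewrite expr0n.
  by rewrite /trunc patchE (negbTE hx) expr0n.
have g0 x : 0 <= ((@enorm R N \o U) \_ B) x.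
  by rewrite patchE; case: ifP => // _; exact: enorm_ge0.
have mE : measurable_fun setT (fun x => \sum_i trunc U i x ^+ 2).
  by apply: measurable_sum => i; apply: measurable_funX; case: (sU i) => -[].
split; last first.
  move=> i x; rewrite -(ger0_norm (g0 x)) -ler_sqr ?nnegrE// !real_normK ?num_real// E.
  by rewrite (bigD1 i)//= lerDl sumr_ge0// => j _; exact: sqr_ge0.
split.
  apply: (@eq_measurable_fun _ _ _ _ setT (fun x => Num.sqrt (\sum_i trunc U i x ^+ 2))).
    by move=> x _; rewrite -E sqrtr_sqr ger0_norm.
  apply: (measurableT_comp _ mE); apply: continuous_measurable_fun.
  exact: sqrt_continuous.
under eq_fun do rewrite E.
by apply: rintegrable_sum => i; case: (sU i) => -[].
Qed.

Lemma L2normE U : admissible B U -> L2norm B U = (Num.sqrt (sqmass U))%:E.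
Proof.
move=> /sqi_enorm [sE _].
exact: (@Lnorm2_sqi _ _ _ (@lebesgue_rV R n) _ sE).
Qed.

(** Square root of the volume of the unit ball, the price of passing from L^2 to L^1. *)
Definition ball_const : R := Num.sqrt (sqn mu (\1_B : V -> R)).

Lemma Rintegral_trunc_le U i : admissible B U ->
  \int[mu]_x `|trunc U i x| <= Num.sqrt (sqmass U) * ball_const.
Proof.
move=> aU; have [sE hE] := sqi_enorm aU; have [sU vU _ _ _] := sob_trunc aU i.
have sB : sqi mu (\1_B : V -> R) by exact: sqi_indic_eball.
apply: (@le_trans _ _ (Num.sqrt (sqn mu (fun x => `|trunc U i x|)) * ball_const)).
  apply: le_trans (norm_Rintegral_mul_le (sqi_norm sU) sB).
  apply: le_trans (ler_norm _); rewrite le_eqVlt; apply/orP; left; apply/eqP.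
  apply: eq_Rintegral => x _; have [h|h] := ltP (enorm x) 1.
    by rewrite indicE mem_set// mulr1.
  by rewrite vU// normr0 mul0r.
rewrite ler_wpM2r ?sqrtr_ge0// ler_sqrt ?sqn_ge0//.
apply: le_sqn => //; first exact: sqi_norm.
by move=> x; rewrite normr_id (le_trans (hE i x))// ler_norm.
Qed.

Lemma mass_inv_ge0 : 0 <= (mass n)^-1 :> R.
Proof. by rewrite invr_ge0 ltW// mass_gt0. Qed.

(** Uses averages at radius 1/4, which fits inside the unit ball when |y| < 1/2: the first summand
    bounds them by the L^2 norm, the second covers their distance to [avg_lim]. *)
Definition sup_const : R := (mass n)^-1 * 4^-1^-1 ^+ n * 2 * ball_const + L.

Lemma avg_lim_trunc_le U i y : minimizer B U -> enorm y < 2^-1 ->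
  `|avg_lim L (trunc U i) y| <= sup_const * (1 + Num.sqrt (sqmass U)).
Proof.
move=> mU y2; have [aU _] := mU; have rU := rintegrable_trunc i aU.
have L0 : 0 <= L := Clip_ge0.
have h4 : 0 < 4^-1 :> R by rewrite invr_gt0.
have hy : 0 < (4^-1 : R) < 1 - enorm y by apply/andP; split; lra.
have lipU : M_lipschitz L (trunc U i) by move=> p s t hs ht; exact: M_trunc_lip.
have h1 := avg_lim_M L0 lipU hy; have h2 := M_le y h4 rU.
have h3 := Rintegral_trunc_le i aU.
have q0 : 0 <= (mass n)^-1 * 4^-1^-1 ^+ n * 2 :> R.
  by rewrite mulr_ge0// mulr_ge0 ?mass_inv_ge0// exprn_ge0// invr_ge0 ltW.
have h5 := ler_wpM2l q0 h3; have A0 := sqrtr_ge0 (sqmass U).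
have b0 : 0 <= ball_const by exact: sqrtr_ge0.
have h6 : `|avg_lim L (trunc U i) y| <= `|avg_lim L (trunc U i) y - M (trunc U i) y 4^-1| + `|M (trunc U i) y 4^-1|.
  by rewrite -[X in `|X| <= _](subrK (M (trunc U i) y 4^-1)); exact: ler_normD.
have aux (a b c d A e l q : R) : 0 <= q -> 0 <= l -> 0 <= A -> 0 <= e ->
    a <= b + c -> b <= l * 4^-1 -> c <= q * d -> q * d <= q * (A * e) ->
    a <= (q * e + l) * (1 + A).
  move=> q1 l0 A1 e0 k1 k2 k3 k4; have qe : 0 <= q * e by exact: mulr_ge0.
  have lA : 0 <= l * A by exact: mulr_ge0.
  lra.
exact: aux q0 L0 A0 b0 h6 h1 h2 h5.
Qed.

(** Bound at the initial scale 1/32: at most N components, each estimated by [ker_lip], where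
    dividing by the scale gives the second factor 32. *)
Definition osc_const : R :=
  N%:R * ((mass n)^-1 * 32^-1^-1 ^+ n * (144 * 32) * ball_const).

Lemma osc0_le U y z m : admissible B U -> 128 * enorm (y - z) <= 1 -> (m <= N)%N ->
  @osc R n (comp_seq U) y z 0 m <= osc_const * Num.sqrt (sqmass U) * enorm (y - z).
Proof.
move=> aU hr mN; have sE : scale 0 = 32^-1 :> R by rewrite /scale expr0 mul1r.
have h0 : 0 < 32^-1 :> R by rewrite invr_gt0.
have r0 := enorm_ge0 (y - z).
have yz : enorm (y - z) <= 32^-1 by lra.
have ru (j : nat) : rintegrable mu (comp_seq U j) by exact: rintegrable_trunc.
pose K : R := (mass n)^-1 * 32^-1^-1 ^+ n * (144 * (enorm (y - z) / 32^-1)).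
have K0 : 0 <= K.
  by rewrite mulr_ge0// ?mulr_ge0 ?divr_ge0// ?mass_inv_ge0// exprn_ge0// invr_ge0 ltW.
have one (j : nat) : `|M (comp_seq U j) y 32^-1 - M (comp_seq U j) z 32^-1| <=
    K * (Num.sqrt (sqmass U) * ball_const).
  have i1 := rintegrable_uker y h0 (ru j); have i2 := rintegrable_uker z h0 (ru j).
  have ri := rintegrableB i1 i2.
  have -> : M (comp_seq U j) y 32^-1 - M (comp_seq U j) z 32^-1 =
      \int[mu]_x (comp_seq U j x * ker y 32^-1 x - comp_seq U j x * ker z 32^-1 x).
    by rewrite [RHS]RintegralB.
  apply: (le_trans (le_normr_Rintegral measurableT ri)).
  apply: le_trans (ler_wpM2l K0 (Rintegral_trunc_le (inord j) aU)).
  have rn := rintegrable_norm (rintegrable_trunc (inord j) aU).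
  rewrite -RintegralZl//.
  apply: le_RintegralT; [exact: rintegrable_norm|exact: rintegrableZ|].
  move=> x; rewrite -mulrBr normrM mulrC ler_wpM2r//.
  exact: ker_lip.
have osum p : M (psums (comp_seq U) m) p 32^-1 = \sum_(j < m) M (comp_seq U j) p 32^-1.
  by rewrite -M_sum.
rewrite /osc sE !osum -sumrB (le_trans (ler_norm_sum _ _ _))//.
apply: (@le_trans _ _ (\sum_(j < m) K * (Num.sqrt (sqmass U) * ball_const))).
  by apply: ler_sum => j _; exact: one.
rewrite sumr_const card_ord -[leLHS]mulr_natl.
have A0 := sqrtr_ge0 (sqmass U); have b0 : 0 <= ball_const by exact: sqrtr_ge0.
apply: (@le_trans _ _ (N%:R * (K * (Num.sqrt (sqmass U) * ball_const)))).
  by rewrite ler_wpM2r ?ler_nat//; apply: mulr_ge0 => //; exact: mulr_ge0.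
rewrite /osc_const /K invrK le_eqVlt; apply/orP; left; apply/eqP; ring.
Qed.

Definition lip_const : R := 2 * osc_const +
  (2 * (N.+2%:R * (N%:R ^+ 2 * @contact_const R n L)) + 8 * L) + 256 * sup_const.

Lemma sup_const_ge0 : 0 <= sup_const.
Proof.
rewrite addr_ge0 ?Clip_ge0// mulr_ge0 ?sqrtr_ge0// mulr_ge0// mulr_ge0 ?mass_inv_ge0//.
Qed.

Lemma osc_const_ge0 : 0 <= osc_const.
Proof.
rewrite mulr_ge0// mulr_ge0 ?sqrtr_ge0// mulr_ge0// mulr_ge0 ?mass_inv_ge0//.
Qed.

Lemma near_const_ge0 :
  0 <= 2 * (N.+2%:R * (N%:R ^+ 2 * @contact_const R n L)) + 8 * L.
Proof.
have L0 : 0 <= L := Clip_ge0.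
have c0 : 0 <= @contact_const R n L by rewrite mulr_ge0 ?Cker_ge0// mulr_ge0.
apply: addr_ge0; last exact: mulr_ge0.
by apply: mulr_ge0 => //; apply: mulr_ge0 => //; apply: mulr_ge0.
Qed.

Lemma lip_const_ge0 : 0 <= lip_const.
Proof.
rewrite /lip_const; apply: addr_ge0; last by rewrite mulr_ge0// sup_const_ge0.
apply: addr_ge0; last exact: near_const_ge0.
by rewrite mulr_ge0// osc_const_ge0.
Qed.

Lemma avg_lim_trunc_lip U i y z : minimizer B U -> enorm y < 2^-1 -> enorm z < 2^-1 ->
  `|avg_lim L (trunc U i) y - avg_lim L (trunc U i) z| <=
  lip_const * (1 + Num.sqrt (sqmass U)) * enorm (y - z).
Proof.
move=> mU y2 z2; have [aU _] := mU; have rf := minimizer_regular mU.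
have A0 := sqrtr_ge0 (sqmass U); have r0 := enorm_ge0 (y - z).
have p0 := osc_const_ge0; have q0 := near_const_ge0; have s0 := sup_const_ge0.
have hy := avg_lim_trunc_le i mU y2; have hz := avg_lim_trunc_le i mU z2.
rewrite /lip_const.
(* Beyond distance 1/128 the sup bound suffices; below it the dyadic iteration applies. *)
have [r1|r1] := leP (128 * enorm (y - z)) 1; last first.
  apply: (le_trans (ler_normB _ _)); apply: (le_trans (lerD hy hz)).
  exact: oscillation_far.
move: r0; rewrite le_eqVlt => /orP[/eqP r0|r0].
  have yz : y = z.
    apply/eqP; rewrite -subr_eq0; apply/eqP/rowP => k; rewrite [RHS]mxE.
    by apply/eqP; rewrite -normr_le0 r0; exact: le_coord_enorm.
  by rewrite yz !subrr normr0 enorm0 mulr0.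
have := @avg_lim_lip_near _ _ _ _ _ rf y z y2 z2 (osc_const * Num.sqrt (sqmass U) * enorm (y - z)) i.
rewrite /comp_seq inord_val => H.
have {}H := H (ltn_ord i) _ r1 r0 (fun m mN => osc0_le aU r1 mN).
have r0' := ltW r0.
apply: (le_trans (H _)); first by rewrite mulr_ge0// mulr_ge0.
exact: oscillation_near.
Qed.

End minimizers.

Lemma enorm_le_coord (R : realType) (N : nat) (x : 'rV[R]_N) (c : R) : 0 <= c ->
  (forall i, `|x 0 i| <= c) -> enorm x <= N%:R * c.
Proof.
move=> c0 hx; apply: (le_trans (enorm_le_norm x)); rewrite ler_wpM2l//.
rewrite /Num.norm/= mx_normrE; apply: bigmax_le => // -[i j] _ /=.
by rewrite ord1.
Qed.

Theorem theorem1p1 (R : realType) (n N : nat) (hn : (1 <= n)%N)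
    (hN : (2 <= N)%N) :
  exists C : R, 0 < C /\
    forall U : 'rV[R]_n -> 'rV[R]_N, minimizer (eball n 1) U ->
      exists Ut : 'rV[R]_n -> 'rV[R]_N,
        [/\ {ae lebesgue_rV n, forall x, eball n 2^-1 x -> Ut x = U x},
            [lipschitz Ut x | x in eball n 2^-1] &
            (C01norm (eball n 2^-1) Ut <= C%:E * (1 + L2norm (eball n 1) U))%E].
Proof.
case: N hN => // N' _.
have sup0 : 0 <= @sup_const R n N' by exact: sup_const_ge0.
have lip0 : 0 <= @lip_const R n N' by exact: lip_const_ge0.
(* The components cost a factor N in the Euclidean norm; the summand 1 ensures strict positivity. *)
exists (N'.+1%:R * @sup_const R n N' + N'.+1%:R * @lip_const R n N' + 1).
have S0 : 0 <= N'.+1%:R * @sup_const R n N' by exact: mulr_ge0.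
have K0 : 0 <= N'.+1%:R * @lip_const R n N' by exact: mulr_ge0.
split; first by rewrite ltr_wpDl// addr_ge0.
move=> U mU; have [aU _] := mU; have rf := minimizer_regular mU.
pose A := Num.sqrt (sqmass U); have A0 : 0 <= A by exact: sqrtr_ge0.
pose Ut (x : 'rV[R]_n) : 'rV[R]_N'.+1 :=
  \row_i avg_lim (@Clip R n N'.+1) (trunc U i) x.
have A1 : 0 <= 1 + A by exact: addr_ge0.
have bnd x : enorm x < 2^-1 -> enorm (Ut x) <= N'.+1%:R * @sup_const R n N' * (1 + A).
  move=> hx; rewrite -mulrA; apply: enorm_le_coord; first exact: mulr_ge0.
  by move=> i; rewrite mxE; exact: avg_lim_trunc_le.
have lip x y : enorm x < 2^-1 -> enorm y < 2^-1 ->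
    enorm (Ut x - Ut y) <= N'.+1%:R * @lip_const R n N' * (1 + A) * enorm (x - y).
  move=> hx hy; rewrite -!mulrA; apply: enorm_le_coord.
    by apply: mulr_ge0 => //; apply: mulr_ge0 => //; exact: enorm_ge0.
  by move=> i; rewrite !mxE mulrA; exact: avg_lim_trunc_lip.
exists Ut; split.
- have h12 : 2^-1 < 1 :> R by lra.
  have h m := avg_lim_ae (rf_L rf) (@rf_lip _ _ _ _ _ rf m) (rf_sqi rf m) (rf_vanish rf m) h12.
  have := ae_foralln h; apply: filterS => x hx xB; apply/rowP => i.
  rewrite mxE; have := hx i xB; rewrite /comp_seq inord_val => ->.
  by apply: restrict_in; apply: lt_trans h12.
(* The Lipschitz predicate is stated with sup norms, whence the factor [n] from [enorm_le_norm]. *)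
- pose K := N'.+1%:R * @lip_const R n N' * (1 + A) * n%:R.
  have K1 : 0 <= K by rewrite mulr_ge0// mulr_ge0.
  exists K; split; first exact: num_real.
  move=> M KM [x y] [/= hx hy].
  apply: (le_trans (norm_le_enorm _)); apply: (le_trans (lip x y hx hy)).
  apply: (@le_trans _ _ (K * `|x - y|)); last by rewrite ler_wpM2r// ltW.
  rewrite /K -[leRHS]mulrA ler_wpM2l//; first by rewrite mulr_ge0.
  exact: enorm_le_norm.
- rewrite L2normE// -EFinD -EFinM /C01norm.
  apply: (@le_trans _ _ ((N'.+1%:R * @sup_const R n N' * (1 + A))%:E +
      (N'.+1%:R * @lip_const R n N' * (1 + A))%:E)%E); last first.
    by rewrite -EFinD lee_fin !mulrDl lerDl mul1r.
  apply: leeD.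
    by apply: ge_ereal_sup => _ [x hx <-]; rewrite lee_fin; exact: bnd.
  apply: ge_ereal_sup => _ [x [y [hx hy xy ->]]]; rewrite lee_fin.
  have r0 : 0 < enorm (x - y).
    rewrite lt_neqAle enorm_ge0 andbT; apply: contra xy => /eqP r0.
    rewrite -subr_eq0; apply/eqP/rowP => k; rewrite [RHS]mxE.
    by apply/eqP; rewrite -normr_le0 r0; exact: le_coord_enorm.
  by rewrite ler_pdivrMr//; exact: lip.
Qed.
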